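(* Fix $t\in[1,2]$ and $s\in[0,1]$ such that $2t+s>3$. There exist $\eta=\eta(t,s)>0$ and $\delta_0=\delta_0(t,s)>0$ such that the following holds for all $0<\delta<\delta_0$. Let $P\subset[0,1]^2$ be a set of $\delta^{-t}$ many points. For each $p\in P$ let $\mathbb{T}_p$ be a nonempty $(\delta,s,\delta^{-\eta})$-set of $\delta$-tubes through $p$, and let $\mathbb{T}=\bigsqcup_{p\in P}\mathbb{T}_p$. Then there is a nontrivial incidence between $P$ and $\mathbb{T}$: there are a point $p\in P$ and a tube $T\in\mathbb{T}\setminus\mathbb{T}_p$ such that $p\in T$.
   Context: A $\delta$-tube is the $\delta$-neighborhood in $\mathbb{R}^2$ of a line (its central line); a tube is through $p$ if its central line passes through $p$. The union $\mathbb{T}$ is a disjoint union, so $T\in\mathbb{T}\setminus\mathbb{T}_p$ means $T\in\mathbb{T}_{p'}$ for some $p'\in P$ with $p'\neq p$. For a line $\ell$, let $d(0,\ell)$ be its distance to the origin and $\theta(\ell)\in\mathbb{R}/\pi\mathbb{Z}$ its angle, and set $d(\ell_1,\ell_2)=|d(0,\ell_1)-d(0,\ell_2)|+|\theta(\ell_1)-\theta(\ell_2)|$. Only lines with $d(0,\ell)\leq 10$ are considered. A set of lines $L$ is a $(\delta,s,C)$-set if it is $\delta$-separated in this metric and $|L\cap B_w(\ell_0)|\leq C w^s|L|$ for every ball $B_w(\ell_0)$ of radius $w\in[\delta,1]$ in this metric. A set of $\delta$-tubes is a $(\delta,s,C)$-set if the set of its central lines is. *)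

(* Defs.v *)
From mathcomp Require Import all_boot all_order all_algebra finmap.
From mathcomp Require Import all_classical all_reals all_analysis.

Set Implicit Arguments.
Unset Strict Implicit.
Unset Printing Implicit Defensive.

Import Order.TTheory GRing.Theory Num.Theory.

Local Open Scope classical_set_scope.
Local Open Scope ring_scope.

Section IncidenceDefs.
Variable R : realType.

Definition plane : Type := (R * R)%type.

(* The canonical norm on R * R is the sup norm, hence this definition. *)
Definition edist (x y : plane) : R :=
  Num.sqrt ((x.1 - y.1) ^+ 2 + (x.2 - y.2) ^+ 2).

Definition line_at (a : plane) (theta : R) : set plane :=
  [set (a.1 + r * cos theta, a.2 + r * sin theta) | r in [set: R]].

Definition is_line (l : set plane) : Prop :=
  exists a theta, l = line_at a theta.

Definition dist0 (l : set plane) : R := inf [set edist (0, 0) x | x in l].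

(* theta(l) in R/pi Z, as a coset of pi Z in R. *)
Definition angle (l : set plane) : set R :=
  [set theta | exists a, l = line_at a theta].

(* The quotient distance on R/pi Z, between two cosets of pi Z. *)
Definition angle_dist (A B : set R) : R :=
  inf [set `|x - y| | x in A & y in B].

(* Only a pseudometric: two parallel lines at the same distance from the
   origin, on opposite sides of it, are at distance 0. *)
Definition line_dist (l1 l2 : set plane) : R :=
  `|dist0 l1 - dist0 l2| + angle_dist (angle l1) (angle l2).

Definition adm_line (l : set plane) : Prop := is_line l /\ dist0 l <= 10.

Definition line_ball (l0 : set plane) (w : R) : set (set plane) :=
  [set l | adm_line l /\ line_dist l0 l < w].

(* Finiteness is implied by separation (for delta > 0), since distances to
   the origin are at most 10; it is stated so that the cardinals are visibly
   meaningful (fset_set of an infinite set is empty). *)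
Definition line_set (delta s C : R) (L : set (set plane)) : Prop :=
  [/\ L `<=` adm_line,
      finite_set L,
      forall l1 l2, L l1 -> L l2 -> l1 <> l2 -> delta <= line_dist l1 l2
    & forall l0 w, adm_line l0 -> delta <= w <= 1 ->
        #|` fset_set (L `&` line_ball l0 w)|%fset%:R
          <= C * w `^ s * #|` fset_set L|%fset%:R].

Definition nbhd (delta : R) (A : set plane) : set plane :=
  [set x | exists2 y, A y & edist x y < delta].

Definition central_line (delta : R) (T l : set plane) : Prop :=
  is_line l /\ T = nbhd delta l.

Definition tube_through (delta : R) (p : plane) (T : set plane) : Prop :=
  exists2 l, central_line delta T l & l p.

Definition central_lines (delta : R) (TT : set (set plane)) :
    set (set plane) :=
  [set l | exists2 T, TT T & central_line delta T l].

Definition tube_set (delta s C : R) (TT : set (set plane)) : Prop :=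
  line_set delta s C (central_lines delta TT).

Definition unit_square : set plane := `[0, 1] `*` `[0, 1].

End IncidenceDefs.

(* Main.v *)
Require Import Defs.
From mathcomp Require Import all_boot all_order all_algebra finmap.
From mathcomp Require Import all_classical all_reals all_analysis.
From mathcomp Require Import zify ring lra.

(* Put delta = d^N and attach to a point (x, y) of P and a line of slope a of
   its pencil the flag (x, y, a), with total weight 1 shared equally by the points
   and then by the lines of a pencil. A cell at level (i, j) collects the flags
   with x known up to d^i, a up to d^j and y - a x up to d^(i+j). By
   pigeonholing there are a subset of weight at least d and exponents f(i, j)
   such that all its cells at level (i, j), i + j <= N + 1, have mass about
   d^f(i, j).
   Rescale a typical cell to unit size, and let b_k be the weight of the pairs
   of flags such that the point of one is d^k-close to the line of the other,
   divided by d^k. Joining two flags through a third one bounds b_h below by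
   d^kappa, kappa = f(i+h, j) + f(i, j+h) - f(i, j) - f(i+h, j+h). A high-low
   inequality (compare tents of widths d^k and d^(k+1) in L^2) gives
   b_k <= 82 b_(k+1) + Err_k, where Err_k^2 is about d^S(k) with
   S(k) = f(i+k, j) + f(i, j+k) - 2 f(i, j) - 3 k. If P and the tubes have no
   nontrivial incidence, the last b_k only counts pairs with the same point.
   Hence either S(k) <= 2 kappa + O(1) for some k >= h, or a similar bound holds
   at the last scale.
   This is impossible. Indeed f(i, j) >= t N + s j - eta N when i + j = N + 1, so
   after recentring at a minimum of f - t (i + j) - s j, the function f grows
   along diagonals at the rate 2 t + s > 3 on average. Averaging over a row
   yields a level where f - 3 k grows linearly on the diagonal and where kappa is
   at most a small multiple of h. There S(k) is the sum of this growth and of the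
   mixed difference at k, so the alternative makes the latter small again for a
   larger k, and iterating, k escapes to the last scale. *)

Set Implicit Arguments.
Unset Strict Implicit.
Unset Printing Implicit Defensive.

Import Order.TTheory GRing.Theory Num.Theory.

Local Open Scope ring_scope.

(** * Exponents on a triangular grid *)

Section Comb.
Variable R : realType.
Implicit Types (G L : nat -> R) (g f : nat -> nat -> R).

(** If [f(i, j)] were [t (i + j) + s j], then [kappa] would vanish and [S(k)] would be
    [(2 t + s - 3) k], so one comparison would finish the proof. But [f] is bounded below well only
    at the last level and may be far from linear before it; the work on the grid is to find a place
    from which it behaves as in the linear case at all scales beyond some [h]. The cells are adapted
    to the maps that, after a shear, rescale [x] by [d^i], [a] by [d^j] and [y] by [d^(i+j)]. These
    preserve the incidence relation, and in a rescaled cell a square of points of side [d^k] is a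
    box of level [(i+k, j)], a ball of lines of radius [d^k] one of level [(i, j+k)]. Up to
    constants [Err_k^2] is the product of the masses of two such boxes over [d^(3k)]: [d^(2k)] is
    the area of the square, and one more [d^k] comes from the correlations of strips. [N] depends on
    [t] and [s] only and is fixed before [d] tends to 0. Hence absolute constants, powers like
    [83^N] and the number of levels cost boundedly many factors [d], that is, an additive constant
    in the exponents. *)

Definition persistent G (H i : nat) : bool :=
  [forall t : 'I_H.+1, (i <= t)%N ==> (G i <= G t)].

(** Counting in the spirit of the Pliss lemma: a sequence that must rise, by steps of at most [b],
    has many persistent times. The witness [t] has to move only when [n] overtakes it. At a
    persistent [n] the move to [n.+1] costs at most [b], since [G n <= G t]; at any other [n] a
    later, smaller value is available for free. *)
Lemma persistent_count G (b : R) (H : nat) :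
  (forall n, (n < H)%N -> G n.+1 <= G n + b) ->
  forall n, (n <= H)%N -> exists t, [/\ (n <= t)%N, (t <= H)%N &
    G t <= G 0%N + b * \sum_(0 <= i < n) (persistent G H i)%:R].
Proof.
move=> step; elim=> [_|n IHn ltnH].
  by exists 0%N; rewrite big_geq // mulr0 addr0 lexx.
have [t [nt tH Gt]] := IHn (ltnW ltnH).
rewrite big_nat_recr //=; have [pn|] := boolP (persistent G H n).
  exists n.+1; split => //; rewrite mulrDr mulr1 addrA.
  have /forallP/(_ (Ordinal (tH : (t < H.+1)%N)))/=/implyP/(_ nt) := pn.
  by move: (step n ltnH) Gt; lra.
rewrite negb_forall => /existsP[u]; rewrite negb_imply -ltNge => /andP[nu Gu].
rewrite addr0; case: (ltngtP n t) nt => // [ltnt|eqnt] _.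
  by exists t; split.
subst t; exists u; split; last by move: Gu Gt; lra.
  by rewrite ltn_neqAle nu andbT; apply/eqP => eu; move: Gu; rewrite -eu ltxx.
by rewrite -ltnS.
Qed.

Lemma sum_blocks (A B : nat -> R) (l q : nat) :
  (forall a, (a < q)%N ->
     \sum_(0 <= r < l) A (a * l + r)%N <= \sum_(0 <= r < l) B (a * l + r)%N) ->
  \sum_(0 <= d < q * l) A d <= \sum_(0 <= d < q * l) B d.
Proof.
elim: q => [|q IHq] AB; first by rewrite mul0n !big_geq.
have e : (q * l <= q.+1 * l)%N by rewrite leq_mul2r leqnSn orbT.
rewrite (big_cat_nat (leq0n _) e) [leRHS](big_cat_nat (leq0n _) e) /=.
apply: lerD; first by apply: IHq => a aq; apply: AB; rewrite ltnS ltnW.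
have sh (F : nat -> R) : \sum_(q * l <= i < q.+1 * l) F i =
    \sum_(0 <= r < l) F (q * l + r)%N.
  rewrite -{1}[(q * l)%N]add0n big_addn mulSn addnK.
  by apply: eq_bigr => i _; rewrite addnC.
by rewrite !sh; apply: AB.
Qed.

Lemma sum_shift_diff L (lo hi : R) (l h : nat) :
  (forall d, (d < l + h)%N -> lo <= L d <= hi) ->
  \sum_(0 <= d < l) (L d - L (d + h)%N) <= h%:R * (hi - lo).
Proof.
move=> bnd; rewrite sumrB.
have sh : \sum_(0 <= d < l) L (d + h)%N = \sum_(h <= d < l + h) L d.
  by rewrite -{2}[h]add0n big_addn addnK.
have e1 : \sum_(0 <= d < l + h) L d =
    \sum_(0 <= d < l) L d + \sum_(l <= d < l + h) L d.
  by rewrite -big_cat_nat // leq_addr.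
have e2 : \sum_(0 <= d < l + h) L d =
    \sum_(0 <= d < h) L d + \sum_(h <= d < l + h) L d.
  by rewrite -big_cat_nat // leq_addl.
have b1 : \sum_(0 <= d < h) L d <= h%:R * hi.
  rewrite -[h in h%:R]subn0 mulr_natl -sumr_const_nat.
  rewrite big_nat_cond [leRHS]big_nat_cond; apply: ler_sum => i.
  by rewrite andbT => /andP[_ ih]; have /bnd/andP[] : (i < l + h)%N by lia.
have b2 : h%:R * lo <= \sum_(l <= d < l + h) L d.
  rewrite -{1}(addKn l h) mulr_natl -sumr_const_nat.
  rewrite big_nat_cond [leRHS]big_nat_cond; apply: ler_sum => i.
  by rewrite andbT => /andP[_ ih]; have /bnd/andP[] : (i < l + h)%N by lia.
rewrite sh mulrBr; lra.
Qed.

(* Otherwise the density would drop by the factor 1 - z at each of the K scales. *)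
Lemma dense_block (A : nat -> nat -> bool) (K D : nat) (l : nat -> nat) (z : R) :
  0 <= z <= 1 ->
  (forall k, (k < K)%N -> (l k %| D)%N) ->
  (forall k d d', (k < K)%N -> (d < D)%N -> (d' < D)%N -> (d <= d' + l k)%N ->
     (d' <= d + l k)%N -> A k d -> A k.+1 d') ->
  (1 - z) ^+ K * D%:R < \sum_(0 <= d < D) (A 0%N d)%:R ->
  exists k a, [/\ (k < K)%N, (a * l k + l k <= D)%N &
    (1 - z) * (l k)%:R <= \sum_(0 <= r < l k) (A k (a * l k + r)%N)%:R].
Proof.
move=> z01 lD prop big0; apply: contrapT => nex.
have dec k : (k < K)%N -> \sum_(0 <= d < D) (A k d)%:R <=
    (1 - z) * \sum_(0 <= d < D) (A k.+1 d)%:R.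
  move=> kK; have /dvdnP[q Dq] := lD k kK.
  rewrite mulr_sumr Dq; apply: sum_blocks => a aq.
  have aD : (a * l k + l k <= D)%N by rewrite Dq -mulSnr leq_mul2r aq orbT.
  (* One point of [A k] in a block makes the whole block belong to [A k.+1], while by contradiction
     it fills less than [1 - z] of the block itself; a block without such a point contributes
     nothing. *)
  have [/hasP[r rl Ar]|/hasPn nA] :=
      boolP (has (fun r => A k (a * l k + r)%N) (iota 0 (l k))).
    have full r' : (r' < l k)%N -> A k.+1 (a * l k + r')%N.
      by move: rl; rewrite mem_iota => rl r'l; apply: (prop k _ _ kK _ _ _ _ Ar); lia.
    rewrite [leRHS](_ : _ = (1 - z) * (l k)%:R).
      by rewrite leNgt; apply/negP => lt; apply: nex; exists k, a; split => //; apply: ltW.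
    rewrite -mulr_sumr -[in RHS](subn0 (l k)) -sumr_const_nat; congr (_ * _).
    rewrite big_nat_cond [RHS]big_nat_cond; apply: eq_bigr => r'.
    by rewrite andbT => /andP[_ r'l]; rewrite full.
  rewrite [leLHS](_ : _ = 0).
    by apply: sumr_ge0 => r' _; apply: mulr_ge0; [lra|exact: ler0n].
  rewrite big_nat_cond big1 // => r'; rewrite andbT => /andP[_ r'l].
  by rewrite (negbTE (nA r' _)) // mem_iota.
have chain k : (k <= K)%N -> \sum_(0 <= d < D) (A 0%N d)%:R <=
    (1 - z) ^+ k * \sum_(0 <= d < D) (A k d)%:R.
  elim: k => [_|k IHk kK]; first by rewrite expr0 mul1r.
  apply: le_trans (IHk (ltnW kK)) _; rewrite exprSr -mulrA.
  by apply: ler_wpM2l (dec k kK); apply: exprn_ge0; lra.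
have := chain K (leqnn K); rewrite leNgt => /negP; apply.
apply: le_lt_trans big0; apply: ler_wpM2l; first by apply: exprn_ge0; lra.
rewrite -[D in leRHS]subn0 -sumr_const_nat; apply: ler_sum => i _.
by case: (A K i).
Qed.

Lemma expr_lt_eps (z e : R) : 0 < z < 1 -> 0 < e -> exists K, (0 < K)%N /\ (1 - z) ^+ K < e.
Proof.
move=> z01 e0.
have bern k : (1 - z) ^+ k * (1 + k%:R * z) <= 1.
  elim: k => [|k IHk]; first by rewrite expr0; lra.
  apply: le_trans IHk; rewrite exprSr -mulrA; apply: ler_wpM2l.
    by apply: exprn_ge0; lra.
  by rewrite -natr1; have := ler0n R k; nra.
have [K KP] : exists K : nat, (e * z)^-1 < K%:R.
  by exists (Num.truncn (e * z)^-1).+1; apply: Num.Theory.truncnS_gt.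
exists K; have ez : 0 < e * z by nra.
have K0 : 0 < K%:R :> R by apply: le_lt_trans KP; rewrite invr_ge0 ltW.
split; first by rewrite -(ltr0n R).
have h : 1 < K%:R * (e * z) by rewrite -ltr_pdivrMr // mul1r.
have := bern K; have : 0 < (1 - z) ^+ K by apply: exprn_gt0; lra.
nra.
Qed.

End Comb.

Section Comb2.
Variable R : realType.
Implicit Types (g : nat -> nat -> R).

(** In the overview [mixdiff] is [kappa] and [axgrow] is [S]; [endgrow] is the exponent of the
    weight of pairs with a common point, divided by the last width. The three growths are tied by
    [axgrow = mixdiff + dgrow] at equal scales. *)
Definition dgrow g (u v k : nat) : R := g (u + k)%N (v + k)%N - g u v - 3 * k%:R.
Definition mixdiff g (u v h : nat) : R :=
  g (u + h)%N v + g u (v + h)%N - g u v - g (u + h)%N (v + h)%N.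
Definition axgrow g (u v k : nat) : R :=
  g (u + k)%N v + g u (v + k)%N - 2 * g u v - 3 * k%:R.
Definition endgrow g (r u v : nat) : R :=
  g (u + (r - (u + v)))%N v - g u v - (r - (u + v))%:R.

(* With b_h of order d^mixdiff: either the error of the high-low step at scale k
   exceeds b_h, or the pairs sharing their point dominate at the last scale. *)
Definition losing g (C : R) (r u v h : nat) : Prop :=
  (exists k, [/\ (h <= k)%N, (u + v + k <= r)%N &
     axgrow g u v k <= 2 * mixdiff g u v h + C]) \/
  endgrow g r u v <= mixdiff g u v h + C.

(** Origin of the factor 3: the alternative at [h] gives [axgrow <= 2 * c * h + C] at some [k >= h],
    so a diagonal growth [3 * c * k] leaves [mixdiff <= c * k] there, because [C < 2 * c * h0]. The
    same inequality excludes [k = h], hence the scale strictly increases. *)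
Lemma losing_ascent g (c C : R) (r u v h0 kmax h : nat) :
  0 < c -> C < 2 * c * h0%:R -> (0 < h0)%N ->
  (u + v + 2 * kmax <= r)%N ->
  (forall h, (0 < h)%N -> (u + v + 2 * h <= r)%N -> losing g C r u v h) ->
  (forall k, (h0 <= k <= kmax)%N -> 3 * c * k%:R <= dgrow g u v k) ->
  (forall k, (kmax < k)%N -> (u + v + k <= r)%N ->
     2 * c * kmax%:R + C < axgrow g u v k) ->
  c * kmax%:R + C < endgrow g r u v ->
  (h0 <= h <= kmax)%N -> mixdiff g u v h <= c * h%:R -> False.
Proof.
move=> c0 Ch0 h00 dom los Tgood Sbig Ebig.
have [n] := ubnP (kmax - h)%N; elim: n h => // n IHn h hn hk kap.
have hR : h%:R <= kmax%:R :> R by rewrite ler_nat; lia.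
have chk : c * h%:R <= c * kmax%:R by rewrite ler_pM2l.
case: (los h) => [| |[k [hlek kr Sk]]|E]; [lia|lia| |].
  have [kmaxk|klek] := ltnP kmax k.
    by have := Sbig k kmaxk kr; move: Sk kap chk; clear; lra.
  have e : axgrow g u v k = mixdiff g u v k + dgrow g u v k.
    by rewrite /axgrow /mixdiff /dgrow; ring.
  have hkk : (h0 <= k <= kmax)%N by lia.
  have Tk := Tgood k hkk.
  have : c * h0%:R <= c * k%:R by rewrite ler_pM2l // ler_nat; lia.
  have : c * h%:R <= c * k%:R by rewrite ler_pM2l // ler_nat.
  case: (ltngtP h k) hlek => // [hltk|hk'] _ chk' ch0k.
    apply: (IHn k) => //; first lia.
    by move: Sk Tk kap chk' ch0k Ch0; rewrite e; clear; lra.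
  by subst k; move: Sk Tk kap ch0k Ch0; rewrite e; clear; lra.
by move: Ebig E kap chk; clear; lra.
Qed.

End Comb2.

Section Comb3.
Variable R : realType.
Implicit Types (g : nat -> nat -> R).

(** A cell of level [(u, v)] has volume about [d^(2(u+v))], so it splits into about [d^(-2(a+b))]
    cells of level [(u + a, v + b)]: this is the slope 2. [step_ge] is the monotonicity of mass.
    Both hold up to constant factors, whence [C]. *)
Definition step_le g (C : R) (r : nat) : Prop := forall u v a b,
  (u + a + (v + b) <= r)%N -> g (u + a)%N (v + b)%N <= g u v + 2 * (a + b)%:R + C.
Definition step_ge g (C : R) (r : nat) : Prop := forall u v a b,
  (u + a + (v + b) <= r)%N -> g u v - C <= g (u + a)%N (v + b)%N.

Lemma step_near g (C : R) (r u u' v l : nat) : step_le g C r -> step_ge g C r ->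
  (u + v <= r)%N -> (u' + v <= r)%N -> (u <= u' + l)%N -> (u' <= u + l)%N ->
  g u' v <= g u v + 2 * l%:R + C.
Proof.
move=> sle sge ur u'r ul u'l; case: (leqP u u') => uu'.
  have := sle u v (u' - u)%N 0%N; rewrite !addn0 subnKC // => /(_ u'r).
  have : (u' - u)%:R <= l%:R :> R by rewrite ler_nat; lia.
  by clear; lra.
have := sge u' v (u - u')%N 0%N; rewrite !addn0 subnKC ?(ltnW uu') // => /(_ ur).
by have := ler0n R l; clear; lra.
Qed.

Lemma dgrow_near g (C : R) (r u u' v l k : nat) : step_le g C r -> step_ge g C r ->
  (u + v + 2 * k <= r)%N -> (u' + v + 2 * k <= r)%N ->
  (u <= u' + l)%N -> (u' <= u + l)%N ->
  dgrow g u v k - 4 * l%:R - 2 * C <= dgrow g u' v k.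
Proof.
move=> sle sge ur u'r ul u'l; rewrite /dgrow.
have : g u' v <= g u v + 2 * l%:R + C.
  by apply: (@step_near _ C r) => //; lia.
have : g (u + k)%N (v + k)%N <= g (u' + k)%N (v + k)%N + 2 * l%:R + C.
  by apply: (@step_near _ C r) => //; lia.
by clear; lra.
Qed.

(** The margin [8 / m] of [2 * t + s] over 3 is split in two. One half is subtracted from [g] along
    the diagonal, so that a persistent time means diagonal growth at rate [3 + 4 / m]; the other
    half still forces the remaining walk to rise, past its initial height of at most [2 * D + C]. *)
Lemma diag_persistent_count g (C D : R) (r d w1 kmax m : nat) (t s : R) :
  (0 < m)%N -> 0 <= s -> 0 <= t -> 3 + 8 * m%:R^-1 <= 2 * t + s -> 0 <= C ->
  step_le g C r -> g 0%N 0%N = 0 ->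
  (forall u v, (u + v <= r)%N -> t * (u + v)%:R + s * v%:R <= g u v) ->
  (d + 2 * (w1 + kmax) <= r)%N -> m%:R^-1 * w1%:R = 2 * D + C -> d%:R <= D ->
  3 * m%:R^-1 * w1%:R <= (4 + C) * \sum_(0 <= i < w1) (persistent
    (fun i => g (d + i)%N i - (3 + 4 * m%:R^-1) * i%:R) (w1 + kmax) i)%:R.
Proof.
move=> m0 s0 t0 ts C0 sle g0 low dom w1D dD.
have c0 : 0 < m%:R^-1 :> R by rewrite invr_gt0 ltr0n.
set c : R := m%:R^-1 in ts w1D c0 *.
set G := fun i : nat => g (d + i)%N i - (3 + 4 * c) * i%:R.
have stp n : (n < w1 + kmax)%N -> G n.+1 <= G n + (4 + C).
  move=> nw; rewrite /G; have := sle (d + n)%N n 1%N 1%N.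
  rewrite !addn1 -addnS => /(_ ltac:(lia)); rewrite -[n.+1%:R]natr1.
  by move: c0; clear; lra.
have [t' [wt' t'H Gt']] := persistent_count stp (leq_addr kmax w1).
have G0 : G 0%N <= 2 * D + C.
  rewrite /G addn0 mulr0 subr0; have := sle 0%N 0%N d 0%N.
  by rewrite !addn0 !add0n g0 => /(_ ltac:(lia)); move: dD; clear; lra.
have Gl : 4 * c * t'%:R <= G t'.
  have := low (d + t')%N t' ltac:(lia); rewrite /G !natrD.
  have : 0 <= t * d%:R by rewrite mulr_ge0.
  have : (3 + 8 * c) * t'%:R <= (2 * t + s) * t'%:R by rewrite ler_wpM2r.
  by clear; lra.
have : c * w1%:R <= c * t'%:R by rewrite ler_pM2l // ler_nat.
move: Gt' G0 Gl w1D; clear; lra.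
Qed.

(* On a block of a row most of whose points grow well along the diagonal, the
   mixed differences telescope, so one of them is small. *)
Lemma block_small_mixdiff g (m C r u v l h : nat) (A : nat -> bool) (z : R) :
  (0 < m)%N -> step_le g C%:R r -> step_ge g C%:R r ->
  z = (10 * m%:R)^-1 -> (0 < h)%N -> (C <= h)%N -> l = (20 * m * h)%N ->
  (u + (l + h) + h + v <= r)%N ->
  (1 - z) * l%:R <= \sum_(0 <= d < l) (A d)%:R ->
  exists2 d, (d < l)%N & A d /\ mixdiff g (u + d)%N v h <= m%:R^-1 * h%:R.
Proof.
move=> m0 sle sge zE h0 Ch lE dom dens; apply: contrapT => nex.
pose L d := g (u + d)%N (v + h)%N - g (u + d)%N v.
have Lb d : (d < l + h)%N -> - C%:R <= L d <= 2 * h%:R + C%:R.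
  move=> dl; have := sle (u + d)%N v 0%N h; have := sge (u + d)%N v 0%N h.
  rewrite !addn0 add0n => /(_ ltac:(lia)) + /(_ ltac:(lia)); rewrite /L.
  by clear; lra.
have kE d : mixdiff g (u + d)%N v h = L d - L (d + h)%N.
  by rewrite /mixdiff /L !addnA; ring.
have c0 : 0 < m%:R^-1 :> R by rewrite invr_gt0 ltr0n.
have hR : 0 < h%:R :> R by rewrite ltr0n.
have ChR : C%:R <= h%:R :> R by rewrite ler_nat.
have := sum_shift_diff Lb.
(* A point outside [A] can lower the sum by at most [2 * h + 2 * C <= 4 * h]. With [z = 1 / (10 m)]
   and [l = 20 m h] the total would still be at least [10 h^2], whereas telescoping leaves at most
   [h * (2 * h + 2 * C) <= 4 h^2]. *)
have lb : \sum_(0 <= d < l) ((A d)%:R * (m%:R^-1 * h%:R + 4 * h%:R) - 4 * h%:R)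
    <= \sum_(0 <= d < l) (L d - L (d + h)%N).
  rewrite big_nat_cond [leRHS]big_nat_cond; apply: ler_sum => d.
  rewrite andbT => /andP[_ dl]; case Ad: (A d); last first.
    have /andP[+ _] := Lb d ltac:(lia); have /andP[_] := Lb (d + h)%N ltac:(lia).
    by rewrite mul0r; move: ChR; clear; lra.
  rewrite mul1r addrK -kE leNgt; apply/negP => lt; apply: nex.
  by exists d => //; split => //; apply: ltW.
rewrite sumrB -mulr_suml sumr_const_nat subn0 -[_ *+ l]mulr_natl in lb.
have l0 : l%:R = 20 * m%:R * h%:R :> R by rewrite lE !natrM.
have mc : m%:R * m%:R^-1 = 1 :> R by rewrite divff // pnatr_eq0 -lt0n.
have zc : z = m%:R^-1 / 10 by rewrite zE invfM mulrC.
set c := m%:R^-1 in c0 lb mc zc.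
have c1 : c <= 1 by rewrite /c invf_le1 ?ltr0n // ler1n.
have s1 : (1 - z) * l%:R * (c * h%:R + 4 * h%:R) <=
    (\sum_(0 <= d < l) (A d)%:R) * (c * h%:R + 4 * h%:R).
  by apply: ler_wpM2r => //; nra.
have e : (1 - z) * l%:R * (c * h%:R + 4 * h%:R) - l%:R * (4 * h%:R) =
    (12 - 2 * c) * (h%:R * h%:R).
  rewrite zc l0.
  transitivity (20 * h%:R * h%:R * ((m%:R * c) - (m%:R * c) * c / 10 - 4 * (m%:R * c) / 10)).
    by field.
  by rewrite mc; field.
have h2 : 0 < h%:R * h%:R :> R by rewrite mulr_gt0.
have : 10 * (h%:R * h%:R) <= (12 - 2 * c) * (h%:R * h%:R).
  by rewrite ler_pM2r //; move: c1; clear; lra.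
have : h%:R * C%:R <= h%:R * h%:R :> R by rewrite ler_pM2l.
move: h2 lb s1 e; clear; lra.
Qed.

End Comb3.

Section Comb4.
Variable R : realType.
Implicit Types (g : nat -> nat -> R).

Lemma exists_popular_row (B : nat -> nat -> bool) (D w : nat) (e x : R) :
  (0 < w)%N -> x < e * D%:R ->
  (forall d, (d < D)%N -> e * w%:R <= \sum_(0 <= i < w) (B d i)%:R) ->
  exists2 i, (i < w)%N & x < \sum_(0 <= d < D) (B d i)%:R.
Proof.
move=> w0 xe row; apply: contrapT => nex.
have : \sum_(0 <= d < D) \sum_(0 <= i < w) (B d i)%:R <= x * w%:R :> R.
  rewrite exchange_big /= mulr_natr -[w in x *+ w]subn0 -sumr_const_nat.
  rewrite big_nat_cond [leRHS]big_nat_cond; apply: ler_sum => i.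
  rewrite andbT => /andP[_ iw]; rewrite leNgt; apply/negP => lt.
  by apply: nex; exists i.
apply/negP; rewrite -ltNge; apply: (@lt_le_trans _ _ (\sum_(0 <= d < D) e * w%:R)).
  by rewrite sumr_const_nat subn0 -[_ *+ D]mulr_natr mulrAC ltr_pM2r // ltr0n.
rewrite big_nat_cond [leRHS]big_nat_cond; apply: ler_sum => d.
by rewrite andbT => /andP[_ dD]; apply: row.
Qed.

(** Persistence gives good diagonal growth only on a positive proportion of a row, but a small mixed
    difference requires it on nearly a whole block. This is bridged by [K] rapidly increasing
    lengths [hh k]: growth at one point is inherited by its neighbours at distance [l k], at a
    slightly smaller rate and from the scale [hh k.+1] on, so that at one of the lengths some block
    must be nearly full. *)
Lemma exponents_not_losing_origin (m C : nat) : (0 < m)%N -> exists r0 : nat,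
  forall (t s : R) g r, (r0 <= r)%N ->
  1 + m%:R^-1 <= t -> 0 <= s -> 3 + 8 * m%:R^-1 <= 2 * t + s ->
  g 0%N 0%N = 0 -> step_le g C%:R r -> step_ge g C%:R r ->
  (forall u v, (u + v <= r)%N -> t * (u + v)%:R + s * v%:R <= g u v) ->
  (forall u v h, (0 < h)%N -> (u + v + 2 * h <= r)%N -> losing g C%:R r u v h) ->
  False.
Proof.
move=> m0; pose c : R := m%:R^-1.
have c0 : 0 < c by rewrite invr_gt0 ltr0n.
have mc : m%:R * c = 1 by rewrite divff // pnatr_eq0 -lt0n.
have c1 : c <= 1 by rewrite /c invf_le1 ?ltr0n // ler1n.
have C0 : 0 <= C%:R :> R by [].
pose e : R := 2 * c / (4 + C%:R).
have C4 : 0 < 4 + C%:R :> R by move: C0; clear; lra.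
have e0 : 0 < e by rewrite divr_gt0 // mulr_gt0.
pose z : R := (10 * m%:R)^-1.
have zc : z = c / 10 by rewrite /z invfM mulrC.
have z01 : 0 < z < 1 by rewrite zc; move: c0 c1; clear; lra.
have z01' : 0 <= z <= 1 by move: z01; clear; lra.
have [K [K0 KP]] := expr_lt_eps z01 e0.
pose h0 := (C.+1 * m)%N; pose B := (20 * m)%N.
pose M := (m * K * (4 * B + 2 * C))%N.
have M0 : (0 < M)%N by rewrite /M !muln_gt0 m0 K0 addn_gt0 muln_gt0 /B muln_gt0 m0.
have h00 : (0 < h0)%N by rewrite muln_gt0 m0.
pose hh k := (h0 * M ^ k)%N; pose l k := (B * hh k)%N.
have hh0 k : (0 < hh k)%N by rewrite /hh muln_gt0 h00 expn_gt0 M0.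
have h0h k : (h0 <= hh k)%N by rewrite /hh leq_pmulr // expn_gt0 M0.
pose D := l K.
have D0 : (0 < D)%N by rewrite /D /l muln_gt0 hh0 andbT muln_gt0 m0.
have lD k : (k <= K)%N -> (l k %| D)%N.
  by move=> kK; rewrite /D /l /hh dvdn_mul // dvdn_mul // dvdn_exp2l.
(* These lengths solve [w1E], [kmaxE] and [r1E]. On [w1] steps the growth overtakes the initial
   height of each diagonal; beyond [kmax], and on the remaining [r1] levels, the a priori lower
   bound on [g] outweighs the value [2 * wb + C] that [g] may have at the chosen point. *)
pose w1 := (m * (2 * D + C))%N; pose wb := (D + 2 * w1)%N.
have hh00 : (hh 0 <= h0)%N by rewrite /hh muln1.
have hhD k : (k <= K)%N -> (hh k <= D)%N.
  move=> /lD/(dvdn_leq D0); apply: leq_trans.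
  by rewrite /l leq_pmull // /B muln_gt0 m0.
pose kmax := (m * (wb + C))%N.
have Dkmax : (D <= kmax)%N.
  by apply: (@leq_trans (wb + C)%N); [rewrite /wb -addnA leq_addr|rewrite leq_pmull].
pose r1 := (m * (2 * wb + 2 * C))%N.
have lE k : l k = (20 * m * hh k)%N by [].
have hhS k : 4 * (l k)%:R + 2 * C%:R <= c / K%:R * (hh k.+1)%:R :> R.
  have -> : hh k.+1 = (m * (K * ((4 * B + 2 * C) * hh k)))%N.
    by rewrite /hh expnS; set P := (M ^ k)%N; rewrite /M; ring.
  have -> : (l k)%:R = B%:R * (hh k)%:R :> R by rewrite /l natrM.
  have K0R : K%:R != 0 :> R by rewrite pnatr_eq0 -lt0n.
  have hk1 : 1 <= (hh k)%:R :> R by rewrite ler1n.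
  rewrite [(m * _)%:R]natrM [(K * _)%:R]natrM [(_ * hh k)%:R]natrM natrD 2!natrM.
  rewrite [leRHS](_ : _ = m%:R * c * (4 * B%:R + 2 * C%:R) * (hh k)%:R); last by field.
  have : 2 * C%:R <= 2 * C%:R * (hh k)%:R :> R by rewrite ler_peMr // mulr_ge0.
  by rewrite mc; clear; lra.
have w1E : c * w1%:R = 2 * D%:R + C%:R.
  by rewrite /w1 natrM mulrA [c * _]mulrC mc mul1r natrD natrM.
have kmaxE : c * kmax%:R = wb%:R + C%:R.
  by rewrite /kmax natrM mulrA [c * _]mulrC mc mul1r natrD.
have r1E : c * r1%:R = 2 * wb%:R + 2 * C%:R.
  by rewrite /r1 natrM mulrA [c * _]mulrC mc mul1r natrD !natrM.
have wbE : wb = (D + 2 * w1)%N by [].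
have w10 : (0 < w1)%N.
  by rewrite /w1 muln_gt0 m0 addn_gt0 muln_gt0 D0.
have Ch k : (C <= hh k)%N.
  by apply: leq_trans (h0h k); apply: leq_trans (leqnSn C) _; rewrite leq_pmulr.
have Ch0 : C%:R < 2 * c * (hh 0%N)%:R.
  rewrite /hh expn0 muln1 /h0 natrM.
  rewrite [ltRHS](_ : _ = 2 * (m%:R * c) * C.+1%:R); last by ring.
  by rewrite mc -natr1; move: C0; clear; lra.
clearbody r1 kmax wb w1 hh l D M h0 B.
exists (3 * wb + 3 * kmax + 3 * w1 + r1 + 1)%N => t s g r r0r t1 s0 ts g0 sle sge low los.
rewrite -/c in t1 ts.
have t0 : 0 <= t by move: t1 c0; clear; lra.
pose G d := fun i : nat => g (d + i)%N i - (3 + 4 * c) * i%:R.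
have [tau tauw pop] : exists2 i, (i < w1)%N &
    (1 - z) ^+ K * D%:R < \sum_(0 <= d < D) (persistent (G d) (w1 + kmax) i)%:R.
  apply: (@exists_popular_row _ _ _ e) => //.
    by rewrite ltr_pM2r // ltr0n.
  move=> d dD; have domw : (d + 2 * (w1 + kmax) <= r)%N by clear -r0r wbE dD; lia.
  have := @diag_persistent_count _ g C%:R D%:R r d w1 kmax m t s
    m0 s0 t0 ts C0 sle g0 low.
  rewrite -/c => /(_ domw w1E).
  move=> /(_ ltac:(by rewrite ler_nat ltnW)).
  rewrite -/(G d) => cnt; rewrite /e mulrAC ler_pdivrMr // [leRHS]mulrC.
  apply: le_trans cnt.
  have : 0 <= c * w1%:R by rewrite mulr_ge0 // ltW.
  by clear; lra.
have dom d i : (d < D)%N -> (i <= kmax)%N -> (tau + d + tau + 2 * i <= r)%N.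
  by clear -r0r wbE tauw; lia.
(* Moving by [l k] changes [dgrow] by at most [4 * l k + 2 * C]; by the choice of [M] in [hhS] this
   is paid by lowering the rate by [c / K] at scales above [hh k.+1]. After at most [K] such losses
   the rate is still [3 * c], as [losing_ascent] requires. *)
pose rate k : R := 4 * c - k%:R * (c / K%:R).
pose A k d := [forall i : 'I_kmax.+1, (hh k <= i)%N ==>
  (rate k * i%:R <= dgrow g (tau + d) tau i)].
have cK0 : 0 < c / K%:R by rewrite divr_gt0 // ltr0n.
have prop k d d' : (k < K)%N -> (d < D)%N -> (d' < D)%N -> (d <= d' + l k)%N ->
    (d' <= d + l k)%N -> A k d -> A k.+1 d'.
  move=> kK dD d'D dd' d'd /forallP Ad; apply/forallP => i; apply/implyP => hi.
  have hki : (hh k <= i)%N.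
    apply: leq_trans hi; rewrite -(ler_nat R); have := hhS k.
    have : 20 * m%:R * (hh k)%:R = (l k)%:R :> R by rewrite lE !natrM.
    have : 1 <= m%:R :> R by rewrite ler1n.
    have : c / K%:R <= 1.
      by rewrite ler_pdivrMr ?ltr0n // mul1r (le_trans c1) // ler1n.
    have := ler0n R (hh k.+1); have := ler0n R (hh k); have := ler0n R C.
    by clear; nra.
  have := Ad i; rewrite hki /= => Adi; have ik : (i <= kmax)%N by rewrite -ltnS.
  have := @dgrow_near _ g C%:R r (tau + d)%N (tau + d')%N tau (l k) i sle sge.
  move=> /(_ (dom _ _ dD ik) (dom _ _ d'D ik)).
  move=> /(_ ltac:(clear -dd'; lia) ltac:(clear -d'd; lia)).
  have : c / K%:R * (hh k.+1)%:R <= c / K%:R * i%:R by rewrite ler_pM2l // ler_nat.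
  move: Adi (hhS k); rewrite /rate -[k.+1%:R]natr1; clear; lra.
have A0 d : persistent (G d) (w1 + kmax) tau -> A 0%N d.
  move=> /forallP pers; apply/forallP => i; apply/implyP => _.
  have ik : (i <= kmax)%N by rewrite -ltnS.
  have tiH : (tau + i < (w1 + kmax).+1)%N by clear -tauw ik; lia.
  have := pers (Ordinal tiH); rewrite /= leq_addr /= /G /rate /dgrow.
  rewrite [(tau + d)%N]addnC -addnA natrD; clear; lra.
have dens : (1 - z) ^+ K * D%:R < \sum_(0 <= d < D) (A 0%N d)%:R.
  apply: lt_le_trans pop _; apply: ler_sum => d _.
  by have [/A0 ->|_] := boolP (persistent (G d) _ _).
have [k [a [kK aD full]]] := dense_block
  z01' (fun k kK => lD k (ltnW kK)) prop dens.
have hkD := hhD k (ltnW kK).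
have domb : (tau + a * l k + (l k + hh k) + hh k + tau <= r)%N.
  by clear -r0r wbE tauw aD hkD; lia.
have [d dl [Ad mixd]] := @block_small_mixdiff _ g m C r (tau + a * l k)%N tau (l k)
  (hh k) (fun r => A k (a * l k + r)%N) z m0 sle sge erefl (hh0 k) (Ch k) (lE k)
  domb full.
rewrite -/c -addnA in mixd Ad.
set dd := (a * l k + d)%N in mixd Ad.
have ddD : (dd < D)%N by rewrite /dd; clear -aD dl; lia.
have ddr : (tau + dd + tau <= wb)%N by clear -ddD wbE tauw; lia.
have ddr' : (tau + dd + tau <= r)%N.
  by apply: leq_trans ddr _; clear -r0r; lia.
have gdd : g (tau + dd)%N tau <= 2 * wb%:R + C%:R.
  have := sle 0%N 0%N (tau + dd)%N tau; rewrite !add0n g0 => /(_ ddr').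
  have : (tau + dd + tau)%:R <= wb%:R :> R by rewrite ler_nat.
  by clear; lra.
have lowx k' : (tau + dd + tau + k' <= r)%N -> t * k'%:R <= g (tau + dd + k')%N tau.
  move=> dm; have /low : (tau + dd + k' + tau <= r)%N by clear -dm; lia.
  have : t * k'%:R <= t * (tau + dd + k' + tau)%:R.
    by rewrite ler_wpM2l // ler_nat; clear; lia.
  by have := mulr_ge0 s0 (ler0n R tau); clear; lra.
have lowz k' : (tau + dd + tau + k' <= r)%N ->
    (t + s) * k'%:R <= g (tau + dd)%N (tau + k')%N.
  move=> dm; have /low : (tau + dd + (tau + k') <= r)%N by clear -dm; lia.
  have : t * k'%:R <= t * (tau + dd + (tau + k'))%:R.
    by rewrite ler_wpM2l // ler_nat; clear; lia.
  have : s * k'%:R <= s * (tau + k')%:R.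
    by rewrite ler_wpM2l // ler_nat; clear; lia.
  by rewrite mulrDl; clear; lra.
have Chk : C%:R < 2 * c * (hh k)%:R.
  apply: lt_le_trans Ch0 _; rewrite ler_pM2l ?mulr_gt0 // ler_nat.
  exact: leq_trans hh00 (h0h k).
have kKR : k%:R * (c / K%:R) <= c.
  rewrite mulrCA ler_piMr ?(ltW c0) // ler_pdivrMr ?ltr0n // mul1r ler_nat.
  exact: ltnW.
apply: (@losing_ascent _ g c C%:R r (tau + dd)%N tau (hh k) kmax (hh k) c0 Chk) => //.
- exact: dom.
- by move=> h h1 h2; apply: los.
- move=> k' /andP[hk' k'k].
  have := forallP Ad (Ordinal (k'k : (k' < kmax.+1)%N)); rewrite hk' /=.
  apply: le_trans; rewrite ler_wpM2r // /rate; move: kKR; clear; lra.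
- move=> k' kk' dm; have := lowx k' dm; have := lowz k' dm.
  have : (3 + 8 * c) * k'%:R <= (2 * t + s) * k'%:R by rewrite ler_wpM2r.
  have : c * kmax%:R <= c * k'%:R by rewrite ler_pM2l // ler_nat ltnW.
  have : 1 <= wb%:R :> R by rewrite ler1n wbE addn_gt0 D0.
  move: gdd kmaxE C0; rewrite /axgrow; clear; lra.
- rewrite /endgrow; set H := (r - _)%N.
  have Hr : (tau + dd + tau + H <= r)%N.
    by rewrite /H subnKC.
  have := lowx H Hr.
  have : (1 + c) * H%:R <= t * H%:R by rewrite ler_wpM2r.
  have : c * (r1%:R + kmax%:R + 1) <= c * H%:R.
    rewrite ler_pM2l // -!natrD -[1]/(1%:R) -natrD ler_nat /H; clear -ddr r0r; lia.
  move: gdd r1E c0; clear; lra.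
- by rewrite leqnn /= (leq_trans hkD).
Qed.
End Comb4.

Section Comb5.
Variable R : realType.
Implicit Types (f g : nat -> nat -> R).

Lemma exists_nat_inv_le (e : R) : 0 < e -> exists2 m, (0 < m)%N & m%:R^-1 <= e.
Proof.
move=> e0; exists (Num.truncn e^-1).+1 => //.
rewrite -[leRHS]invrK lef_pV2 ?posrE ?invr_gt0 ?ltr0n //.
by apply: ltW; apply: truncnS_gt.
Qed.

Lemma losing_shift f (C : R) (n i j u v h : nat) : (i + j <= n)%N ->
  losing f C n (i + u) (j + v) h ->
  losing (fun u v => f (i + u)%N (j + v)%N - f i j) C (n - (i + j)) u v h.
Proof.
move=> ijn [[k [hk kn L]]|L]; [left|right].
  exists k; split=> //; first by clear -kn ijn; lia.
  by move: L; rewrite /axgrow /mixdiff !addnA; clear; lra.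
move: L; rewrite /endgrow /mixdiff.
rewrite (_ : n - (i + u + (j + v)) = n - (i + j) - (u + v))%N; last by clear; lia.
by rewrite !addnA; clear; lra.
Qed.

(** The minimum is taken with [t' = t - c] instead of [t] to keep it away from the last level: there
    the lower bound exceeds [t' N + s j] by about [(c - eta) N = c N / 2], while at the minimum the
    excess is at most [C], by comparison with the origin. Since [f] changes at bounded rate, at
    least [r0] levels remain once [N] is large. *)
Lemma exponents_not_losing (t s : R) (C : nat) : 1 < t -> 0 <= s -> 3 < 2 * t + s ->
  exists2 eta : R, 0 < eta & exists N0 : nat, forall N f, (N0 <= N)%N ->
  f 0%N 0%N <= C%:R -> step_le f C%:R N.+1 -> step_ge f C%:R N.+1 ->
  (forall i j, (i + j = N.+1)%N ->
     t * N%:R + s * j%:R - eta * N%:R - C%:R <= f i j) ->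
  (forall i j h, (0 < h)%N -> (i + j + 2 * h <= N.+1)%N ->
     losing f C%:R N.+1 i j h) -> False.
Proof.
move=> t1 s0 ts.
have [m1 m10 m1P] := @exists_nat_inv_le ((t - 1) / 20) ltac:(move: t1; clear; lra).
have [m2 m20 m2P] := @exists_nat_inv_le ((2 * t + s - 3) / 20) ltac:(move: ts; clear; lra).
pose m := (m1 * m2)%N; have m0 : (0 < m)%N by rewrite muln_gt0 m10.
pose c : R := m%:R^-1; have c0 : 0 < c by rewrite invr_gt0 ltr0n.
have cm1 : c <= m1%:R^-1.
  by rewrite lef_pV2 ?posrE ?ltr0n // ler_nat leq_pmulr.
have cm2 : c <= m2%:R^-1.
  by rewrite lef_pV2 ?posrE ?ltr0n // ler_nat leq_pmull.
have mc : m%:R * c = 1 by rewrite divff // pnatr_eq0 -lt0n.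
have [r0 r0P] := @exponents_not_losing_origin R m C m0; rewrite -/c in r0P.
exists (c / 2); first by rewrite divr_gt0.
pose T := (Num.truncn t).+1; have tT : t < T%:R by apply: truncnS_gt.
exists (2 * m * (r0 + 3 * C + T))%N => N f N0N f0 sle sge fend los.
have NR : r0%:R + 3 * C%:R + T%:R <= c / 2 * N%:R.
  have : (2 * m * (r0 + 3 * C + T))%:R <= N%:R :> R by rewrite ler_nat.
  rewrite -(ler_pM2l (_ : 0 < c / 2)) ?divr_gt0 //; apply: le_trans.
  have -> : (2 * m * (r0 + 3 * C + T))%:R = 2 * m%:R * (r0%:R + 3 * C%:R + T%:R) :> R.
    by rewrite -!natrM -!natrD -natrM.
  have gen (x y w : R) : y / 2 * (2 * x * w) = x * y * w by field.
  by rewrite gen mc mul1r.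
pose t' := t - c.
have t'1 : 1 + c <= t' by rewrite /t'; move: m1P cm1 c0 t1; clear; lra.
have ts' : 3 + 8 * c <= 2 * t' + s by rewrite /t'; move: m2P cm2 c0 ts; clear; lra.
pose F (p : 'I_N.+2 * 'I_N.+2) := f p.1 p.2 - t' * (p.1 + p.2)%:R - s * p.2%:R.
pose P := [pred p : 'I_N.+2 * 'I_N.+2 | (p.1 + p.2 <= N.+1)%N].
have P0 : P (ord0, ord0) by [].
have [[i j] /= Pij Fmin] := Order.TotalTheory.arg_minP F P0.
have F0 : F (i, j) <= C%:R.
  apply: le_trans (Fmin _ P0) _; rewrite /F /= !mulr0 !subr0; exact: f0.
have Fm u v : (u + v <= N.+1)%N -> F (i, j) <= f u v - t' * (u + v)%:R - s * v%:R.
  move=> uv; have uN : (u < N.+2)%N by clear -uv; lia.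
  have vN : (v < N.+2)%N by clear -uv; lia.
  exact: (Fmin (Ordinal uN, Ordinal vN) uv).
rewrite /F /= in F0 Fm.
pose r := (N.+1 - (i + j))%N.
have rE : (i + j + r = N.+1)%N by rewrite /r subnKC.
have r0r : (r0 <= r)%N.
  have := sle i j r 0%N; rewrite addn0 => /(_ ltac:(clear -rE; lia)).
  have := fend (i + r)%N j ltac:(clear -rE; lia); rewrite addn0.
  have : (i + j)%:R + r%:R = N%:R + 1 :> R by rewrite -natrD rE natr1.
  have tr : (1 + c) * r%:R <= t' * r%:R by rewrite ler_wpM2r.
  move=> e.
  have e2 : t' * (i + j)%:R + t' * r%:R = (t - c) * N%:R + t'.
    by rewrite -mulrDr e mulrDr mulr1.
  have : t' <= t by rewrite /t'; move: c0; clear; lra.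
  have : 0 <= c * r%:R by rewrite mulr_ge0 // ltW.
  rewrite -(ler_nat R).
  move: tr e2 F0 tT NR; clear; lra.
apply: (r0P t' s (fun u v => f (i + u)%N (j + v)%N - f i j) r r0r t'1 s0 ts').
- by rewrite !addn0 subrr.
- move=> u v a b uvr; have := sle (i + u)%N (j + v)%N a b.
  rewrite -!addnA => /(_ ltac:(clear -uvr rE; lia)); clear; lra.
- move=> u v a b uvr; have := sge (i + u)%N (j + v)%N a b.
  rewrite -!addnA => /(_ ltac:(clear -uvr rE; lia)); clear; lra.
- move=> u v uvr; have := Fm (i + u)%N (j + v)%N ltac:(clear -uvr rE; lia).
  rewrite !natrD; clear; lra.
- move=> u v h h0 uvh; apply: losing_shift => //; apply: los => //.
  by clear -uvh rE; lia.
Qed.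

End Comb5.

(** * A high-low inequality on the integer grid *)

Section Kernel.
Variable R : realType.
Implicit Types t s v p q : R.

Definition pospart t : R := Num.max 0 t.
(** The hat function on [[-1, 1]]; [sigmoid] is its antiderivative, a quadratic spline rising from 0
    to 1. Written as second differences of [pospart], both have bounds that follow by splitting on
    three signs. *)
Definition tent t : R := pospart (t + 1) - 2 * pospart t + pospart (t - 1).
Definition sigmoid t : R :=
  (pospart (t + 1) ^+ 2 - 2 * pospart t ^+ 2 + pospart (t - 1) ^+ 2) / 2.

Lemma pospartP t : (t <= 0 /\ pospart t = 0) \/ (0 <= t /\ pospart t = t).
Proof.
rewrite /pospart; have [h|h] := lerP 0 t; [right|left]; split => //.
exact: ltW.
Qed.

Lemma pospart_taylor t s :
  `|pospart (t + s) ^+ 2 - pospart t ^+ 2 - 2 * s * pospart t| <= s ^+ 2.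
Proof.
rewrite ler_norml.
case: (pospartP (t + s)) => -[a ->]; case: (pospartP t) => -[b ->]; nra.
Qed.

Lemma sigmoid_taylor t s : `|sigmoid (t + s) - sigmoid t - s * tent t| <= 2 * s ^+ 2.
Proof.
have := pospart_taylor (t + 1) s; have := pospart_taylor t s.
have := pospart_taylor (t - 1) s; rewrite /sigmoid /tent.
rewrite [t + s + 1]addrAC [t + s - 1]addrAC !ler_norml.
lra.
Qed.

Lemma tent_ge0 t : 0 <= tent t.
Proof.
rewrite /tent; case: (pospartP (t + 1)) => -[a ->]; case: (pospartP t) => -[b ->];
  case: (pospartP (t - 1)) => -[c ->]; lra.
Qed.

Lemma tent_le1 t : tent t <= 1.
Proof.
rewrite /tent; case: (pospartP (t + 1)) => -[a ->]; case: (pospartP t) => -[b ->];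
  case: (pospartP (t - 1)) => -[c ->]; lra.
Qed.

Lemma tent_out t : 1 <= `|t| -> tent t = 0.
Proof.
rewrite ler_normr /tent => /orP h.
case: (pospartP (t + 1)) => -[a ->]; case: (pospartP t) => -[b ->];
  case: (pospartP (t - 1)) => -[c ->]; case: h => h; lra.
Qed.

Lemma tent_half t : `|t| <= 1 / 2 -> 1 / 2 <= tent t.
Proof.
rewrite ler_norml /tent => h.
case: (pospartP (t + 1)) => -[a ->]; case: (pospartP t) => -[b ->];
  case: (pospartP (t - 1)) => -[c ->]; lra.
Qed.

Lemma sigmoid_bound t : 0 <= sigmoid t <= 1.
Proof.
rewrite /sigmoid; case: (pospartP (t + 1)) => -[a ->]; case: (pospartP t) => -[b ->];
  case: (pospartP (t - 1)) => -[c ->]; nra.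
Qed.

Lemma sigmoid_neg t : t <= -1 -> sigmoid t = 0.
Proof.
rewrite /sigmoid => h; case: (pospartP (t + 1)) => -[a ->];
  case: (pospartP t) => -[b ->]; case: (pospartP (t - 1)) => -[c ->]; nra.
Qed.

Lemma sigmoid_pos t : 1 <= t -> sigmoid t = 1.
Proof.
rewrite /sigmoid => h; case: (pospartP (t + 1)) => -[a ->];
  case: (pospartP t) => -[b ->]; case: (pospartP (t - 1)) => -[c ->]; nra.
Qed.

(** Both hats have integral 1, so the kernel has mean zero and its antiderivative [prim] vanishes
    outside [[-q, q]] when [p <= q]. This cancellation is what makes transversal lines nearly
    orthogonal. *)
Definition kern p q v : R := tent (v / p) / p - tent (v / q) / q.
Definition prim p q v : R := sigmoid (v / p) - sigmoid (v / q).

Lemma kern_out p q v : 0 < p <= q -> q <= `|v| -> kern p q v = 0.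
Proof.
move=> /andP[p0 pq] qv; have q0 := lt_le_trans p0 pq.
have out w : 0 < w <= q -> tent (v / w) = 0.
  move=> /andP[w0 wq]; rewrite tent_out // normrM normfV (gtr0_norm w0).
  by rewrite ler_pdivlMr // mul1r (le_trans wq).
by rewrite /kern !out ?mul0r ?subrr ?p0 ?q0 //=.
Qed.

Lemma prim_out p q v : 0 < p <= q -> q <= `|v| -> prim p q v = 0.
Proof.
move=> /andP[p0 pq]; have q0 := lt_le_trans p0 pq.
rewrite /prim ler_normr => /orP[qv|qv].
  by rewrite !sigmoid_pos ?subrr // ler_pdivlMr // mul1r // (le_trans pq).
rewrite !sigmoid_neg ?subrr // ler_pdivrMr // mulN1r lerNr //.
exact: le_trans qv.
Qed.

Lemma prim_le1 p q v : `|prim p q v| <= 1.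
Proof.
rewrite /prim; have := sigmoid_bound (v / p); have := sigmoid_bound (v / q).
by rewrite ler_norml; clear; lra.
Qed.

Lemma kern_le p q v : 0 < p <= q -> `|kern p q v| <= p^-1.
Proof.
move=> /andP[p0 pq]; have q0 := lt_le_trans p0 pq.
have pq' : q^-1 <= p^-1 by rewrite lef_pV2 ?posrE.
have b w : 0 < w -> 0 <= tent (v / w) / w <= w^-1.
  move=> w0; rewrite mulr_ge0 ?tent_ge0 ?invr_ge0 ?(ltW w0) //=.
  by rewrite ler_piMl ?tent_le1 // invr_ge0 ltW.
have := b p p0; have := b q q0; rewrite /kern ler_norml; lra.
Qed.

Lemma prim_taylor p q v s : 0 < p <= q ->
  `|prim p q (v + s) - prim p q v - s * kern p q v| <= 4 * s ^+ 2 / p ^+ 2.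
Proof.
move=> /andP[p0 pq]; have q0 := lt_le_trans p0 pq.
have pq' : q^-1 ^+ 2 <= p^-1 ^+ 2.
  by rewrite ler_pXn2r ?nnegrE ?invr_ge0 ?(ltW p0) ?(ltW q0) // lef_pV2 ?posrE.
have -> : prim p q (v + s) - prim p q v - s * kern p q v =
    (sigmoid (v / p + s / p) - sigmoid (v / p) - s / p * tent (v / p)) -
    (sigmoid (v / q + s / q) - sigmoid (v / q) - s / q * tent (v / q)).
  by rewrite /prim /kern ![(v + s) / _]mulrDl; ring.
apply: le_trans (ler_normB _ _) _.
have := sigmoid_taylor (v / p) (s / p); have := sigmoid_taylor (v / q) (s / q).
have : s ^+ 2 * q^-1 ^+ 2 <= s ^+ 2 * p^-1 ^+ 2 by rewrite ler_wpM2l // sqr_ge0.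
rewrite !expr_div_n -!exprVn; clear.
set a := `|_|; set b := `|_|; lra.
Qed.

End Kernel.

Section ZSum.
Variable R : realType.
Implicit Types (h : int -> R) (M q n p : nat).

Definition zsum M h : R := \sum_(0 <= j < (2 * M).+1) h (j%:Z - M%:Z).

Lemma zsum_shift M q (c : int) h :
  (forall u : int, (q < absz u)%N -> h u = 0) -> (absz c + q <= M)%N ->
  zsum M (fun u => h (u - c)) = zsum q h.
Proof.
move=> h0 cqM; rewrite /zsum.
pose o := absz (M%:Z + c - q%:Z)%R.
have oE : o%:Z = M%:Z + c - q%:Z by rewrite /o; lia.
have o1 : (o + (2 * q).+1 <= (2 * M).+1)%N by lia.
rewrite (big_cat_nat (leq0n o)) /=; last by lia.
rewrite (big_cat_nat (leq_addr (2 * q).+1 o)) //=.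
rewrite big_nat big1 ?add0r; last by move=> j jo; apply: h0; lia.
rewrite [X in _ + X]big_nat [X in _ + X]big1 ?addr0; last by move=> j jo; apply: h0; lia.
rewrite -{1}(add0n o) big_addn addKn; apply: eq_bigr => i _.
by congr h; rewrite PoszD; lia.
Qed.

Lemma eq_zsum M h h' : h =1 h' -> zsum M h = zsum M h'.
Proof. by move=> hh'; apply: eq_bigr => j _; rewrite hh'. Qed.

Lemma ler_zsum M h h' : (forall u : int, (absz u <= M)%N -> h u <= h' u) ->
  zsum M h <= zsum M h'.
Proof.
move=> hh'; rewrite /zsum big_nat [leRHS]big_nat; apply: ler_sum => j jM.
by apply: hh'; lia.
Qed.

Lemma zsum_const M (c : R) : zsum M (fun=> c) = (2 * M).+1%:R * c.
Proof. by rewrite /zsum sumr_const_nat subn0 mulr_natl. Qed.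

Lemma ler_norm_zsum M h : `|zsum M h| <= zsum M (fun u => `|h u|).
Proof. exact: ler_norm_sum. Qed.

Lemma mulr_zsumr M h (c : R) : c * zsum M h = zsum M (fun u => c * h u).
Proof. exact: mulr_sumr. Qed.

Lemma mulr_zsuml M h (c : R) : zsum M h * c = zsum M (fun u => h u * c).
Proof. exact: mulr_suml. Qed.

Lemma zsum_sum (I : finType) M (h : I -> int -> R) :
  zsum M (fun u => \sum_i h i u) = \sum_i zsum M (h i).
Proof. exact: exchange_big. Qed.

Lemma exchange_zsum M M' (h : int -> int -> R) :
  zsum M (fun u => zsum M' (h u)) = zsum M' (fun v => zsum M (h^~ v)).
Proof. exact: exchange_big. Qed.

Lemma count_progression_le (c th : R) q m : th != 0 ->
  \sum_(0 <= j < m) (`|c + th * j%:R| <= q%:R)%R%:R <= 2 * q%:R / `|th| + 1 :> R.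
Proof.
move=> th0; have nth0 : 0 < `|th| by rewrite normr_gt0.
pose P j := `|c + th * j%:R| <= q%:R.
pose m' := Num.truncn (2 * q%:R / `|th|).
have m'P : m'%:R <= 2 * q%:R / `|th| by rewrite truncn_le divr_ge0 // mulr_ge0.
rewrite -natr_sum -big_mkcond sum1_count.
apply: (@le_trans _ _ (m'.+1)%:R); last by rewrite -natr1 lerD2r.
rewrite ler_nat -size_filter.
have [->//|] := eqVneq (seq.filter P (index_iota 0 m)) [::].
rewrite -has_filter => /hasP[j _ Pj].
have [j0 Pj0 j0min] := ex_minnP (ex_intro P j Pj).
rewrite -[m'.+1](size_iota j0); apply: uniq_leq_size.
  by rewrite filter_uniq // iota_uniq.
move=> i; rewrite mem_filter mem_iota => /andP[Pi _].
have ij := j0min i Pi; rewrite ij /=.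
have e : (i - j0)%:R <= 2 * q%:R / `|th|.
  rewrite ler_pdivlMr // -[(i - j0)%:R]ger0_norm // -normrM natrB //.
  rewrite [X in `|X|](_ : _ = (c + th * i%:R) - (c + th * j0%:R)); last by ring.
  apply: le_trans (ler_normB _ _) _; move: Pi Pj0; rewrite /P; clear; lra.
have : (i - j0 <= m')%N.
  by rewrite truncn_ge_nat // divr_ge0 // mulr_ge0.
lia.
Qed.

Lemma sum_by_parts (a b : nat -> R) m : a 0%N = 0 -> a m = 0 ->
  \sum_(0 <= j < m) a j * (b j.+1 - b j) =
  - \sum_(0 <= j < m) (a j.+1 - a j) * b j.+1.
Proof.
move=> a0 am; apply/eqP; rewrite -addr_eq0 -big_split /=.
rewrite (eq_bigr (fun j => a j.+1 * b j.+1 - a j * b j)); last by move=> j _; ring.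
by rewrite telescope_sumr // a0 am !mul0r subrr.
Qed.

End ZSum.

(** * Correlation of the strips around two lines *)

Section CrossTerm.
Variables (R : realType) (n p q : nat).
Hypotheses (n0 : (0 < n)%N) (p0 : (0 < p)%N) (pq : (p <= q)%N).

Definition ikern (u : int) : R := kern p%:R q%:R u%:~R.
(** A weight for the abscissae: it is at least [n] where points can lie, its increments are at most
    1, and it vanishes at both ends of the range, so that summation by parts has no boundary
    terms. *)
Definition cutoff (x : int) : R := 4 * n%:R - (absz x)%:R.
Definition crossterm (th be : int) : R :=
  zsum (4 * n) (fun x => cutoff x *
    zsum q (fun u => ikern u * ikern (u + (th * x + be)))).

Let p0R : 0 < p%:R :> R. Proof. by rewrite ltr0n. Qed.
Let q0R : 0 < q%:R :> R. Proof. by rewrite ltr0n (leq_trans p0). Qed.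
Let pqR : 0 < (p%:R : R) <= q%:R. Proof. by rewrite p0R ler_nat. Qed.

Lemma absz_intrE (u : int) : (absz u)%:R = `|u%:~R| :> R.
Proof. by rewrite -intr_norm -abszE. Qed.

Lemma ikern_out u : (q <= absz u)%N -> ikern u = 0.
Proof. by move=> qu; apply: kern_out => //; rewrite -absz_intrE ler_nat. Qed.

Lemma ikern_le u : `|ikern u| <= p%:R^-1.
Proof. exact: kern_le. Qed.

Lemma zsum_ikern_le : zsum q (fun u => `|ikern u|) <= 6 :> R.
Proof.
have cnt m : (0 < m)%N -> zsum m (fun=> m%:R^-1) <= 3 :> R.
  move=> m0; rewrite zsum_const ler_pdivrMr ?ltr0n // -natr1 natrM.
  have : 1 <= m%:R :> R by rewrite ler1n.
  by lra.
have tle m u : (0 < m)%N -> tent (u%:~R / m%:R) / m%:R <= m%:R^-1 :> R.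
  by move=> m0; rewrite ler_piMl ?tent_le1 // invr_ge0.
have tq : zsum q (fun u => tent (u%:~R / q%:R) / q%:R : R) <= 3.
  by apply: le_trans (cnt q _); [apply: ler_zsum => u _; apply: tle|]; rewrite (leq_trans p0).
have tp : zsum q (fun u => tent (u%:~R / p%:R) / p%:R : R) <= 3.
  rewrite (_ : zsum q _ = zsum p (fun u => tent (u%:~R / p%:R) / p%:R)).
    by apply: le_trans (cnt p _) => //; apply: ler_zsum => u _; apply: tle.
  rewrite -(@zsum_shift _ q p 0) //; first by apply: eq_zsum => u; rewrite subr0.
  move=> u pu; rewrite tent_out ?mul0r // normrM normfV (gtr0_norm p0R).
  by rewrite ler_pdivlMr // mul1r -absz_intrE ler_nat ltnW.
apply: (@le_trans _ _ (zsum q (fun u => tent (u%:~R / p%:R) / p%:R) +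
                       zsum q (fun u => tent (u%:~R / q%:R) / q%:R))); last first.
  by move: tp tq; lra.
rewrite /zsum -big_split /=; apply: ler_sum => j _.
rewrite /ikern /kern; apply: le_trans (ler_normB _ _) _.
by rewrite !ger0_norm // mulr_ge0 ?tent_ge0 // invr_ge0.
Qed.

Lemma cutoff_bound x : (absz x <= 4 * n)%N -> 0 <= cutoff x <= 4 * n%:R.
Proof.
rewrite /cutoff => xn; have : (absz x)%:R <= 4 * n%:R :> R by rewrite -natrM ler_nat.
by have := ler0n R (absz x); lra.
Qed.

Lemma zsum_cutoff_le : zsum (4 * n) cutoff <= 36 * n%:R ^+ 2.
Proof.
apply: (@le_trans _ _ (zsum (4 * n) (fun=> 4 * n%:R))).
  by apply: ler_zsum => x /cutoff_bound/andP[].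
rewrite zsum_const -natr1 !natrM.
have : 1 <= n%:R :> R by rewrite ler1n.
by nra.
Qed.

Lemma crossterm_trivial th be : `|crossterm th be| <= 216 * n%:R ^+ 2 / p%:R.
Proof.
apply: le_trans (ler_norm_zsum _ _) _.
apply: (@le_trans _ _ (zsum (4 * n) cutoff * (6 / p%:R))).
  rewrite mulr_zsuml; apply: ler_zsum => x xn.
  have /andP[c0 _] := cutoff_bound xn; rewrite normrM ger0_norm // ler_wpM2l //.
  apply: le_trans (ler_norm_zsum _ _) _.
  apply: (@le_trans _ _ (zsum q (fun u => `|ikern u|) / p%:R)).
    rewrite mulr_zsuml; apply: ler_zsum => u _; rewrite normrM ler_wpM2l //.
    exact: ikern_le.
  by rewrite ler_pM2r ?invr_gt0 //; exact: zsum_ikern_le.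
have -> : 216 * n%:R ^+ 2 / p%:R = 36 * n%:R ^+ 2 * (6 / p%:R) :> R by ring.
by rewrite ler_pM2r ?divr_gt0 //; exact: zsum_cutoff_le.
Qed.

Lemma crossterm_disjoint th be :
  (forall x : int, (absz x <= 4 * n)%N -> (2 * q < absz (th * x + be)%R)%N) ->
  crossterm th be = 0.
Proof.
move=> sep; apply/eqP; rewrite -normr_le0; apply: le_trans (ler_norm_zsum _ _) _.
rewrite -[leRHS](mulr0 ((2 * (4 * n)).+1%:R)) -zsum_const; apply: ler_zsum => x xn.
rewrite normr_le0 mulf_eq0; apply/orP; right.
rewrite -normr_le0; apply: le_trans (ler_norm_zsum _ _) _.
rewrite -[leRHS](mulr0 ((2 * q).+1%:R)) -zsum_const; apply: ler_zsum => u uq.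
by rewrite (ikern_out (u := u + _)) ?mulr0 ?normr0 //; have := sep x xn; lia.
Qed.

(** Along a transversal line [th] times the kernel is nearly the increment of [prim]. Summation by
    parts moves the difference to [cutoff], and only the [2 q / |th| + 1] abscissae inside the strip
    count, each with a term at most 1. The last summand is the Taylor error of replacing a
    derivative by an increment. *)
Lemma zsum_cutoff_ikern_le (c th : int) : th != 0 ->
  `|zsum (4 * n) (fun x => cutoff x * ikern (c + th * x))| <=
  2 * q%:R / th%:~R ^+ 2 + `|th%:~R|^-1 + 144 * n%:R ^+ 2 * `|th%:~R| / p%:R ^+ 2.
Proof.
move=> th0; have thR : th%:~R != 0 :> R by rewrite intr_eq0.
have nth0 : 0 < `|th%:~R| :> R by rewrite normr_gt0.
pose m := (2 * (4 * n))%N.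
pose a (j : nat) := cutoff (j%:Z - (4 * n)%N%:Z).
pose b (j : nat) : R := prim p%:R q%:R (c + th * (j%:Z - (4 * n)%N%:Z))%:~R.
have a0 : a 0%N = 0 by rewrite /a /cutoff sub0r abszN absz_nat natrM subrr.
have am : a m = 0.
  rewrite /a /cutoff (_ : absz _ = (4 * n)%N); last by rewrite /m; lia.
  by rewrite natrM subrr.
have aS j : `|a j.+1 - a j| <= 1.
  rewrite /a /cutoff; set x := absz _; set y := absz _.
  rewrite (_ : _ - _ = y%:R - x%:R); last by ring.
  have [h1 h2] : (x <= y.+1)%N /\ (y <= x.+1)%N by rewrite /x /y; split; lia.
  by move: h1 h2; rewrite -!(ler_nat R) -!natr1 ler_norml; lra.
pose S := zsum (4 * n) (fun x => cutoff x * ikern (c + th * x)).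
have SE : S = \sum_(0 <= j < m) a j * ikern (c + th * (j%:Z - (4 * n)%N%:Z)).
  by rewrite /S /zsum big_nat_recr //= -/(a _) am mul0r addr0.
have err : `|th%:~R * S - \sum_(0 <= j < m) a j * (b j.+1 - b j)| <=
    144 * n%:R ^+ 2 * `|th%:~R| ^+ 2 / p%:R ^+ 2.
  rewrite SE mulr_sumr -sumrB; apply: le_trans (ler_norm_sum _ _ _) _.
  apply: (@le_trans _ _ (\sum_(0 <= j < m) a j * (4 * th%:~R ^+ 2 / p%:R ^+ 2))).
    rewrite big_nat [leRHS]big_nat; apply: ler_sum => j jm.
    have /andP[aj0 _] : 0 <= a j <= 4 * n%:R by apply: cutoff_bound; rewrite /m in jm; lia.
    rewrite mulrCA -mulrBr normrM ger0_norm // ler_wpM2l // distrC.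
    have := @prim_taylor R p%:R q%:R (c + th * (j%:Z - (4 * n)%N%:Z))%:~R th%:~R pqR.
    rewrite -intrD /ikern /b.
    by have -> : c + th * (j%:Z - (4 * n)%N%:Z) + th =
      c + th * (j.+1%:Z - (4 * n)%N%:Z) by rewrite -addn1 PoszD; ring.
  rewrite -mulr_suml real_normK ?num_real //.
  have -> : 144 * n%:R ^+ 2 * th%:~R ^+ 2 / p%:R ^+ 2 =
    36 * n%:R ^+ 2 * (4 * th%:~R ^+ 2 / p%:R ^+ 2) :> R by ring.
  apply: ler_wpM2r; first by rewrite divr_ge0 ?exprn_ge0 ?ler0n // mulr_ge0 ?ler0n // -real_normK ?num_real ?exprn_ge0.
  by move: zsum_cutoff_le; rewrite /zsum big_nat_recr //= -/(a _) am addr0.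
have main : `|\sum_(0 <= j < m) a j * (b j.+1 - b j)| <= 2 * q%:R / `|th%:~R| + 1.
  rewrite sum_by_parts // normrN; apply: le_trans (ler_norm_sum _ _ _) _.
  apply: le_trans (@count_progression_le R (c + th * (1 - (4 * n)%N%:Z))%:~R th%:~R q m thR).
  apply: ler_sum => j _; rewrite normrM.
  have -> : (c + th * (1 - (4 * n)%N%:Z))%:~R + th%:~R * j%:R =
     (c + th * (j.+1%:Z - (4 * n)%N%:Z))%:~R :> R.
    by rewrite -[j%:R]/(j%:Z%:~R) -intrM -intrD -addn1 PoszD; congr (_%:~R); ring.
  rewrite -/(b j.+1); have [le|gt] := lerP `|_| q%:R.
    rewrite /= -[leRHS]mul1r; apply: ler_pM => //; exact: prim_le1.
  by rewrite [b _]prim_out ?normr0 ?mulr0 // ltW.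
have SE2 : `|S| = `|th%:~R * S| / `|th%:~R| by rewrite normrM mulrAC divff ?mul1r ?gt_eqF.
rewrite -/S SE2 ler_pdivrMr //.
have -> : (2 * q%:R / th%:~R ^+ 2 + `|th%:~R|^-1 + 144 * n%:R ^+ 2 * `|th%:~R| / p%:R ^+ 2) *
   `|th%:~R| = (2 * q%:R / `|th%:~R| + 1) + 144 * n%:R ^+ 2 * `|th%:~R| ^+ 2 / p%:R ^+ 2 :> R.
  rewrite -[th%:~R ^+ 2]real_normK ?num_real //.
  by move: (`|th%:~R| : R) nth0 => x x0; field; rewrite gt_eqF //= gt_eqF.
rewrite -[th%:~R * S](subrK (\sum_(0 <= j < m) a j * (b j.+1 - b j))) addrC.
by apply: le_trans (ler_normD _ _) _; apply: lerD.
Qed.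

Lemma crossterm_transversal th be : th != 0 ->
  `|crossterm th be| <= 6 * (2 * q%:R / th%:~R ^+ 2 + `|th%:~R|^-1 +
                             144 * n%:R ^+ 2 * `|th%:~R| / p%:R ^+ 2).
Proof.
move=> th0.
have -> : crossterm th be = zsum q (fun u => ikern u *
    zsum (4 * n) (fun x => cutoff x * ikern (u + be + th * x))).
  transitivity (zsum (4 * n) (fun x => zsum q (fun u => cutoff x * (ikern u *
    ikern (u + (th * x + be)))))); first by apply: eq_zsum => x; rewrite mulr_zsumr.
  rewrite exchange_zsum; apply: eq_zsum => u; rewrite mulr_zsumr; apply: eq_zsum => x.
  by rewrite mulrCA -[u + be + _]addrA [be + _]addrC.
apply: le_trans (ler_norm_zsum _ _) _.
set W := (X in _ <= 6 * X).
apply: (@le_trans _ _ (zsum q (fun u => `|ikern u|) * W)).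
  rewrite mulr_zsuml; apply: ler_zsum => u _; rewrite normrM ler_wpM2l //.
  exact: zsum_cutoff_ikern_le.
apply: ler_wpM2r zsum_ikern_le.
exact: le_trans (normr_ge0 _) (zsum_cutoff_ikern_le 0 th0).
Qed.

End CrossTerm.

Section CauchySchwarz.
Variable R : realType.

Lemma sum_cauchy_schwarz (T : Type) (s : seq T) (a b : T -> R) :
  (\sum_(i <- s) a i * b i) ^+ 2 <=
  (\sum_(i <- s) a i ^+ 2) * \sum_(i <- s) b i ^+ 2.
Proof.
set S := \sum_(i <- s) a i * b i; set U := \sum_(i <- s) a i ^+ 2.
set V := \sum_(i <- s) b i ^+ 2.
have quad x : 0 <= x ^+ 2 * U + 2 * x * S + V.
  have -> : x ^+ 2 * U + 2 * x * S + V = \sum_(i <- s) (x * a i + b i) ^+ 2.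
    rewrite /U /V /S !mulr_sumr -!big_split /=; apply: eq_bigr => i _.
    by rewrite sqrrD exprMn mulr2n; ring.
  by apply: sumr_ge0 => i _; exact: sqr_ge0.
have U0 : 0 <= U by apply: sumr_ge0 => i _; exact: sqr_ge0.
have V0 : 0 <= V by have := quad 0; rewrite expr0n /= mul0r mulr0 mul0r !add0r.
move: U0; rewrite le_eqVlt => /orP[/eqP U0|U0].
  rewrite -U0 mul0r; have := quad (- (V + 1) / (2 * S)); rewrite -U0 mulr0 add0r.
  have [->|S0] := eqVneq S 0; first by rewrite expr0n.
  have -> : 2 * (- (V + 1) / (2 * S)) * S = - (V + 1) by field.
  by lra.
have := quad (- (S / U)); have -> : (- (S / U)) ^+ 2 * U + 2 * - (S / U) * S + V =
  V - S ^+ 2 / U by field; rewrite gt_eqF.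
by rewrite subr_ge0 ler_pdivrMr // mulrC.
Qed.

Lemma zsum2_cauchy_schwarz M M' (a b : int -> int -> R) :
  (zsum M (fun x => zsum M' (fun y => a x y * b x y))) ^+ 2 <=
  zsum M (fun x => zsum M' (fun y => a x y ^+ 2)) *
  zsum M (fun x => zsum M' (fun y => b x y ^+ 2)).
Proof.
pose xs m := [seq j%:Z - m%:Z | j <- index_iota 0 (2 * m).+1].
pose s := [seq (x, y) | x <- xs M, y <- xs M'].
have E h : zsum M (fun x => zsum M' (h x)) = \sum_(z <- s) h z.1 z.2 :> R.
  by rewrite /s big_allpairs /= big_map; apply: eq_bigr => j _; rewrite big_map.
by rewrite !E; exact: sum_cauchy_schwarz.
Qed.

Lemma zsum_sum2 (I : finType) M (w : I -> I -> R) (h : I -> I -> int -> R) :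
  zsum M (fun x => \sum_e \sum_e' w e e' * h e e' x) =
  \sum_e \sum_e' w e e' * zsum M (h e e').
Proof.
rewrite zsum_sum; apply: eq_bigr => e _; rewrite zsum_sum; apply: eq_bigr => e' _.
by rewrite mulr_zsumr.
Qed.

Lemma eq_zsum_in M (h h' : int -> R) :
  (forall u : int, (absz u <= M)%N -> h u = h' u) -> zsum M h = zsum M h'.
Proof.
move=> hh'; rewrite /zsum big_nat [RHS]big_nat; apply: eq_bigr => j jM.
by apply: hh'; lia.
Qed.

End CauchySchwarz.

(** * Smeared points against a sum of strips *)

Section HighLowInt.
Variables (R : realType) (I : finType) (nu : I -> R) (n r q : nat).
Variables (X Y A : I -> int) (MP : R).
Let p := (r * n)%N.
Hypotheses (r0 : (0 < r)%N) (rn : (r <= n)%N) (pq : (8 * p <= q)%N).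
Hypotheses (nu0 : forall e, 0 <= nu e) (nu1 : \sum_e nu e <= 1).
Hypotheses (Xn : forall e, (absz (X e) <= n)%N) (An : forall e, (absz (A e) <= n)%N).
Hypothesis Yn : forall e, (absz (Y e) <= 3 * n ^ 2)%N.
Hypothesis hMP : forall x y : int,
  \sum_(e | (0 <= x - X e < r%:Z) && (0 <= y - Y e < p%:Z)) nu e <= MP.

Definition intercept e : int := Y e - A e * X e.
Definition vdist e e' : int := Y e - Y e' - A e' * (X e - X e').

Let n0 : (0 < n)%N. Proof. exact: leq_trans rn. Qed.
Let p0 : (0 < p)%N. Proof. by rewrite muln_gt0 r0. Qed.
Let pq' : (p <= q)%N. Proof. by apply: leq_trans pq; rewrite leq_pmull. Qed.
Let p0R : 0 < p%:R :> R. Proof. by rewrite ltr0n. Qed.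
Let q0R : 0 < q%:R :> R. Proof. by rewrite ltr0n (leq_trans p0). Qed.
Let r0R : 0 < r%:R :> R. Proof. by rewrite ltr0n. Qed.
Let n0R : 0 < n%:R :> R. Proof. by rewrite ltr0n. Qed.

(** For [|x| <= 4 n] a line stays within [8 n^2], with [4 n^2] from the slope and [4 n^2] from the
    intercept; [q] is the half-width of the kernel. *)
Let M := (8 * n ^ 2 + q)%N.
(** Each point is smeared over an [r] by [p] rectangle to give the density [rho] a controlled [L^2]
    norm. As slopes are at most [n] and [p = r n], the vertical distance to a line changes by at
    most [2 p] inside the rectangle. *)
Let eta e (x y : int) : bool := (0 <= x - X e < r%:Z) && (0 <= y - Y e < p%:Z).
Let F (x y : int) : R := \sum_e nu e * ikern R p q (y - (A e * x + intercept e)).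
Let rho (x y : int) : R := (\sum_e nu e * (eta e x y)%:R) / (r * p)%:R.

Let rp0 : 0 < (r * p)%:R :> R. Proof. by rewrite natrM mulr_gt0. Qed.
Let nn : (n <= n ^ 2)%N. Proof. by rewrite leq_pmulr. Qed.

Lemma zsum_interval m (w : nat) (c : int) : (absz c + w <= m)%N ->
  zsum m (fun x => (0 <= x - c < w%:Z)%R%:R) = w%:R :> R.
Proof.
move=> cm; have -> : zsum m (fun x => (0 <= x - c < w%:Z)%R%:R : R) =
    zsum w (fun x => (0 <= x < w%:Z)%R%:R).
  rewrite -(@zsum_shift R m w c (fun u => (0 <= u < w%:Z)%R%:R)) // => u wu.
  by have -> : (0 <= u < w%:Z) = false by apply/negbTE; lia.
rewrite /zsum (big_cat_nat (leq0n w)) /=; last by lia.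
rewrite big_nat big1 ?add0r => [|j jw]; last first.
  by have -> : (0 <= j%:Z - w%:Z < w%:Z) = false by apply/negbTE; lia.
rewrite big_nat_recr /=; last by lia.
have -> : (0 <= (2 * w)%N%:Z - w%:Z < w%:Z) = false by apply/negbTE; lia.
rewrite addr0 big_nat (eq_bigr (fun=> 1)) => [|j jw]; last first.
  by have -> : (0 <= j%:Z - w%:Z < w%:Z) = true by lia.
by rewrite -big_nat sumr_const_nat mul2n -addnn addnK.
Qed.

Lemma zsum_eta e : zsum (4 * n) (fun x => zsum M (fun y => (eta e x y)%:R)) =
  (r * p)%:R :> R.
Proof.
rewrite natrM -(@zsum_interval (4 * n) r (X e)); last by have := Xn e; lia.
rewrite mulr_zsuml; apply: eq_zsum => x; rewrite /eta.
rewrite -(@zsum_interval M p (Y e)); last first.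
  by have := Yn e; have := pq'; rewrite /M; lia.
by rewrite mulr_zsumr; apply: eq_zsum => y; rewrite -mulnb natrM.
Qed.

Definition excess : R := \sum_e \sum_e' nu e * nu e' *
  ((4 * absz (vdist e e') <= q)%N%:R / (2 * q%:R) -
   (absz (vdist e e') <= 3 * p)%N%:R / p%:R).

(** The thresholds in [excess] absorb the displacement [2 p]: from [q / 4] it leads to at most
    [q / 2], because [8 p <= q], where the wide hat is at least [1 / 2]; from beyond [3 p] it leads
    to beyond [p], where the narrow hat vanishes. *)
Lemma kern_excess e e' x y : eta e x y ->
  (4 * absz (vdist e e') <= q)%N%:R / (2 * q%:R) -
   (absz (vdist e e') <= 3 * p)%N%:R / p%:R <=
  - ikern R p q (y - (A e' * x + intercept e')).
Proof.
move=> /andP[hx hy]; set u := y - _; set v := absz _.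
have uv : (absz (u - vdist e e')%R <= 2 * p)%N.
  have -> : u - vdist e e' = (y - Y e) - A e' * (x - X e).
    by rewrite /u /vdist /intercept; ring.
  have : (absz (A e' * (x - X e))%R <= n * r)%N.
    by rewrite abszM; apply: leq_mul => //; lia.
  by rewrite /p mulnC; move: hy; rewrite /p; lia.
have H1 : (4 * v <= q)%N%:R / (2 * q%:R) <= tent (u%:~R / q%:R) / q%:R :> R.
  have [vq|_] := leqP (4 * v) q; last first.
    by rewrite mul0r divr_ge0 ?tent_ge0.
  rewrite invfM mulrA ler_pM2r ?invr_gt0 //; apply: tent_half.
  rewrite normrM normfV (gtr0_norm q0R) ler_pdivrMr // -absz_intrE.
  have : (2 * absz u <= q)%N by move: uv vq pq; rewrite /v; lia.
  by rewrite -(ler_nat R) natrM; lra.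
have H2 : tent (u%:~R / p%:R) / p%:R <= (v <= 3 * p)%N%:R / p%:R :> R.
  rewrite ler_pM2r ?invr_gt0 //; have [vp|vp] := leqP v (3 * p).
    exact: tent_le1.
  rewrite tent_out // normrM normfV (gtr0_norm p0R) ler_pdivlMr // mul1r.
  by rewrite -absz_intrE ler_nat; move: uv vp; rewrite /v; lia.
by rewrite /ikern /kern; move: H1 H2; lra.
Qed.

Lemma excess_le : excess <= - zsum (4 * n) (fun x => zsum M (fun y => rho x y * F x y)).
Proof.
have -> : - zsum (4 * n) (fun x => zsum M (fun y => rho x y * F x y)) =
   \sum_e \sum_e' nu e * nu e' * (zsum (4 * n) (fun x => zsum M (fun y =>
     (eta e x y)%:R * - ikern R p q (y - (A e' * x + intercept e')))) / (r * p)%:R).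
  transitivity (zsum (4 * n) (fun x => \sum_e \sum_e' nu e * nu e' *
      (zsum M (fun y => (eta e x y)%:R *
         - ikern R p q (y - (A e' * x + intercept e'))) / (r * p)%:R))).
    rewrite -mulN1r mulr_zsumr; apply: eq_zsum => x; rewrite mulr_zsumr.
    transitivity (zsum M (fun y => \sum_e \sum_e' nu e * nu e' * ((eta e x y)%:R *
         - ikern R p q (y - (A e' * x + intercept e')) / (r * p)%:R))).
      apply: eq_zsum => y; rewrite /rho /F mulN1r -mulNr -mulrN -mulrA mulr_suml.
      apply: eq_bigr => e _; rewrite mulr_sumr mulr_sumr; apply: eq_bigr => e' _.
      by ring.
    rewrite zsum_sum2; apply: eq_bigr => e _; apply: eq_bigr => e' _.
    by rewrite mulr_zsuml.
  rewrite zsum_sum2; apply: eq_bigr => e _; apply: eq_bigr => e' _.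
  by rewrite mulr_zsuml.
apply: ler_sum => e _; apply: ler_sum => e' _; rewrite ler_wpM2l ?mulr_ge0 //.
rewrite ler_pdivlMr // -(zsum_eta e) mulr_zsumr; apply: ler_zsum => x _.
rewrite mulr_zsumr; apply: ler_zsum => y _.
have [ex|_] := boolP (eta e x y); last by rewrite mulr0 mul0r.
by rewrite mulr1 mul1r; exact: kern_excess.
Qed.

Lemma rho_ge0 x y : 0 <= rho x y.
Proof. by rewrite divr_ge0 // sumr_ge0 // => e _; rewrite mulr_ge0. Qed.

Lemma rho_le x y : rho x y <= MP / (r * p)%:R.
Proof.
rewrite ler_pM2r ?invr_gt0 //; apply: le_trans (hMP x y).
rewrite [leRHS]big_mkcond; apply: ler_sum => e _ /=; rewrite -/(eta e x y).
by case: (eta e x y); rewrite ?mulr1 ?mulr0.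
Qed.

Lemma zsum_rho_sqr_le :
  zsum (4 * n) (fun x => zsum M (fun y => rho x y ^+ 2)) <= MP / (r * p)%:R.
Proof.
have MP0 : 0 <= MP / (r * p)%:R by apply: le_trans (rho_ge0 0 0) (rho_le 0 0).
apply: (@le_trans _ _ (zsum (4 * n) (fun x => zsum M (fun y => rho x y)) *
                       (MP / (r * p)%:R))).
  rewrite mulr_zsuml; apply: ler_zsum => x _; rewrite mulr_zsuml; apply: ler_zsum => y _.
  by rewrite expr2 ler_wpM2l ?rho_ge0 // rho_le.
rewrite ler_piMl //; apply: le_trans nu1.
have -> : zsum (4 * n) (fun x => zsum M (fun y => rho x y)) =
   \sum_e nu e * (zsum (4 * n) (fun x => zsum M (fun y => (eta e x y)%:R)) / (r * p)%:R).
  transitivity (zsum (4 * n) (fun x => \sum_e nu e *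
      (zsum M (fun y => (eta e x y)%:R) / (r * p)%:R))).
    apply: eq_zsum => x; rewrite /rho.
    transitivity (zsum M (fun y => \sum_e nu e * ((eta e x y)%:R / (r * p)%:R))).
      apply: eq_zsum => y; rewrite mulr_suml; apply: eq_bigr => e _.
      by rewrite mulrA.
    by rewrite zsum_sum; apply: eq_bigr => e _; rewrite mulr_zsuml mulr_zsumr.
  rewrite zsum_sum; apply: eq_bigr => e _.
  by rewrite mulr_zsuml mulr_zsumr.
by apply: ler_sum => e _; rewrite zsum_eta divff ?mulr1 // gt_eqF.
Qed.

Lemma zsum_F_sqr :
  zsum (4 * n) (fun x => cutoff R n x * zsum M (fun y => F x y ^+ 2)) =
  \sum_e \sum_e' nu e * nu e' *
    crossterm R n p q (A e - A e') (intercept e - intercept e').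
Proof.
rewrite /crossterm -zsum_sum2; apply: eq_zsum_in => x xn.
transitivity (cutoff R n x * \sum_e \sum_e' nu e * nu e' *
    zsum q (fun u => ikern R p q u * ikern R p q (u + ((A e - A e') * x +
      (intercept e - intercept e'))))); last first.
  rewrite mulr_sumr; apply: eq_bigr => e _; rewrite mulr_sumr; apply: eq_bigr => e' _.
  by rewrite mulrCA.
congr (_ * _).
transitivity (zsum M (fun y => \sum_e \sum_e' nu e * nu e' *
    (ikern R p q (y - (A e * x + intercept e)) *
     ikern R p q (y - (A e' * x + intercept e'))))).
  apply: eq_zsum => y; rewrite /F expr2 mulr_suml; apply: eq_bigr => e _.
  by rewrite mulr_sumr; apply: eq_bigr => e' _; ring.
rewrite zsum_sum2; apply: eq_bigr => e _; apply: eq_bigr => e' _; congr (_ * _).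
rewrite -(@zsum_shift R M q (A e * x + intercept e)
  (fun u => ikern R p q u * ikern R p q (u + ((A e - A e') * x +
      (intercept e - intercept e'))))).
- by apply: eq_zsum => y; congr (_ * ikern R p q _); ring.
- by move=> u qu; rewrite ikern_out ?mul0r // ltnW.
have AX z : (absz z <= 4 * n)%N -> (absz (A e * z)%R <= 4 * n ^ 2)%N.
  by move=> zn; rewrite abszM -mulnn mulnCA; apply: leq_mul.
have := AX x xn; have Xe : (absz (X e) <= 4 * n)%N by have := Xn e; lia.
have : (absz (A e * X e)%R <= n ^ 2)%N by rewrite abszM -mulnn leq_mul.
by rewrite /intercept /M; have := Yn e; lia.
Qed.

Lemma high_low_int : 0 <= excess ->
  excess ^+ 2 <= MP / (r * p * n)%:R * \sum_e \sum_e' nu e * nu e' *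
    `|crossterm R n p q (A e - A e') (intercept e - intercept e')|.
Proof.
move=> ex0; set D := zsum (4 * n) (fun x => zsum M (fun y => rho x y * F x y)).
have exD : excess ^+ 2 <= D ^+ 2.
  by have := excess_le; rewrite -/D => exD; rewrite -[leRHS]sqrrN ler_sqr ?nnegrE // (le_trans ex0).
apply: le_trans exD _.
(* On the support of [rho] the abscissa is at most [2 n], so [cutoff] dominates [n] there; elsewhere
   [F] has to be discarded before the weight can be inserted. *)
pose F1 x y := (rho x y != 0)%:R * F x y.
have -> : D = zsum (4 * n) (fun x => zsum M (fun y => rho x y * F1 x y)).
  apply: eq_zsum => x; apply: eq_zsum => y; rewrite /F1.
  by have [->|_] := eqVneq (rho x y) 0; rewrite ?mul0r // mul1r.
apply: le_trans (zsum2_cauchy_schwarz _ _ _ _) _.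
rewrite natrM invfM mulrA -mulrA; apply: ler_pM.
- by apply: sumr_ge0 => i _; apply: sumr_ge0 => j _; rewrite sqr_ge0.
- by apply: sumr_ge0 => i _; apply: sumr_ge0 => j _; rewrite sqr_ge0.
- exact: zsum_rho_sqr_le.
rewrite [leRHS]mulrC ler_pdivlMr //.
apply: (@le_trans _ _ (zsum (4 * n) (fun x => cutoff R n x * zsum M (fun y => F x y ^+ 2)))).
  rewrite mulr_zsuml; apply: ler_zsum => x xn; rewrite mulr_zsuml mulr_zsumr.
  apply: ler_zsum => y _; rewrite /F1 mulrC; have := cutoff_bound R xn => /andP[c0 _].
  have [_|rxy] := eqVneq (rho x y) 0.
    by rewrite mul0r expr0n mulr0 mulr_ge0 // sqr_ge0.
  rewrite mul1r ler_wpM2r ?sqr_ge0 //.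
  have [e ex] : exists e, eta e x y.
    apply: contrapT => nex; move: rxy; rewrite /rho big1 ?mul0r ?eqxx // => e _.
    by case: (boolP (eta e x y)) => [h|_]; [case: nex; exists e|rewrite mulr0].
  have : (absz x <= 2 * n)%N.
    by move: ex (Xn e) rn => /andP[] ; lia.
  by rewrite -(ler_nat R) natrM /cutoff; move: n0R; lra.
rewrite zsum_F_sqr; apply: ler_sum => e _; apply: ler_sum => e' _.
by rewrite ler_wpM2l ?mulr_ge0 // ler_norm.
Qed.

End HighLowInt.

(** * The high-low inequality for weighted flags *)

Section AngularClasses.
Variable R : realType.

Lemma scale_cases (d t : R) k : 0 < d <= 1 -> t <= 2 ->
  t <= 2 * d ^+ k \/ exists2 m, (m < k)%N & d ^+ m.+1 < t <= 2 * d ^+ m.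
Proof.
move=> d01 t2; elim: k => [|k [IHk|[m mk h]]]; first by left; rewrite expr0 mulr1.
  have [le|lt] := lerP t (d ^+ k.+1).
    left; have : 0 <= d ^+ k.+1 by apply: exprn_ge0; lra.
    lra.
  by right; exists k => //; rewrite lt.
by right; exists m => //; rewrite ltnS ltnW.
Qed.

Variables (I : finType) (nu a b : I -> R) (T : I -> I -> R).
Variables (d K1 K2 : R) (k : nat) (lam : nat -> R).
Hypotheses (d0 : 0 < d) (d1 : d <= 1) (K10 : 0 <= K1) (K20 : 0 <= K2).
Hypotheses (nu0 : forall e, 0 <= nu e) (nu1 : \sum_e nu e <= 1).
Hypothesis a1 : forall e, `|a e| <= 1.
Hypothesis hL : forall m (a0 b0 : R), (m <= k)%N ->
  \sum_(e | (`|a e - a0| <= 100 * d ^+ m) && (`|b e - b0| <= 100 * d ^+ m)) nu e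
     <= lam m.
Hypothesis T_trivial : forall e e', `|T e e'| <= K1.
Hypothesis T_support : forall e e', T e e' != 0 ->
  `|b e' - b e| <= 83 * d ^+ k + 4 * `|a e - a e'|.
Hypothesis T_transversal : forall e e', d ^+ k <= `|a e - a e'| ->
  `|T e e'| <= K2 / `|a e - a e'| ^+ 2.

Let near (e e' : I) (s : R) : bool :=
  (`|a e' - a e| <= 100 * s) && (`|b e' - b e| <= 100 * s).

Let dpos m : 0 < d ^+ m. Proof. exact: exprn_gt0. Qed.
Let coef0 m : 0 <= K2 / (d ^+ m.+1) ^+ 2.
Proof. by rewrite divr_ge0 // exprn_ge0 // ltW. Qed.

(** The angle puts a pair in one of [k + 1] scales. Strips that meet over a bounded range have
    intercepts as close as their slopes, up to the width: if the slopes differ by at most [2 d^m],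
    the intercepts differ by at most [(83 + 8) d^m]. So at scale [m] the second line lies in a ball
    of radius [100 d^m] around the first. *)
Lemma class_bound e e' : `|T e e'| <= K1 * (near e e' (d ^+ k))%:R +
   \sum_(m < k) K2 / (d ^+ m.+1) ^+ 2 * (near e e' (d ^+ m))%:R.
Proof.
have sum0 : 0 <= \sum_(m < k) K2 / (d ^+ m.+1) ^+ 2 * (near e e' (d ^+ m))%:R.
  by apply: sumr_ge0 => m _; apply: mulr_ge0.
have fst0 (c : bool) : 0 <= K1 * c%:R by rewrite mulr_ge0.
have [->|c0] := eqVneq (T e e') 0; first by rewrite normr0 addr_ge0.
have sup := T_support c0.
have t2 : `|a e - a e'| <= 2.
  by have := a1 e; have := a1 e'; rewrite !ler_norml; lra.
have d01 : 0 < d <= 1 by move: d0 d1; lra.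
have [tW|[m mk /andP[t1' t2']]] := scale_cases k d01 t2.
  rewrite -[leLHS]addr0; apply: lerD => //.
  have -> : near e e' (d ^+ k) = true.
    by rewrite /near distrC; apply/andP; split; move: tW sup (dpos k); lra.
  by rewrite mulr1 T_trivial.
have dmk : d ^+ k <= d ^+ m.+1 by apply: ler_wiXn2l mk => //; exact: ltW.
rewrite -[leLHS]add0r; apply: lerD => //.
rewrite (bigD1 (Ordinal mk)) //= -[leLHS]addr0; apply: lerD; last first.
  by apply: sumr_ge0 => i _; apply: mulr_ge0.
have dm0 := dpos m.
have dmS : d ^+ m.+1 <= d ^+ m by rewrite exprS ler_piMl ?(ltW dm0) //; move: d01; lra.
have -> : near e e' (d ^+ m) = true.
  by rewrite /near distrC; apply/andP; split; move: t2' dmk dmS sup dm0; lra.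
have dS0 := dpos m.+1.
rewrite mulr1; apply: le_trans (T_transversal _) _; first by move: dmk t1'; lra.
have t0 : 0 < `|a e - a e'| by apply: lt_trans t1'.
by rewrite ler_wpM2l // lef_pV2 ?posrE ?exprn_gt0 // ler_pXn2r ?nnegrE ?ltW.
Qed.

Lemma sum_class_le :
  \sum_e \sum_e' nu e * nu e' * `|T e e'| <=
  K1 * lam k + \sum_(m < k) K2 / (d ^+ m.+1) ^+ 2 * lam m.
Proof.
set S := (X in _ <= X).
have row e : \sum_e' nu e' * `|T e e'| <= S.
  apply: (@le_trans _ _ (\sum_e' (K1 * (nu e' * (near e e' (d ^+ k))%:R) +
     \sum_(m < k) K2 / (d ^+ m.+1) ^+ 2 * (nu e' * (near e e' (d ^+ m))%:R)))).
    apply: ler_sum => e' _; apply: le_trans (ler_wpM2l (nu0 e') (class_bound e e')) _.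
    rewrite mulrDr mulr_sumr mulrCA lerD2l; apply: ler_sum => m _.
    by rewrite mulrCA.
  have nearE s : \sum_e' nu e' * (near e e' s)%:R = \sum_(e' | near e e' s) nu e'.
    rewrite [RHS]big_mkcond; apply: eq_bigr => e' _.
    by case: (near e e' s); rewrite ?mulr1 ?mulr0.
  rewrite big_split /= -mulr_sumr nearE exchange_big /=; apply: lerD.
    by rewrite ler_wpM2l // hL.
  apply: ler_sum => m _; rewrite -mulr_sumr nearE; apply: ler_wpM2l => //; apply: hL; exact: ltnW.
have T0 : 0 <= S.
  have lam0 m : (m <= k)%N -> 0 <= lam m.
    by move=> mk; apply: le_trans (hL 0 0 mk); apply: sumr_ge0.
  apply: addr_ge0; first by rewrite mulr_ge0 ?lam0.
  by apply: sumr_ge0 => m _; apply: mulr_ge0 => //; apply: lam0; apply: ltnW.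
apply: (@le_trans _ _ (\sum_e nu e * S)).
  apply: ler_sum => e _; apply: le_trans (ler_wpM2l (nu0 e) (row e)).
  by rewrite mulr_sumr; apply: ler_sum => e' _; rewrite mulrA.
by rewrite -mulr_suml ler_piMl.
Qed.

End AngularClasses.

Section Rounding.
Variable R : realType.
Implicit Types (x y a t : R) (n : nat).

Definition rnd (N : R) x : int := Num.floor (N * x).

Lemma rndP N x : N * x - 1 < (rnd N x)%:~R <= N * x.
Proof.
by rewrite /rnd floor_le andbT; have := floorD1_gt (N * x); rewrite intrD; lra.
Qed.

Lemma absz_rnd_le (N x : R) (B : nat) : `|N * x| <= B%:R -> (absz (rnd N x) <= B)%N.
Proof.
move=> h; have : - B%:R <= N * x <= B%:R by rewrite -ler_norml.
move=> /andP[h1 h2].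
have f1 : - B%:Z <= rnd N x by rewrite /rnd floor_ge_int intrN.
have f2 : rnd N x <= B%:Z by rewrite -(ler_int R) (le_trans _ h2) // /rnd floor_le.
lia.
Qed.

Lemma prod_rounding (c N x a x' a' : R) : 1 <= N -> 0 <= c ->
  `|x - x'| <= 1 -> `|a - a'| <= 1 -> `|x| <= c * N -> `|a'| <= N ->
  `|a * x - a' * x'| <= (c + 1) * N.
Proof.
move=> N1 c0 xx aa xc aN.
have -> : a * x - a' * x' = (a - a') * x + a' * (x - x') by ring.
apply: le_trans (ler_normD _ _) _; rewrite !normrM mulrDl mul1r.
apply: lerD; first by rewrite -[leRHS]mul1r; apply: ler_pM.
by rewrite -[leRHS]mulr1; apply: ler_pM.
Qed.

End Rounding.

Section HighLow.
Variables (R : realType) (I : finType) (nu x y a : I -> R) (d : R) (k : nat).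
Hypotheses (d0 : 0 < d) (d1 : d <= 1 / 1000).
Hypotheses (nu0 : forall e, 0 <= nu e) (nu1 : \sum_e nu e <= 1).
Hypotheses (x1 : forall e, `|x e| <= 1) (a1 : forall e, `|a e| <= 1).
Hypothesis y2 : forall e, `|y e| <= 2.

Definition rvdist e e' : R := y e - y e' - a e' * (x e - x e').
Definition rintercept e : R := y e - a e * x e.
Definition incidence (w : R) : R :=
  \sum_e \sum_e' nu e * nu e' * (`|rvdist e e'| <= w)%R%:R.

Let W := d ^+ k.
Let w := d ^+ k.+1.
Let W0 : 0 < W. Proof. exact: exprn_gt0. Qed.
Let w0 : 0 < w. Proof. exact: exprn_gt0. Qed.
Let W1 : W <= 1. Proof. by rewrite /W exprn_ile1 //; move: d0 d1; lra. Qed.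
Let wW : w <= W / 1000.
Proof. by rewrite /w exprS -/W; have := ler_wpM2l (ltW W0) d1; lra. Qed.

Variables n r q : nat.
Hypothesis nP : 5000 <= n%:R * w ^+ 2 * W.
Hypothesis rP : n%:R * w <= (r%:R : R) <= 2 * n%:R * w.
Hypothesis qP : 40 * n%:R ^+ 2 * W <= (q%:R : R) <= 41 * n%:R ^+ 2 * W.
Let n_gt0 : (0 < n)%N.
Proof. by rewrite lt0n; apply/eqP => n0; move: nP; rewrite n0 !mul0r; lra. Qed.
Let n0 : 0 < n%:R :> R. Proof. by rewrite ltr0n. Qed.
Let nw : 5000 <= n%:R * w.
Proof.
apply: le_trans nP _; rewrite -mulrA ler_wpM2l //.
have ww1 : w <= 1 by move: wW W1 W0; lra.
by rewrite expr2 -mulrA ler_piMr ?mulr_ile1 // ltW.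
Qed.
Let nW : 5000 <= n%:R * W.
Proof. by apply: le_trans nw _; rewrite ler_wpM2l //; move: wW W0; lra. Qed.

Let n1 : 1 <= n%:R :> R. Proof. by rewrite ler1n. Qed.
Let n2W : 5000 <= n%:R ^+ 2 * W.
Proof.
rewrite expr2 -mulrA; apply: le_trans nW _; rewrite ler_peMl ?ler1n //.
by rewrite mulr_ge0 // ltW.
Qed.
Let p := (r * n)%N.
Let pP : n%:R ^+ 2 * w <= p%:R <= 2 * n%:R ^+ 2 * w.
Proof. by rewrite /p natrM; move: rP n0; nra. Qed.

(** Ordinates live on a grid of step [1 / n^2] because slope and abscissa, both on a grid of step
    [1 / n], are multiplied. Rounding then changes vertical distances by [O(n)], which is negligible
    against [n^2 w]. *)
Let X e := rnd n%:R (x e).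
Let A e := rnd n%:R (a e).
Let Y e := rnd (n%:R ^+ 2) (y e).

Let r0 : (0 < r)%N.
Proof. by rewrite -(ltr0n R); move: rP nw; lra. Qed.
Let rn : (r <= n)%N.
Proof.
rewrite -(ler_nat R); have /andP[_ h] := rP; apply: le_trans h _.
have : 2 * w <= 1 by move: wW W1; lra.
by move=> /(ler_wpM2l (ltW n0)); lra.
Qed.
Let pq : (8 * p <= q)%N.
Proof.
rewrite -(ler_nat R) natrM; move: pP qP => /andP[_ h1] /andP[h2 _].
have n20 : 0 <= n%:R ^+ 2 :> R by rewrite exprn_ge0.
by have := ler_wpM2l n20 wW; have := mulr_ge0 n20 (ltW W0); lra.
Qed.

Let Xn e : (absz (X e) <= n)%N.
Proof.
by apply: absz_rnd_le; rewrite normrM ger0_norm // ler_piMr // ltW.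
Qed.
Let An e : (absz (A e) <= n)%N.
Proof.
by apply: absz_rnd_le; rewrite normrM ger0_norm // ler_piMr // ltW.
Qed.
Let Yn e : (absz (Y e) <= 3 * n ^ 2)%N.
Proof.
apply: absz_rnd_le; rewrite normrM ger0_norm ?exprn_ge0 // mulrC natrM natrX.
by rewrite ler_wpM2r ?exprn_ge0 //; have := y2 e; lra.
Qed.
Let ARn e : `|(A e)%:~R : R| <= n%:R.
Proof. by rewrite -absz_intrE ler_nat. Qed.

Lemma vdist_rnd e e' : `|n%:R ^+ 2 * rvdist e e' - (vdist X Y A e e')%:~R| <= 4 * n%:R.
Proof.
have hx := rndP n%:R (x e); have hx' := rndP n%:R (x e').
have ha := rndP n%:R (a e'); have hy := rndP (n%:R ^+ 2) (y e).
have hy' := rndP (n%:R ^+ 2) (y e').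
have h1 : `|n%:R * (x e - x e') - (X e - X e')%:~R| <= 1.
  by rewrite intrB ler_norml mulrBr; move: hx hx'; rewrite -/(X e) -/(X e'); lra.
have h2 : `|n%:R * a e' - (A e')%:~R| <= 1.
  by rewrite ler_norml; move: ha; rewrite -/(A e'); lra.
have h3 : `|n%:R * (x e - x e')| <= 2 * n%:R.
  rewrite normrM ger0_norm // mulrC ler_wpM2r //.
  by have := x1 e; have := x1 e'; rewrite !ler_norml; lra.
have := prod_rounding n1 (ler0n R 2) h1 h2 h3 (ARn e').
rewrite /vdist /rvdist !intrB intrM intrB.
rewrite -/(Y e) -/(Y e') in hy hy' *.
have -> : n%:R * a e' * (n%:R * (x e - x e')) = n%:R ^+ 2 * (a e' * (x e - x e')) by ring.
by rewrite !ler_norml; move: hy hy' n1; lra.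
Qed.

Lemma intercept_rnd e : `|n%:R ^+ 2 * rintercept e - (intercept X Y A e)%:~R| <= 3 * n%:R.
Proof.
have hx := rndP n%:R (x e); have ha := rndP n%:R (a e).
have hy := rndP (n%:R ^+ 2) (y e).
have h1 : `|n%:R * x e - (X e)%:~R| <= 1.
  by rewrite ler_norml; move: hx; rewrite -/(X e); lra.
have h2 : `|n%:R * a e - (A e)%:~R| <= 1.
  by rewrite ler_norml; move: ha; rewrite -/(A e); lra.
have h3 : `|n%:R * x e| <= 1 * n%:R.
  by rewrite normrM ger0_norm // mul1r ler_piMr // ltW.
have := prod_rounding n1 ler01 h1 h2 h3 (ARn e).
rewrite /intercept /rintercept intrB intrM.
have -> : n%:R * a e * (n%:R * x e) = n%:R ^+ 2 * (a e * x e) by ring.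
by rewrite -/(Y e) in hy *; rewrite !ler_norml; move: hy n1; lra.
Qed.

(** With [q] between 40 and 41 times [n^2 W], a distance [8 W] becomes after rounding at most
    [10 n^2 W <= q / 4], and [2 q <= 82 n^2 W]. Conversely [3 p <= 6 n^2 w], and rounding keeps this
    below [8 n^2 w]. *)
Lemma excess_lower : incidence (8 * W) / (82 * (n%:R ^+ 2 * W)) -
  incidence (8 * w) / (n%:R ^+ 2 * w) <= excess nu n r q X Y A.
Proof.
rewrite /incidence !mulr_suml -sumrB; apply: ler_sum => e _.
rewrite !mulr_suml -sumrB; apply: ler_sum => e' _.
rewrite -[X in X - _]mulrA -[X in _ - X]mulrA -mulrBr ler_wpM2l ?mulr_ge0 //.
have := vdist_rnd e e'; rewrite ler_norml => /andP[v1 v2].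
have /andP[q1 q2] := qP; have /andP[p1 p2] := pP.
have n20 : 0 < n%:R ^+ 2 :> R by rewrite exprn_gt0.
have q0 : 0 < q%:R :> R by rewrite ltr0n (leq_trans _ pq) // muln_gt0 /= muln_gt0 r0.
have n2w0 : 0 < n%:R ^+ 2 * w by rewrite mulr_gt0.
have nnW : 5000 * n%:R <= n%:R ^+ 2 * W.
  by rewrite expr2 -mulrA mulrC ler_wpM2l // ltW.
have nnw : 5000 * n%:R <= n%:R ^+ 2 * w.
  by rewrite expr2 -mulrA mulrC ler_wpM2l // ltW.
apply: lerB.
  have [vW|_] := lerP `|rvdist e e'| (8 * W); last by rewrite mul0r divr_ge0 // mulr_ge0 // ltW.
  have -> : (4 * absz (vdist X Y A e e') <= q)%N.
    rewrite -(ler_nat R) natrM absz_intrE.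
    have : `|n%:R ^+ 2 * rvdist e e'| <= n%:R ^+ 2 * (8 * W).
      by rewrite normrM ger0_norm ?ler_wpM2l // ltW.
    rewrite ler_norml => /andP[z1 z2].
    have : `|(vdist X Y A e e')%:~R| <= 10 * (n%:R ^+ 2 * W) :> R.
      by rewrite ler_norml; move: v1 v2 z1 z2 nnW; lra.
    by move: q1; lra.
  rewrite !mul1r lef_pV2 ?posrE ?mulr_gt0 //; move: q2; lra.
have [vp|_] := leqP (absz (vdist X Y A e e')) (3 * p); last first.
  by rewrite mul0r divr_ge0 // ltW.
have -> : `|rvdist e e'| <= 8 * w.
  move: vp; rewrite -(ler_nat R) natrM absz_intrE ler_norml => /andP[z1 z2].
  rewrite -(ler_pM2l n20) -[X in X * `|_|]ger0_norm ?(ltW n20) // -normrM.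
  by rewrite ler_norml; move: v1 v2 z1 z2 nnw p2; lra.
by rewrite !mul1r lef_pV2 ?posrE // (lt_le_trans n2w0).
Qed.

Variable MP : R.
Hypothesis hP : forall x0 y0 : R,
  \sum_(e | (`|x e - x0| <= 3 * d ^+ k.+1) && (`|y e - y0| <= 3 * d ^+ k.+1)) nu e <= MP.
Let hMP (u v : int) :
  \sum_(e | (0 <= u - X e < r%:Z) && (0 <= v - Y e < p%:Z)) nu e <= MP.
Proof.
apply: le_trans (hP (u%:~R / n%:R) (v%:~R / n%:R ^+ 2)).
rewrite big_mkcond [leRHS]big_mkcond; apply: ler_sum => e _.
case: ifPn => [/andP[hu hv]|_]; last by case: ifP.
have n20 : 0 < n%:R ^+ 2 :> R by rewrite exprn_gt0.
have hx := rndP n%:R (x e); have hy := rndP (n%:R ^+ 2) (y e).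
rewrite -/(X e) -/(Y e) in hx hy.
have hu' : 0 <= (u%:~R - (X e)%:~R : R) <= r%:R.
  by rewrite -intrB ler0z (pmulrn 1 r) ler_int; clear -hu; lia.
have hv' : 0 <= (v%:~R - (Y e)%:~R : R) <= p%:R.
  by rewrite -intrB ler0z (pmulrn 1 p) ler_int; clear -hv; lia.
have -> : `|x e - u%:~R / n%:R| <= 3 * d ^+ k.+1.
  rewrite -(ler_pM2l n0) -[X in X * `|_|]ger0_norm ?(ltW n0) // -normrM mulrBr.
  rewrite [n%:R * (_ / _)]mulrC divfK ?gt_eqF // -/w.
  have /andP[_ r2] := rP; rewrite ler_norml; move: nw hx hu' r2; lra.
have -> // : `|y e - v%:~R / n%:R ^+ 2| <= 3 * d ^+ k.+1.
rewrite -(ler_pM2l n20) -[X in X * `|_|]ger0_norm ?(ltW n20) // -normrM mulrBr.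
rewrite [n%:R ^+ 2 * (_ / _)]mulrC divfK ?gt_eqF // -/w.
have /andP[p1 p2] := pP.
have : 5000 <= n%:R ^+ 2 * w.
  by apply: le_trans nw _; rewrite expr2 -mulrA ler_peMl // mulr_ge0 // ltW.
by rewrite ler_norml; move: hy hv' p2; lra.
Qed.

Let cterm e e' := crossterm R n p q (A e - A e') (intercept X Y A e - intercept X Y A e').
Let n20 : 0 < n%:R ^+ 2 :> R. Proof. by rewrite exprn_gt0. Qed.

Lemma cterm_trivial e e' : `|cterm e e'| <= 216 / w.
Proof.
have pp0 : (0 < p)%N by rewrite /p muln_gt0 r0.
have pq' : (p <= q)%N by apply: leq_trans pq; rewrite leq_pmull.
apply: le_trans (crossterm_trivial R _ pp0 pq' _ _) _ => //.
have /andP[p1 _] := pP.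
rewrite ler_pdivrMr ?ltr0n // mulrAC ler_pdivlMr // -mulrA ler_wpM2l //.
Qed.

Lemma theta_rnd e e' : `|n%:R * (a e - a e') - (A e - A e')%:~R| <= 1.
Proof.
have ha := rndP n%:R (a e); have ha' := rndP n%:R (a e').
by rewrite intrB ler_norml mulrBr; move: ha ha'; rewrite -/(A e) -/(A e'); lra.
Qed.

Lemma cterm_support e e' : cterm e e' != 0 ->
  `|rintercept e' - rintercept e| <= 83 * W + 4 * `|a e - a e'|.
Proof.
move=> c0; have pp0 : (0 < p)%N by rewrite /p muln_gt0 r0.
have pq' : (p <= q)%N by apply: leq_trans pq; rewrite leq_pmull.
set th := A e - A e'; set be := intercept X Y A e - intercept X Y A e'.
have [z zn zq] : exists2 z : int, (absz z <= 4 * n)%N & (absz (th * z + be)%R <= 2 * q)%N.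
  apply: contrapT => nex; move: c0; rewrite /cterm crossterm_disjoint ?eqxx // => z zn.
  by rewrite ltnNge; apply/negP => zq; apply: nex; exists z.
have /andP[_ q2] := qP.
have hbe : `|be%:~R| <= 2 * q%:R + 4 * n%:R * `|th%:~R| :> R.
  have gen (t u b : int) : b%:~R = (t * u + b)%:~R - t%:~R * u%:~R :> R.
    by rewrite intrD intrM addrAC subrr add0r.
  rewrite (gen th z be).
  apply: le_trans (ler_normB _ _) _; apply: lerD.
    by rewrite -absz_intrE -natrM ler_nat.
  by rewrite normrM mulrC ler_wpM2r // -absz_intrE -natrM ler_nat.
have hth : `|th%:~R| <= n%:R * `|a e - a e'| + 1 :> R.
  have h := theta_rnd e e'; rewrite -/th in h.
  have -> : n%:R * `|a e - a e'| = `|n%:R * (a e - a e')| by rewrite normrM ger0_norm.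
  have -> : th%:~R = n%:R * (a e - a e') - (n%:R * (a e - a e') - th%:~R) :> R by ring.
  by apply: le_trans (ler_normB _ _) _; rewrite lerD2l.
have nnW : 5000 * n%:R <= n%:R ^+ 2 * W.
  by rewrite expr2 -mulrA mulrC ler_wpM2l // ltW.
have hb : `|n%:R ^+ 2 * (rintercept e' - rintercept e)| <= `|be%:~R| + 6 * n%:R.
  have h1 := intercept_rnd e; have h2 := intercept_rnd e'.
  have -> : n%:R ^+ 2 * (rintercept e' - rintercept e) =
    (n%:R ^+ 2 * rintercept e' - (intercept X Y A e')%:~R) -
    (n%:R ^+ 2 * rintercept e - (intercept X Y A e)%:~R) - be%:~R :> R.
    by rewrite /be intrB; ring.
  apply: le_trans (ler_normB _ _) _; rewrite addrC lerD2l.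
  by apply: le_trans (ler_normB _ _) _; move: h1 h2; lra.
rewrite -(ler_pM2l n20) -[X in X * `|_|]ger0_norm ?(ltW n20) // -normrM.
apply: le_trans hb _.
have : 4 * n%:R * `|th%:~R| <= 4 * n%:R * (n%:R * `|a e - a e'| + 1) :> R.
  by rewrite ler_wpM2l // mulr_ge0.
have -> : n%:R ^+ 2 * (83 * W + 4 * `|a e - a e'|) =
   83 * (n%:R ^+ 2 * W) + 4 * n%:R * (n%:R * `|a e - a e'|) by ring.
by move: hbe q2 nnW n0; lra.
Qed.

Lemma cterm_transversal e e' : W <= `|a e - a e'| ->
  `|cterm e e'| <= 2000 * W / `|a e - a e'| ^+ 2.
Proof.
set t := `|a e - a e'| => Wt; have t0 : 0 < t := lt_le_trans W0 Wt.
have t2 : t <= 2.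
  by have := a1 e; have := a1 e'; rewrite /t !ler_norml; lra.
have pp0 : (0 < p)%N by rewrite /p muln_gt0 r0.
have pq' : (p <= q)%N by apply: leq_trans pq; rewrite leq_pmull.
set th := A e - A e'.
have nt : 5000 <= n%:R * t by apply: le_trans nW _; rewrite ler_wpM2l.
have hth : n%:R * t / 2 <= (`|th%:~R| : R) <= 2 * n%:R.
  apply/andP; split; last first.
    by rewrite /th intrB (le_trans (ler_normB _ _)) //; have := ARn e; have := ARn e'; lra.
  have := theta_rnd e e'; have : n%:R * t = `|n%:R * (a e - a e')| by rewrite normrM ger0_norm.
  move=> E h; have : `|n%:R * (a e - a e')| <= `|th%:~R| + 1.
    have -> : n%:R * (a e - a e') = th%:~R + (n%:R * (a e - a e') - th%:~R) by ring.
    by apply: le_trans (ler_normD _ _) _; rewrite lerD2l.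
  by rewrite -E; move: nt; lra.
have /andP[th1 th2] := hth.
have th0 : 0 < `|th%:~R| :> R by apply: lt_le_trans th1; move: nt; lra.
have thn : th != 0 by apply: contraTneq th0 => ->; rewrite normr0 ltxx.
apply: le_trans (crossterm_transversal R _ pp0 pq' _ thn) _.
  by rewrite (leq_trans r0).
have /andP[_ q2] := qP; have /andP[p1 _] := pP.
have tt0 : 0 < t ^+ 2 by rewrite exprn_gt0.
have Wt4 : W / 4 <= W / t ^+ 2.
  rewrite ler_pM2l // lef_pV2 ?posrE // expr2.
  have : t * t <= 2 * 2 by apply: ler_pM => //; exact: ltW.
  by lra.
have E1 : 2 * q%:R / th%:~R ^+ 2 <= 328 * (W / t ^+ 2) :> R.
  rewrite -[th%:~R ^+ 2]real_normK ?num_real // ler_pdivrMr ?exprn_gt0 //.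
  apply: (@le_trans _ _ (328 * (W / t ^+ 2) * (n%:R * t / 2) ^+ 2)); last first.
    apply: ler_wpM2l; first exact: (mulr_ge0 (ler0n R 328) (divr_ge0 (ltW W0) (ltW tt0))).
    by rewrite ler_pXn2r ?nnegrE // divr_ge0 // mulr_ge0 // ltW.
  have -> : 328 * (W / t ^+ 2) * (n%:R * t / 2) ^+ 2 = 82 * n%:R ^+ 2 * W.
    by field; rewrite gt_eqF.
  by move: q2; lra.
have ww1 : w <= 1 by move: wW W1 W0; lra.
have nWW : 5000 <= n%:R * W * W.
  apply: le_trans nP _; rewrite ler_wpM2r ?(ltW W0) // ler_wpM2l //.
  by rewrite expr2; apply: le_trans (ler_piMl (ltW w0) ww1) _; move: wW W0; lra.
have E2 : `|th%:~R|^-1 <= W / t ^+ 2 :> R.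
  apply: le_trans Wt4; rewrite -[leLHS]mul1r ler_pdivrMr //.
  have h1 : W * (n%:R * W) <= W * (n%:R * t) by rewrite ler_wpM2l ?ler_wpM2l // ltW.
  have h2 : W / 4 * (n%:R * t / 2) <= W / 4 * `|th%:~R| by rewrite ler_wpM2l // divr_ge0 // ltW.
  by move: h1 h2 nWW; lra.
(* The discretisation error is at most [288 / (n w^2)]; it is the term for which [n w^2 W] must be
   large. *)
have E3 : 144 * n%:R ^+ 2 * `|th%:~R| / p%:R ^+ 2 <= W / t ^+ 2 :> R.
  apply: le_trans Wt4; have pR0 : 0 < p%:R :> R by rewrite ltr0n.
  rewrite ler_pdivrMr ?exprn_gt0 //.
  apply: (@le_trans _ _ (W / 4 * (n%:R ^+ 2 * w) ^+ 2)); last first.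
    apply: ler_wpM2l; first by apply: divr_ge0 => //; apply: ltW.
    by rewrite ler_pXn2r ?nnegrE // mulr_ge0 // ltW.
  apply: (@le_trans _ _ (144 * n%:R ^+ 2 * (2 * n%:R))).
    by rewrite ler_wpM2l // mulr_ge0 // ltW.
  have -> : W / 4 * (n%:R ^+ 2 * w) ^+ 2 = n%:R ^+ 3 * (n%:R * w ^+ 2 * W) / 4 by field.
  have -> : 144 * n%:R ^+ 2 * (2 * n%:R) = n%:R ^+ 3 * 288 :> R by ring.
  have : n%:R ^+ 3 * 5000 <= n%:R ^+ 3 * (n%:R * w ^+ 2 * W) by rewrite ler_wpM2l // exprn_ge0.
  by have : 0 <= n%:R ^+ 3 :> R; [exact: exprn_ge0|lra].
have E0 : 0 <= W / t ^+ 2 by rewrite divr_ge0 // ltW.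
by rewrite -mulrA; move: E0 E1 E2 E3; lra.
Qed.

Lemma excess_sqr_le (lam : nat -> R) :
  (forall m (a0 b0 : R), (m <= k)%N ->
    \sum_(e | (`|a e - a0| <= 100 * d ^+ m) && (`|rintercept e - b0| <= 100 * d ^+ m)) nu e
       <= lam m) ->
  0 <= excess nu n r q X Y A ->
  excess nu n r q X Y A ^+ 2 <= MP / (r * (r * n) * n)%:R *
    (216 / w * lam k + \sum_(m < k) 2000 * W / (d ^+ m.+1) ^+ 2 * lam m).
Proof.
move=> hL e0; have d1' : d <= 1 by move: d1; lra.
have K1 : 0 <= 216 / w := divr_ge0 (ler0n R 216) (ltW w0).
have K2 : 0 <= 2000 * W := mulr_ge0 (ler0n R 2000) (ltW W0).
have cl := sum_class_le d0 d1' K1 K2 nu0 nu1 a1 hL cterm_trivial cterm_support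
  cterm_transversal.
apply: le_trans (high_low_int r0 rn pq nu0 nu1 Xn An Yn hMP e0) _.
apply: ler_wpM2l; last exact: cl.
apply: divr_ge0; last exact: ler0n.
by apply: le_trans (hP 0 0); apply: sumr_ge0.
Qed.

End HighLow.

Lemma rounding_parameters (R : realType) (w W : R) : 0 < w -> w <= 1 -> 0 < W -> W <= 1 ->
  exists n r q : nat,
   [/\ (5000 : R) <= n%:R * w ^+ 2 * W,
     n%:R * w <= (r%:R : R) <= 2 * n%:R * w
   & 40 * n%:R ^+ 2 * W <= (q%:R : R) <= 41 * n%:R ^+ 2 * W].
Proof.
move=> w0 w1 W0 W1; set v := w ^+ 2 * W.
have v0 : 0 < v by rewrite mulr_gt0 // exprn_gt0.
have vw : v <= w.
  rewrite /v expr2 -mulrA ler_piMr ?(ltW w0) //.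
  by apply: mulr_ile1 => //; apply: ltW.
have vW : v <= W by rewrite /v ler_piMl ?(ltW W0) // exprn_ile1 // ltW.
have [c cE] : exists c : R, c = 5000 by exists 5000.
have c0 : 0 <= c by rewrite cE; exact: ler0n.
rewrite -cE; set n := (Num.truncn (c / v)).+1.
have nv : c <= n%:R * v.
  by rewrite -ler_pdivrMr // ltW // truncnS_gt.
have n0 : 0 <= n%:R :> R by exact: ler0n.
have n1 : 1 <= n%:R :> R by rewrite ler1n.
have nw : c <= n%:R * w by apply: le_trans nv _; apply: ler_wpM2l.
have nW : c <= n%:R * W by apply: le_trans nv _; apply: ler_wpM2l.
have n2W : c <= n%:R ^+ 2 * W.
  rewrite expr2 -mulrA; apply: le_trans nW _; apply: ler_peMl => //.
  by apply: mulr_ge0 => //; exact: ltW.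
exists n, (Num.truncn (2 * n%:R * w)), (Num.truncn (40 * n%:R ^+ 2 * W)).+1; split.
- by rewrite -mulrA.
- have h0 : 0 <= 2 * n%:R * w by rewrite -mulrA; apply: mulr_ge0 => //; move: nw c0; lra.
  rewrite truncn_le h0 andbT.
  have := truncnS_gt (2 * n%:R * w); rewrite -natr1.
  by move: nw; rewrite cE; clear; lra.
- have h0 : 0 <= 40 * n%:R ^+ 2 * W by rewrite -mulrA; apply: mulr_ge0 => //; move: n2W c0; lra.
  apply/andP; split; first by apply/ltW; exact: truncnS_gt.
  have := truncn_le (40 * n%:R ^+ 2 * W); rewrite h0 -natr1 => h1.
  by move: n2W h1; rewrite cE; clear; lra.
Qed.

Section HighLow.
Variables (R : realType) (I : finType) (nu x y a : I -> R) (d : R) (k : nat).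
Hypotheses (d0 : 0 < d) (d1 : d <= 1 / 1000).
Hypotheses (nu0 : forall e, 0 <= nu e) (nu1 : \sum_e nu e <= 1).
Hypotheses (x1 : forall e, `|x e| <= 1) (a1 : forall e, `|a e| <= 1).
Hypothesis y2 : forall e, `|y e| <= 2.
Variables (MP : R) (lam : nat -> R).
Hypothesis hP : forall x0 y0 : R,
  \sum_(e | (`|x e - x0| <= 3 * d ^+ k.+1) && (`|y e - y0| <= 3 * d ^+ k.+1)) nu e <= MP.
Hypothesis hL : forall m (a0 b0 : R), (m <= k)%N ->
  \sum_(e | (`|a e - a0| <= 100 * d ^+ m) && (`|rintercept x y a e - b0| <= 100 * d ^+ m))
     nu e <= lam m.

(** The auxiliary grid disappears: [Err] is [82 n^2] times the excess, or 0 if the excess is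
    negative, and since [r >= n d^(k+1)] the factors [n^4] cancel in its square. *)
Theorem high_low : exists Err : R, [/\ 0 <= Err,
  Err ^+ 2 <= 82 ^+ 2 * 2000 * (MP / (d ^+ k.+1) ^+ 2) *
    (lam k / d ^+ k.+1 + \sum_(m < k) d ^+ k / (d ^+ m.+1) ^+ 2 * lam m)
 & incidence nu x y a (8 * d ^+ k) / d ^+ k
    <= 82 * (incidence nu x y a (8 * d ^+ k.+1) / d ^+ k.+1) + Err].
Proof.
have [c cE] : exists c : R, c = 82 ^+ 2 * 2000 by eexists.
have c0 : 0 <= c by rewrite cE -natrX -natrM; exact: ler0n.
rewrite -cE; have w0 : 0 < d ^+ k.+1 by exact: exprn_gt0.
have W0 : 0 < d ^+ k by exact: exprn_gt0.
have dle1 : d <= 1 by move: d1; lra.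
have w1 : d ^+ k.+1 <= 1 by apply: exprn_ile1 => //; exact: ltW.
have W1 : d ^+ k <= 1 by apply: exprn_ile1 => //; exact: ltW.
have [n [r [q [nP rP qP]]]] := rounding_parameters w0 w1 W0 W1.
have low := excess_lower y d0 d1 nu0 x1 a1 nP rP qP.
have sqr := excess_sqr_le d0 d1 nu0 nu1 x1 a1 y2 nP rP qP hP hL.
move: low sqr.
set e := excess _ _ _ _ _ _ _.
set I0 := incidence _ _ _ _ (8 * d ^+ k); set I1 := incidence _ _ _ _ _.
set S := \sum_(m < k) _; set S' := \sum_(m < k) _ => low sqr.
have lam0 m : (m <= k)%N -> 0 <= lam m.
  by move=> mk; apply: le_trans (hL 0 0 mk); apply: sumr_ge0.
have MP0 : 0 <= MP by apply: le_trans (hP 0 0); apply: sumr_ge0.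
have n0 : 0 < n%:R :> R.
  rewrite ltr0n lt0n; apply/eqP => E; move: nP; rewrite E !mul0r leNgt ltr0n //.
have r0 : 0 < r%:R :> R by case/andP: rP => + _; apply: lt_le_trans; exact: mulr_gt0.
have n20 : 0 < n%:R ^+ 2 :> R by exact: exprn_gt0.
have SS : S = 2000 * S'.
  by rewrite mulr_sumr; apply: eq_bigr => m _; rewrite !mulrA.
have S0 : 0 <= S'.
  apply: sumr_ge0 => m _; apply: mulr_ge0; last by apply: lam0; exact: ltnW.
  by apply: divr_ge0; [exact: ltW | apply/exprn_ge0/exprn_ge0/ltW].
set B := lam k / d ^+ k.+1 + S'.
have l0 : 0 <= lam k / d ^+ k.+1 by apply: divr_ge0; [exact: lam0 | exact: ltW].
have B0 : 0 <= B by exact: addr_ge0.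
have main : I0 / d ^+ k <= 82 * (I1 / d ^+ k.+1) + 82 * n%:R ^+ 2 * e.
  have := ler_wpM2l (ltW n20) low.
  have -> : n%:R ^+ 2 * (I0 / (82 * (n%:R ^+ 2 * d ^+ k)) - I1 / (n%:R ^+ 2 * d ^+ k.+1)) =
    (I0 / d ^+ k) / 82 - I1 / d ^+ k.+1.
    by field; rewrite !gt_eqF.
  by move=> /(ler_wpM2l (ler0n R 82)); rewrite mulrBr [82 * (_ / 82)]mulrCA divff ?mulr1 ?pnatr_eq0 // lerBlDl mulrA.
have [e0|e0] := lerP 0 e; last first.
  exists 0; split => //.
    rewrite expr0n /=; apply: mulr_ge0 => //; apply: mulr_ge0 => //.
    by apply: divr_ge0 => //; apply: exprn_ge0; exact: ltW.
  apply: le_trans main _; rewrite lerD2l -mulrA pmulr_rle0 ?ltr0n //.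
  by rewrite pmulr_rle0 // ltW.
exists (82 * n%:R ^+ 2 * e); split => //.
  by apply: mulr_ge0 => //; apply: mulr_ge0.
have w20 : 0 < (d ^+ k.+1) ^+ 2 by exact: exprn_gt0.
have rr : n%:R ^+ 4 * (d ^+ k.+1) ^+ 2 <= (r * (r * n) * n)%:R.
  have -> : (r * (r * n) * n)%:R = n%:R ^+ 2 * r%:R ^+ 2 :> R by rewrite !natrM; ring.
  have -> : n%:R ^+ 4 * (d ^+ k.+1) ^+ 2 = n%:R ^+ 2 * (n%:R * d ^+ k.+1) ^+ 2 by ring.
  rewrite ler_pM2l // ler_pXn2r ?nnegrE //; [by case/andP: rP | by apply: mulr_ge0; exact: ltW].
have rrr : 0 < (r * (r * n) * n)%:R :> R.
  by apply: lt_le_trans rr; apply: mulr_gt0 => //; exact: exprn_gt0.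
have e2 : e ^+ 2 <= MP / (n%:R ^+ 4 * (d ^+ k.+1) ^+ 2) * (2000 * B).
  apply: le_trans (sqr e0) _; apply: ler_pM.
  - by apply: divr_ge0 => //; exact: ltW.
  - apply: addr_ge0; last by rewrite SS; exact: (mulr_ge0 (ler0n R 2000) S0).
    exact: (mulr_ge0 (divr_ge0 (ler0n R 216) (ltW w0)) (lam0 k (leqnn k))).
  - apply: ler_wpM2l => //; rewrite lef_pV2 ?posrE //.
    by apply: mulr_gt0 => //; exact: exprn_gt0.
  - rewrite SS /B mulrDr lerD2r.
    rewrite [216 / _ * _]mulrAC -mulrA; apply: ler_wpM2r => //.
    by rewrite ler_nat.
have -> : (82 * n%:R ^+ 2 * e) ^+ 2 = 82 ^+ 2 * (n%:R ^+ 4 * e ^+ 2) by ring.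
have c1 : 0 <= 82 ^+ 2 :> R by rewrite -natrX; exact: ler0n.
rewrite cE (_ : 82 ^+ 2 * 2000 * (MP / (d ^+ k.+1) ^+ 2) * B =
  82 ^+ 2 * (2000 * (MP * (((d ^+ k.+1) ^+ 2)^-1 * B)))); last by ring.
apply: (ler_wpM2l c1).
have n40 : 0 < n%:R ^+ 4 :> R by exact: exprn_gt0.
apply: le_trans (ler_wpM2l (ltW n40) e2) _.
suff E : n%:R ^+ 4 * (MP / (n%:R ^+ 4 * (d ^+ k.+1) ^+ 2) * (2000 * B)) =
  2000 * (MP * (((d ^+ k.+1) ^+ 2)^-1 * B)) by rewrite E.
by field; rewrite !gt_eqF.
Qed.

End HighLow.

(** * Cells in the space of flags *)

Section Slab.
Variable R : realType.

Lemma floor_eq_dist (u v : R) : Num.floor u = Num.floor v -> `|u - v| <= 1.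
Proof.
move=> E; have h1 := floor_le u; have h2 := floorD1_gt u.
have h3 := floor_le v; have h4 := floorD1_gt v.
move: h1 h2 h3 h4; rewrite E !intrD ler_norml; set z := (_ %:~R).
by move=> h1 h2 h3 h4; lra.
Qed.

Lemma floor_eq_scale (s u v : R) : 0 < s ->
  Num.floor (u / s) = Num.floor (v / s) -> `|u - v| <= s.
Proof.
move=> s0 /floor_eq_dist; rewrite -mulrBl normrM (ger0_norm (x := s^-1)).
  by rewrite ler_pdivrMr // mul1r.
by rewrite invr_ge0 ltW.
Qed.

Lemma slab_bound (I : finType) (A : pred I) (w g : I -> R) (s L M g0 : R) :
  0 < s -> 0 <= L -> 0 <= M -> (forall e, A e -> `|g e - g0| <= L * s) ->
  (forall e0, A e0 ->
     \sum_(e | A e && (Num.floor (g e / s) == Num.floor (g e0 / s))) w e <= M) ->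
  \sum_(e | A e) w e <= (2 * L + 3) * M.
Proof.
move=> s0 L0 M0 gA cls.
pose z0 := Num.floor (g0 / s - L).
pose K := (Num.truncn (2 * L)).+2.
pose idx e : 'I_K := inord (absz (Num.floor (g e / s) - z0)%R).
have idxE e : A e -> Num.floor (g e / s) = z0 + (idx e : nat)%:Z.
  move=> /gA; have -> : g e = (g e / s) * s by rewrite divfK // gt_eqF.
  rewrite -{1}[g0](divfK (lt0r_neq0 s0)) -mulrBl normrM (ger0_norm (ltW s0)) ler_pM2r //.
  rewrite ler_norml /idx divfK ?gt_eqF // => /andP[g1 g2].
  set z := Num.floor (g e / s).
  have zge : z0 <= z by apply: le_floor; move: g1; lra.
  have lt : (absz (z - z0)%R < K)%N.
    have h1 := floor_le (g e / s); have h2 := floorD1_gt (g0 / s - L).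
    have h3 := truncnS_gt (2 * L).
    suff : ((absz (z - z0)%R).+1%:R : R) < (Num.truncn (2 * L)).+3%:R.
      by rewrite !ltr_nat; lia.
    have -> : (absz (z - z0)%R).+1%:R = z%:~R - z0%:~R + 1 :> R.
      by rewrite -natr1 -intrB; congr (_ + _); rewrite pmulrn; congr intmul; lia.
    move: h2 h3; rewrite intrD -/z0 -!natr1 => h2 h3.
    by move: h1 h2 h3 g2; rewrite -/z; lra.
  by rewrite inordK //; lia.
rewrite (partition_big idx xpredT) //=.
apply: (@le_trans _ _ (\sum_(v < K) M)).
  apply: ler_sum => v _; have [e0 /andP[Ae0 /eqP ve0]|none] := pickP (fun e => A e && (idx e == v)).
    apply: le_trans (cls e0 Ae0); rewrite (eq_bigl (fun e => A e && (Num.floor (g e / s) == Num.floor (g e0 / s)))) //.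
    move=> e; have [Ae|//] := boolP (A e); rewrite (idxE e) // (idxE e0) //= (inj_eq (addrI _)).
    by rewrite eqz_nat -ve0.
  by rewrite big1 // => e; rewrite none.
rewrite sumr_const card_ord -[leLHS]mulr_natl; apply: ler_wpM2r => //.
have := truncn_le (2 * L); rewrite mulr_ge0 // /K -!natr1 => h.
by move: h; set k := (Num.truncn _)%:R; move: L0; lra.
Qed.

(* Exchange the two sums: the normalised weights u e0 / U e0 of the e0 that see
   a given e add up to at most c e. *)
Lemma poor_mass (I : finType) (u U v c : I -> R) (rel : I -> I -> bool) (kappa : R) :
  0 <= kappa -> (forall e, 0 <= u e <= U e) -> (forall e, 0 <= v e) ->
  (forall e, \sum_(e0 | rel e0 e) u e0 / U e0 <= c e) ->
  \sum_(e0 | U e0 < kappa * \sum_(e | rel e0 e) v e) u e0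
    <= kappa * \sum_e v e * c e.
Proof.
move=> k0 uU v0 hc.
have uU0 e : 0 <= u e / U e.
  have /andP[u0 le] := uU e; apply: divr_ge0 => //; exact: le_trans le.
apply: (@le_trans _ _ (\sum_e0 kappa * (u e0 / U e0 * \sum_(e | rel e0 e) v e))).
  rewrite big_mkcond; apply: ler_sum => e0 _; case: ifPn => [lt|_].
    have /andP[u0 le] := uU e0.
    have [Uz|Unz] := eqVneq (U e0) 0.
      by rewrite Uz in le; rewrite (le_trans le) // mulr_ge0 // mulr_ge0 // sumr_ge0.
    have Up : 0 < U e0 by rewrite lt_def Unz (le_trans u0).
    rewrite mulrCA -mulrA [X in _ <= _ * X]mulrC ler_peMr //.
    by rewrite ler_pdivlMr // mul1r ltW.
  by rewrite mulr_ge0 // mulr_ge0 // sumr_ge0.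
rewrite -mulr_sumr ler_wpM2l //.
under eq_bigr do rewrite mulr_sumr big_mkcond /=.
rewrite exchange_big /=; apply: ler_sum => e _.
apply: le_trans (ler_wpM2l (v0 e) (hc e)); rewrite mulr_sumr [leRHS]big_mkcond /=.
by apply: ler_sum => e0 _; case: ifP => // _; rewrite mulrC.
Qed.

End Slab.

Section PhaseCells.
Variables (R : realType) (I : finType) (x y a : I -> R) (d : R).
Hypothesis d0 : 0 < d.

Definition corner (s u : R) : R := (Num.floor (u / s))%:~R * s.
Definition third (i j : nat) e : R :=
  y e - corner (d ^+ j) (a e) * (x e - corner (d ^+ i) (x e)).

(* Measuring y along the slope and from the abscissa of the corner of the cell in
   (a, x) makes the third side of a cell d^(i+j), up to a constant. *)
Definition key (i j : nat) e : int * int * int :=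
  (Num.floor (x e / d ^+ i), Num.floor (a e / d ^+ j),
   Num.floor (third i j e / d ^+ (i + j))).

Definition inbox (x0 y0 a0 r1 r2 r3 : R) e : bool :=
  [&& `|x e - x0| <= r1, `|a e - a0| <= r2 & `|y e - y0 - a0 * (x e - x0)| <= r3].

Let dpos m : 0 < d ^+ m. Proof. exact: exprn_gt0. Qed.

Lemma corner_dist s u : 0 < s -> `|u - corner s u| <= s.
Proof.
move=> s0; have -> : u = u / s * s by rewrite divfK // gt_eqF.
rewrite /corner mulfK ?gt_eqF // -mulrBl normrM (ger0_norm (ltW s0)).
rewrite ler_piMl ?(ltW s0) // ler_norml.
have h1 := floor_le (u / s); have := floorD1_gt (u / s); rewrite intrD => h2.
by move: h1 h2; set z := _%:~R; lra.
Qed.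

Lemma shear_dist (s a0 a1 x0 x1 y0 y1 r2 r3 : R) :
  `|x1 - x0| <= s -> `|a1 - a0| <= r2 -> `|y1 - y0 - a0 * (x1 - x0)| <= r3 ->
  `|y1 - y0 - a1 * (x1 - x0)| <= r3 + r2 * s.
Proof.
move=> hx ha hy.
have -> : y1 - y0 - a1 * (x1 - x0) = (y1 - y0 - a0 * (x1 - x0)) - (a1 - a0) * (x1 - x0) by ring.
by apply: le_trans (ler_normB _ _) (lerD hy _); rewrite normrM ler_pM.
Qed.

Lemma key_inbox i j e e' : key i j e = key i j e' ->
  inbox (x e) (y e) (a e) (d ^+ i) (d ^+ j) (2 * d ^+ (i + j)) e'.
Proof.
move=> [kx ka kt].
have hx := floor_eq_scale (dpos i) kx; have ha := floor_eq_scale (dpos j) ka.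
have := floor_eq_scale (dpos (i + j)) kt.
rewrite /third /corner -kx -ka.
rewrite -/(corner (d ^+ j) (a e)) -/(corner (d ^+ i) (x e)).
set a0 := corner _ _; set x0 := corner _ _ => ht.
apply/and3P; split; [by rewrite distrC | by rewrite distrC |].
have ca : `|a e - a0| <= d ^+ j by exact: corner_dist.
rewrite distrC in hx; rewrite distrC in ht.
have ht' : `|y e' - y e - a0 * (x e' - x e)| <= d ^+ (i + j).
  apply: le_trans ht; rewrite le_eqVlt; apply/orP; left; apply/eqP; congr `|_|; ring.
by have := shear_dist hx ca ht'; rewrite [d ^+ j * _]mulrC -exprD; lra.
Qed.

(** Slabs are cut in [x], then in [a], then in the third coordinate, which is comparable between two
    flags only once they share the corner it is measured from. Replacing [a0] by the slope of that
    corner costs [(1 + K2) d^(i+j)], whence [4 * K3 + 2 * K2 + 5]. *)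
Lemma box_bound i j (A : pred I) (w : I -> R) (K1 K2 K3 x0 y0 a0 M : R) :
  0 <= K1 -> 0 <= K2 -> 0 <= K3 -> 0 <= M -> (forall e, 0 <= w e) ->
  (forall e, A e -> inbox x0 y0 a0 (K1 * d ^+ i) (K2 * d ^+ j) (K3 * d ^+ (i + j)) e) ->
  (forall e0, A e0 -> \sum_(e | key i j e == key i j e0) w e <= M) ->
  \sum_(e | A e) w e <= (2 * K1 + 3) * ((2 * K2 + 3) * ((4 * K3 + 2 * K2 + 5) * M)).
Proof.
move=> K10 K20 K30 M0 w0 hA cls.
have B3 : 0 <= (4 * K3 + 2 * K2 + 5) * M by apply: mulr_ge0 => //; lra.
have B2 : 0 <= (2 * K2 + 3) * ((4 * K3 + 2 * K2 + 5) * M) by apply: mulr_ge0 => //; lra.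
apply: (@slab_bound _ _ _ _ x (d ^+ i) _ _ x0) => //; first by move=> e /hA /and3P[].
move=> e1 Ae1.
apply: (@slab_bound _ _ _ _ a (d ^+ j) _ _ a0) => //.
  by move=> e /andP[/hA /and3P[]].
move=> e2 /andP[Ae2 /eqP kx2].
have L0 : 0 <= 2 * K3 + K2 + 1 by lra.
rewrite [X in X * M](_ : _ = 2 * (2 * K3 + K2 + 1) + 3); last by ring.
apply: (@slab_bound _ _ _ _ (third i j) (d ^+ (i + j)) _ _ (third i j e2)) => //.
  move=> e /andP[/andP[Ae /eqP kx] /eqP ka].
  have hx : `|x e - x e2| <= d ^+ i by apply: floor_eq_scale (dpos i) _; rewrite kx kx2.
  rewrite /third /corner ka kx kx2.
  rewrite -/(corner (d ^+ j) (a e2)).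
  set ac := corner _ _; set xc := _ * d ^+ i.
  have -> : y e - ac * (x e - xc) - (y e2 - ac * (x e2 - xc)) =
     (y e - y0 - a0 * (x e - x0)) - (y e2 - y0 - a0 * (x e2 - x0)) -
     (ac - a0) * (x e - x e2) by ring.
  have /and3P[_ _ h1] := hA e Ae; have /and3P[_ a2 h2] := hA e2 Ae2.
  have hac : `|ac - a0| <= d ^+ j + K2 * d ^+ j.
    have -> : ac - a0 = (a e2 - a0) - (a e2 - ac) by ring.
    by apply: le_trans (ler_normB _ _) _; rewrite addrC lerD // corner_dist.
  apply: le_trans (ler_normB _ _) _.
  apply: le_trans (lerD (ler_normB _ _) (lexx _)) _.
  have : `|(ac - a0) * (x e - x e2)| <= (d ^+ j + K2 * d ^+ j) * d ^+ i.
    by rewrite normrM ler_pM.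
  have -> : (d ^+ j + K2 * d ^+ j) * d ^+ i = (1 + K2) * d ^+ (i + j) by rewrite exprD; ring.
  by move: h1 h2; lra.
move=> e3 /andP[/andP[Ae3 /eqP kx3] /eqP ka3].
apply: le_trans (cls e3 Ae3).
rewrite big_mkcond [leRHS]big_mkcond; apply: ler_sum => e _.
case: ifP => [/andP[/andP[/andP[_ /eqP kx] /eqP ka] /eqP kt]|_]; last by case: ifP.
by rewrite /key kx kx3 ka ka3 kt eqxx.
Qed.

End PhaseCells.

Section RealPowers.
Variables (R : realType) (d : R).
Hypotheses (d0 : 0 < d) (d1 : d < 1).

Lemma pwD r s : d `^ (r + s) = d `^ r * d `^ s.
Proof. by rewrite powRD // (gt_eqF d0) implybT. Qed.

Lemma pw_gt0 r : 0 < d `^ r. Proof. exact: powR_gt0. Qed.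

Lemma pwX n : d ^+ n = d `^ n%:R. Proof. by rewrite powR_mulrn // ltW. Qed.

Lemma pw_sqr r : (d `^ r) ^+ 2 = d `^ (2 * r).
Proof. by rewrite expr2 -pwD; congr (_ `^ _); ring. Qed.

Lemma lt_pw r s : r < s -> d `^ s < d `^ r.
Proof.
move=> rs; have -> : s = r + (s - r) by ring.
rewrite pwD gtr_pMr ?pw_gt0 //.
have sr : 0 < s - r by rewrite subr_gt0.
rewrite /powR gt_eqF // expR_lt1 pmulr_rlt0 //; apply: ln_lt0; rewrite d0 //.
Qed.

Lemma le_pw r s : (d `^ r <= d `^ s) = (s <= r).
Proof.
apply/idP/idP => [|sr]; last by apply: ger_powR => //; rewrite d0 ltW.
by apply: contraTT; rewrite -!ltNge; exact: lt_pw.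
Qed.

Lemma pw_ge1 r : 0 <= r -> 1 <= d `^ (- r).
Proof. by move=> r0; rewrite -(powRr0 d) le_pw oppr_le0. Qed.

(** The rule for constants in all cell counts: each side of a box costs one extra factor
    [d^(-1)]. *)
Lemma affine_le_pw c0 c1 r : 2000 * d <= 1 -> 0 <= r -> 0 <= c0 -> 0 <= c1 -> c0 + c1 <= 2000 ->
  c1 * d `^ (- r) + c0 <= d `^ (- r - 1).
Proof.
move=> dK r0 c00 c10 cc; have := pw_ge1 r0; set D := d `^ _ => D1.
have -> : d `^ (- r - 1) = D * d^-1 by rewrite pwD -/D powRN powRr1 // ltW.
rewrite ler_pdivlMr //.
have h0 : c0 <= c0 * D by rewrite ler_peMr.
have h1 : (c1 * D + c0) * d <= (c0 + c1) * d * D.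
  rewrite [leRHS]mulrAC ler_wpM2r ?(ltW d0) // mulrDl; lra.
apply: le_trans h1 _; rewrite ler_piMl //; first by lra.
by apply: le_trans dK; rewrite ler_wpM2r // ltW.
Qed.

End RealPowers.

(** Pigeonhole on the vector of rounded exponents at all levels of [T]. Their number does not depend
    on [d], so one vector carries weight [d]. Exponents are truncated at [cap] to make the vectors
    finitely many; a mass at the cap gets no lower bound. *)
Lemma uniformise (R : realType) (I : finType) (T : finType) (mass : T -> I -> R)
    (m : I -> R) (d : R) (cap : nat) :
  0 < d -> (forall e, 0 <= m e) -> 1 / 2 <= \sum_e m e ->
  (forall p e, mass p e <= 1) ->
  (cap.+1 ^ #|T|)%:R * d < 1 / 2 ->
  exists (X : pred I) (f : T -> nat), d <= \sum_(e | X e) m e /\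
    forall p, (f p <= cap)%N /\ forall e, X e ->
      mass p e <= d ^+ f p /\ ((f p < cap)%N -> d ^+ (f p).+1 <= mass p e).
Proof.
move=> d0 m0 m1 mass1 small.
pose cls p e : 'I_cap.+1 := [arg max_(c > ord0 | (mass p e <= d ^+ c)%R) (c : nat)]%N.
pose vec e : {ffun T -> 'I_cap.+1} := [ffun p => cls p e].
have clsP p e : mass p e <= d ^+ cls p e /\
    ((cls p e < cap)%N -> d ^+ (cls p e).+1 <= mass p e).
  rewrite /cls; case: arg_maxnP => [|c hc cmax]; first by rewrite expr0 mass1.
  split=> // ccap; rewrite leNgt; apply/negP => lt.
  have := cmax (Ordinal (ccap : (c.+1 < cap.+1)%N)) (ltW lt).
  by rewrite /= ltnn.
have [g hg] : exists g, d <= \sum_(e | vec e == g) m e.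
  apply: contrapT => none.
  have : \sum_e m e <= \sum_(g : {ffun T -> 'I_cap.+1}) d.
    rewrite (partition_big vec xpredT) //=; apply: ler_sum => g _.
    by rewrite leNgt; apply/negP => lt; apply: none; exists g; exact: ltW.
  rewrite sumr_const card_ffun card_ord -mulr_natl => le.
  by have := le_lt_trans (le_trans m1 le) small; rewrite ltxx.
exists (fun e => vec e == g), (fun p => g p : nat); split => // p.
split; first by rewrite -ltnS ltn_ord.
by move=> e /eqP <-; rewrite ffunE; exact: clsP.
Qed.

(** * Exponents of a uniform set of flags *)

Section Uniform.
Variables (R : realType) (I : finType) (x y a m : I -> R) (d : R) (N : nat).
Variables (X : pred I) (f : nat -> nat -> nat).
Hypotheses (d0 : 0 < d) (dK : 2000 * d <= 1).
Hypotheses (m0 : forall e, 0 <= m e) (m1 : \sum_e m e <= 1).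
Hypotheses (xb : forall e, 0 <= x e <= 1) (yb : forall e, 0 <= y e <= 1).
Hypothesis ab : forall e, `|a e| <= 1.

Definition cellmass (w : I -> R) i j e : R :=
  \sum_(e' | key x y a d i j e' == key x y a d i j e) w e'.

Hypothesis hX : d <= \sum_(e | X e) m e.
Hypothesis fX : forall i j, (i + j <= N.+1)%N -> (f i j <= 2 * N + 10)%N /\
  forall e, X e -> cellmass m i j e <= d ^+ f i j /\
   ((f i j < 2 * N + 10)%N -> d ^+ (f i j).+1 <= cellmass m i j e).

Definition dens (i j : nat) : R := (f i j)%:R.
(** Uniformity concerns the cells of the full weight [m] seen from flags of [X]. Upper bounds pass
    to the restriction; lower bounds do not, as [X] may be thin in a cell, and have to be recovered
    by [heavy_cell] and [poor_share]. *)
Definition restr e : R := if X e then m e else 0.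
Local Notation u := restr.
Local Notation F := dens.

Let d1 : d < 1. Proof. by move: d0 dK; lra. Qed.
Let pw0 r : 0 < d `^ r. Proof. exact: pw_gt0. Qed.
Let ple r s : (d `^ r <= d `^ s) = (s <= r). Proof. exact: le_pw. Qed.
Let pD r s : d `^ (r + s) = d `^ r * d `^ s. Proof. exact: pwD. Qed.
Let pX n : d ^+ n = d `^ n%:R. Proof. exact: pwX. Qed.

Lemma restr_ge0 e : 0 <= u e.
Proof. by rewrite /u; case: ifP. Qed.
Lemma restr_le e : u e <= m e.
Proof. by rewrite /u; case: ifP. Qed.

Lemma cellmass_ge (w : I -> R) i j e : (forall e, 0 <= w e) -> w e <= cellmass w i j e.
Proof. by move=> w0; rewrite /cellmass (bigD1 e) //= lerDl sumr_ge0. Qed.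

Lemma cellmass_restr i j e : (i + j <= N.+1)%N -> X e -> cellmass u i j e <= d `^ F i j.
Proof.
move=> ij Xe; have [_ /(_ e Xe)[h _]] := fX ij.
rewrite -pX; apply: le_trans h; apply: ler_sum => e' _; exact: restr_le.
Qed.

Lemma restr_box i j (A : pred I) (K1 K2 K3 x0 y0 a0 B1 B2 B3 : R) : (i + j <= N.+1)%N ->
  0 <= K1 -> 0 <= K2 -> 0 <= K3 ->
  2 * K1 + 3 <= d `^ B1 -> 2 * K2 + 3 <= d `^ B2 -> 4 * K3 + 2 * K2 + 5 <= d `^ B3 ->
  (forall e, A e -> X e ->
     inbox x y a x0 y0 a0 (K1 * d ^+ i) (K2 * d ^+ j) (K3 * d ^+ (i + j)) e) ->
  \sum_(e | A e) u e <= d `^ (B1 + B2 + B3 + F i j).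
Proof.
move=> ij k1 k2 k3 b1 b2 b3 hA.
have -> : \sum_(e | A e) u e = \sum_(e | A e && X e) u e.
  rewrite big_mkcond [RHS]big_mkcond; apply: eq_bigr => e _; rewrite /restr.
  by case: (A e); case: (X e).
apply: le_trans (box_bound d0 k1 k2 k3 (ltW (pw0 (F i j))) restr_ge0 _ _) _.
- by move=> e /andP[]; exact: hA.
- by move=> e0 /andP[_ Xe0]; exact: cellmass_restr.
have F0 := ltW (pw0 (F i j)).
have -> : B1 + B2 + B3 + F i j = B1 + (B2 + (B3 + F i j)) by ring.
rewrite !pD; apply: ler_pM => //; first by lra.
  by rewrite !mulr_ge0 //; lra.
apply: ler_pM => //; first by lra.
  by rewrite mulr_ge0 //; lra.
by apply: ler_wpM2r.
Qed.

Lemma small_le_pw (c : R) : c <= 2000 -> c <= d `^ (-1).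
Proof.
move=> c2; rewrite powRN powRr1 ?(ltW d0) // -[leRHS]mul1r ler_pdivlMr //.
by apply: le_trans dK; rewrite ler_wpM2r // ltW.
Qed.

Lemma restr_box_const i j (A : pred I) (K1 K2 K3 x0 y0 a0 : R) : (i + j <= N.+1)%N ->
  0 <= K1 <= 300 -> 0 <= K2 <= 300 -> 0 <= K3 <= 300 ->
  (forall e, A e -> X e ->
     inbox x y a x0 y0 a0 (K1 * d ^+ i) (K2 * d ^+ j) (K3 * d ^+ (i + j)) e) ->
  \sum_(e | A e) u e <= d `^ (F i j - 3).
Proof.
move=> ij /andP[k1 k1'] /andP[k2 k2'] /andP[k3 k3'] hA.
have -> : F i j - 3 = -1 + -1 + -1 + F i j by ring.
by apply: (restr_box ij k1 k2 k3 _ _ _ hA); apply: small_le_pw; lra.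
Qed.

Let exprV k : d ^+ k * d `^ (- k%:R) = 1.
Proof. by rewrite pX -pD subrr powRr0. Qed.

(** The flags fill about [d^(-2(i+j))] cells, up to three factors [d^(-1)] for the constants, and
    [X] weighs at least [d]: the 4 is [3 + 1]. *)
Lemma dens_le i j : (i + j <= N.+1)%N -> F i j <= 2 * (i + j)%:R + 4.
Proof.
move=> ij.
have [e0 Xe0] : exists e0, X e0.
  apply: contrapT => none; have := lt_le_trans d0 hX.
  by rewrite big1 ?ltxx // => e Xe; case: none; exists e.
pose k1 := d `^ (- i%:R); pose k2 := 2 * d `^ (- j%:R); pose k3 := 2 * d `^ (- (i + j)%:R).
have a1 c0 c1 k : 0 <= c0 -> 0 <= c1 -> c0 + c1 <= 2000 ->
    c1 * d `^ (- k%:R) + c0 <= d `^ (- k%:R - 1).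
  by move=> h0 h1 h01; apply: affine_le_pw.
have ud : d <= \sum_(e | predT e) u e.
  apply: le_trans hX _; rewrite big_mkcond; apply: ler_sum => e _; rewrite /restr.
  by case: (X e).
have i0 : k1 * d ^+ i = 1 by rewrite /k1 mulrC exprV.
have j0 : k2 * d ^+ j = 2 by rewrite /k2 -mulrA [_ * d ^+ j]mulrC exprV mulr1.
have ij0 : k3 * d ^+ (i + j) = 2 by rewrite /k3 -mulrA [_ * d ^+ _]mulrC exprV mulr1.
have D0 r : 0 <= d `^ r by exact: ltW.
have h3 : 4 * k3 + 2 * k2 + 5 <= d `^ (- (i + j)%:R - 1).
  apply: le_trans (a1 5 12 (i + j)%N _ _ _); [|by []|by []|by lra].
  have : d `^ (- j%:R) <= d `^ (- (i + j)%:R).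
    by rewrite ple lerN2 ler_nat leq_addl.
  by rewrite /k3 /k2; move: (d `^ _) (d `^ _) => z1 z2; lra.
have h1 : 2 * k1 + 3 <= d `^ (- i%:R - 1) by apply: a1; lra.
have h2 : 2 * k2 + 3 <= d `^ (- j%:R - 1).
  by rewrite /k2 mulrA; apply: a1; lra.
have hA e : predT e -> X e ->
    inbox x y a (x e0) (y e0) (a e0) (k1 * d ^+ i) (k2 * d ^+ j) (k3 * d ^+ (i + j)) e.
  move=> _ _; rewrite i0 j0 ij0.
  have := xb e; have := xb e0; have := yb e; have := yb e0.
  have := ab e; have := ab e0 => ha0 ha hy0 hy hx0 hx.
  have hxx : `|x e - x e0| <= 1 by rewrite ler_norml; lra.
  have hyy : `|y e - y e0| <= 1 by rewrite ler_norml; lra.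
  rewrite /inbox hxx /=; apply/andP; split.
    by move: ha0 ha; rewrite !ler_norml; lra.
  apply: le_trans (ler_normB _ _) _; rewrite (natrD R 1 1) lerD // normrM.
  by apply: mulr_ile1.
have : d <= d `^ (- i%:R - 1 + (- j%:R - 1) + (- (i + j)%:R - 1) + F i j).
  apply: le_trans ud (restr_box ij _ _ _ h1 h2 h3 hA); rewrite /k1 /k2 /k3 //; apply: mulr_ge0 => //.
rewrite -{1}(powRr1 (ltW d0)) ple natrD; move: (F i j) (i%:R) (j%:R) => z1 z2 z3; lra.
Qed.

(** By [dens_le] the exponents stay below the cap [2 * N + 10], so truncation never occurs. *)
Lemma cellmass_lower i j e : (i + j <= N.+1)%N -> X e -> d `^ (F i j + 1) <= cellmass m i j e.
Proof.
move=> ij Xe; have [_ /(_ e Xe)[_ h]] := fX ij.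
rewrite /dens natr1 -pX; apply: h; rewrite -(ltr_nat R); apply: le_lt_trans (dens_le ij) _.
rewrite -natrM -natrD ltr_nat; clear -ij; lia.
Qed.

Lemma dens00 : F 0 0 <= 4.
Proof. by have := @dens_le 0 0 isT; rewrite mulr0 add0r. Qed.

Definition hull i j q e : bool :=
  inbox x y a (x q) (y q) (a q) (3 * d ^+ i) (3 * d ^+ j) (10 * d ^+ (i + j)) e.

Lemma cell_hull i j q e : key x y a d i j e = key x y a d i j q -> hull i j q e.
Proof.
move=> E; have /and3P[h1 h2 h3] := key_inbox d0 (esym E).
have p1 : 0 < d ^+ i by exact: exprn_gt0.
have p2 : 0 < d ^+ j by exact: exprn_gt0.
have p3 : 0 < d ^+ (i + j) by exact: exprn_gt0.
by apply/and3P; split; lra.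
Qed.

Lemma hull_sym i j q e : hull i j q e ->
  inbox x y a (x e) (y e) (a e) (3 * d ^+ i) (3 * d ^+ j) (19 * d ^+ (i + j)) q.
Proof.
move=> /and3P[h1 h2 h3]; apply/and3P; split; [by rewrite distrC|by rewrite distrC|].
have := shear_dist h1 h2 h3.
have -> : 10 * d ^+ (i + j) + 3 * d ^+ j * (3 * d ^+ i) = 19 * d ^+ (i + j).
  by rewrite exprD; ring.
by rewrite -normrN; congr (`|_| <= _); ring.
Qed.

(** Flags of [X] in whose cell [X] is thin relative to the hull weigh at most [d^5 * d^(-3)], less
    than the weight [d] of [X]. The comparison is with the hull because finer cells that meet the
    cell may stick out of it. *)
Lemma heavy_cell i j : (i + j <= N.+1)%N -> exists q, [/\ X q,
  d `^ (F i j + 6) <= cellmass u i j q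
  & \sum_(e | hull i j q e) m e <= d `^ (-5) * cellmass u i j q].
Proof.
move=> ij; pose U := cellmass u i j.
have uU e : 0 <= u e <= U e by rewrite restr_ge0 cellmass_ge //; exact: restr_ge0.
have U0 e : 0 <= U e by case/andP: (uU e); exact: le_trans.
have hc e : \sum_(e0 | hull i j e0 e) u e0 / U e0 <= d `^ (-3).
  have K3 : 0 <= 3 :> R by []. have K19 : 0 <= 19 :> R by [].
  have w0 e0 : 0 <= u e0 / U e0 by apply: divr_ge0 => //; exact: restr_ge0.
  apply: le_trans (box_bound d0 K3 K3 K19 ler01 w0 _ _) _.
  - by move=> e0; exact: hull_sym.
  - move=> e0 _; rewrite (eq_bigr (fun e' => u e' / U e0)); last first.
      by move=> e' /eqP E; rewrite /U /cellmass E.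
    rewrite -mulr_suml -/(cellmass u i j e0) -/(U e0).
    by have [->|nz] := eqVneq (U e0) 0; rewrite ?mul0r // divff.
  have -> : -3 = -1 + (-1 + -1) :> R by ring.
  have s c : 0 <= c <= 2000 -> 0 <= c <= d `^ (-1).
    by move=> /andP[-> h]; exact: small_le_pw.
  have /andP[? ?] := s (2 * 3 + 3) ltac:(lra).
  have /andP[? ?] := s ((4 * 19 + 2 * 3 + 5) * 1) ltac:(lra).
  by rewrite !pD; apply: ler_pM => //; apply: ler_pM.
have := poor_mass (ltW (pw0 5)) uU m0 hc.
set poor := \sum_(e0 | _) _ => hp.
have lt : poor < \sum_e u e.
  apply: (@lt_le_trans _ _ d).
    apply: le_lt_trans hp _; rewrite -mulr_suml.
    apply: (@le_lt_trans _ _ (d `^ 5 * (1 * d `^ (-3)))).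
      by apply: ler_wpM2l; [exact: ltW | apply: ler_wpM2r => //; exact: ltW].
    rewrite mul1r -pD -[ltRHS](powRr1 (ltW d0)); apply: lt_pw => //; lra.
  by apply: le_trans hX _; rewrite big_mkcond.
have [q [uq hq]] : exists q, u q != 0 /\ d `^ 5 * \sum_(e | hull i j q e) m e <= U q.
  apply: contrapT => none; move: lt; rewrite ltNge => /negP; apply.
  rewrite /poor [leRHS]big_mkcond; apply: ler_sum => e _; case: ifPn => //.
  rewrite -leNgt => h; have [->//|nz] := eqVneq (u e) 0.
  by case: none; exists e.
have Xq : X q by move: uq; rewrite /restr; case: (X q) => //; rewrite eqxx.
exists q; split => //.
  rewrite addrC (_ : 6 + F i j = 5 + (F i j + 1)); last by ring.
  rewrite pD; apply: le_trans hq; apply: ler_wpM2l; first exact: ltW.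
  apply: le_trans (cellmass_lower ij Xq) _.
  rewrite /cellmass big_mkcond [leRHS]big_mkcond; apply: ler_sum => e _.
  case: ifPn => [/eqP E|_]; last by case: ifP.
  by rewrite cell_hull.
by rewrite powRN mulrC ler_pdivlMr // mulrC.
Qed.

Lemma dens_step_le : step_le F 9 N.+1.
Proof.
move=> i j p q; set i' := (i + p)%N; set j' := (j + q)%N => ij'.
have ij : (i + j <= N.+1)%N by apply: leq_trans ij'; rewrite leq_add ?leq_addr.
have [e0 [Xe0 low _]] := heavy_cell ij.
pose k1 := d `^ (- p%:R); pose k2 := d `^ (- q%:R); pose k3 := 2 * d `^ (- (p + q)%:R).
have a1 c0 c1 k : 0 <= c0 -> 0 <= c1 -> c0 + c1 <= 2000 ->
    c1 * d `^ (- k%:R) + c0 <= d `^ (- k%:R - 1).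
  by move=> h0 h1 h01; apply: affine_le_pw.
have D0 r : 0 <= d `^ r by exact: ltW.
have h3 : 4 * k3 + 2 * k2 + 5 <= d `^ (- (p + q)%:R - 1).
  apply: le_trans (a1 5 10 (p + q)%N _ _ _); [|by []|by []|by lra].
  have : d `^ (- q%:R) <= d `^ (- (p + q)%:R).
    by rewrite ple lerN2 ler_nat leq_addl.
  by rewrite /k3 /k2; move: (d `^ _) (d `^ _) => z1 z2; lra.
have h1 : 2 * k1 + 3 <= d `^ (- p%:R - 1) by apply: a1; lra.
have h2 : 2 * k2 + 3 <= d `^ (- q%:R - 1) by apply: a1; lra.
have E k l : d `^ (- k%:R) * d ^+ (l + k) = d ^+ l.
  by rewrite exprD mulrCA [_ * d ^+ k]mulrC exprV mulr1.
have hA e : (key x y a d i j e == key x y a d i j e0) -> X e ->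
    inbox x y a (x e0) (y e0) (a e0) (k1 * d ^+ i') (k2 * d ^+ j') (k3 * d ^+ (i' + j')) e.
  move=> /eqP /esym /(key_inbox d0); rewrite /k1 /k2 /k3 !E -mulrA.
  by rewrite /i' /j' addnACA E.
have := le_trans low (restr_box ij' (D0 _) (D0 _) _ h1 h2 h3 hA).
rewrite ple natrD => le; suff : 0 <= k3 by move=> /le; lra.
by apply: mulr_ge0.
Qed.

Lemma dens_step_ge : step_ge F 9 N.+1.
Proof.
move=> i j p q; set i' := (i + p)%N; set j' := (j + q)%N => ij'.
have ij : (i + j <= N.+1)%N by apply: leq_trans ij'; rewrite leq_add ?leq_addr.
have [e0 [Xe0 low _]] := heavy_cell ij'.
have sh k l : (l <= k)%N -> d ^+ k <= d ^+ l.
  by move=> lk; apply: ler_wiXn2l => //; apply: ltW.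
have hA e : (key x y a d i' j' e == key x y a d i' j' e0) -> X e ->
    inbox x y a (x e0) (y e0) (a e0) (1 * d ^+ i) (1 * d ^+ j) (2 * d ^+ (i + j)) e.
  move=> /eqP /esym /(key_inbox d0) /and3P[h1 h2 h3] _; rewrite !mul1r.
  have s1 := sh i' i (leq_addr _ _). have s2 := sh j' j (leq_addr _ _).
  have s3 : d ^+ (i' + j') <= d ^+ (i + j) by apply: sh; rewrite leq_add ?leq_addr.
  by apply/and3P; split; lra.
have := le_trans low (restr_box_const ij _ _ _ hA).
by rewrite ple => le; suff : F i j - 3 <= F i' j' + 6; [lra | apply: le; lra].
Qed.

End Uniform.

(* A pair (e1, e2) is reached through the e sharing the P-class of e1 and the
   L-class of e2; these e form one class of P x L, so that the weights nu / UC
   sum to at most 1. *)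
Lemma rectangles_le (R : realType) (I : finType) (K : eqType) (nu : I -> R)
    (P L : I -> K) (inc : I -> I -> bool) :
  (forall e, 0 <= nu e) ->
  (forall e e1 e2, nu e != 0 -> nu e1 != 0 -> nu e2 != 0 -> P e1 = P e -> L e2 = L e ->
     inc e1 e2) ->
  \sum_e nu e * ((\sum_(e1 | P e1 == P e) nu e1) * (\sum_(e2 | L e2 == L e) nu e2) /
     \sum_(e' | (P e' == P e) && (L e' == L e)) nu e')
  <= \sum_e1 \sum_e2 nu e1 * nu e2 * (inc e1 e2)%:R.
Proof.
move=> nu0 hinc; set UC := fun e => \sum_(e' | (P e' == P e) && (L e' == L e)) nu e'.
have UC0 e : 0 <= UC e by exact: sumr_ge0.
have E e : nu e * ((\sum_(e1 | P e1 == P e) nu e1) * (\sum_(e2 | L e2 == L e) nu e2) / UC e) =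
  \sum_e1 \sum_e2 nu e1 * nu e2 * (if (P e1 == P e) && (L e2 == L e) then nu e / UC e else 0).
  rewrite mulrCA big_distrlr /= mulr_suml [LHS]big_mkcond; apply: eq_bigr => e1 _.
  case: (P e1 == P e) => /=; last by rewrite big1 // => e2 _; rewrite mulr0.
  rewrite mulr_suml [LHS]big_mkcond; apply: eq_bigr => e2 _.
  by case: (L e2 == L e); rewrite ?mulr0.
rewrite (eq_bigr _ (fun e _ => E e)) exchange_big /=; apply: ler_sum => e1 _.
rewrite exchange_big /=; apply: ler_sum => e2 _.
rewrite -mulr_sumr.
have [->|n1] := eqVneq (nu e1) 0; first by rewrite !mul0r.
have [->|n2] := eqVneq (nu e2) 0; first by rewrite !(mulr0, mul0r).
apply: ler_wpM2l; first exact: mulr_ge0.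
rewrite -big_mkcond /=.
have [[e /and3P[/eqP p /eqP l ne]]|none] :=
  pselect (exists e, [&& P e1 == P e, L e2 == L e & nu e != 0]).
  rewrite (hinc _ _ _ ne n1 n2 p l).
  rewrite (eq_bigr (fun e' => nu e' / UC e)); last first.
    by move=> e' /andP[/eqP p' /eqP l']; rewrite /UC -p' -l' p l.
  rewrite -mulr_suml (eq_bigl (fun e' => (P e' == P e) && (L e' == L e))); last first.
    by move=> e'; rewrite p l ![_ == P e]eq_sym ![_ == L e]eq_sym.
  by rewrite -/(UC e); have [->|nz] := eqVneq (UC e) 0; rewrite ?mul0r // divff.
rewrite big1 ?ler0n // => e /andP[p l].
have [->|ne] := eqVneq (nu e) 0; first by rewrite mul0r.
by case: none; exists e; rewrite p l.
Qed.

Lemma backward_chain (R : realType) (b : nat -> R) (E : R) h l :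
  0 <= E -> b (h + l)%N <= E ->
  (forall k, (h <= k < h + l)%N -> b k <= 82 * b k.+1 + E) -> b h <= 83 ^+ l * E.
Proof.
move=> E0; elim: l h => [|l IH] h; first by rewrite addn0 expr0 mul1r.
move=> bl st; have /IH : b (h.+1 + l)%N <= E by rewrite addSnnS.
have st' k : (h.+1 <= k < h.+1 + l)%N -> b k <= 82 * b k.+1 + E.
  by move=> /andP[k1 k2]; apply: st; rewrite (ltnW k1) addnS -addSn.
move=> /(_ st') bs; have hh : (h <= h < h + l.+1)%N by rewrite leqnn addnS ltnS leq_addr.
have := st h hh; have : 1 * E <= 83 ^+ l * E.
  by apply: ler_wpM2r => //; apply: exprn_ege1; rewrite ler1n.
rewrite exprS -mulrA; set z := 83 ^+ l * E in bs *; clear -bs; lra.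
Qed.

(** * Rescaled cells and the losing alternative *)

Section MainProposition.
Variables (R : realType) (I : finType) (x y a m : I -> R) (d : R) (N : nat).
Variables (X : pred I) (f : nat -> nat -> nat).
Hypotheses (d0 : 0 < d) (dK : 2000 * d <= 1).
Hypotheses (m0 : forall e, 0 <= m e) (m1 : \sum_e m e <= 1).
Hypotheses (xb : forall e, 0 <= x e <= 1) (yb : forall e, 0 <= y e <= 1).
Hypothesis ab : forall e, `|a e| <= 1.
Hypothesis hX : d <= \sum_(e | X e) m e.
Hypothesis fX : forall i j, (i + j <= N.+1)%N -> (f i j <= 2 * N + 10)%N /\
  forall e, X e -> cellmass x y a d m i j e <= d ^+ f i j /\
   ((f i j < 2 * N + 10)%N -> d ^+ (f i j).+1 <= cellmass x y a d m i j e).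
Hypothesis noinc : forall e e', (x e, y e) != (x e', y e') ->
  d ^+ N <= `|y e - y e' - a e' * (x e - x e')|.
Hypothesis d83 : 83 ^+ N.+1 * d < 1.

Local Notation F := (dens R f).
Local Notation u := (restr m X).
Local Notation cell := (key x y a d).
Local Notation mass := (cellmass x y a d).

Let d1 : d < 1. Proof. by move: d0 dK; lra. Qed.
Let pw0 r : 0 < d `^ r. Proof. exact: pw_gt0. Qed.
Let ple r s : (d `^ r <= d `^ s) = (s <= r). Proof. exact: le_pw. Qed.
Let pD r s : d `^ (r + s) = d `^ r * d `^ s. Proof. exact: pwD. Qed.
Let pX n : d ^+ n = d `^ n%:R. Proof. exact: pwX. Qed.
Let dpos n : 0 < d ^+ n. Proof. exact: exprn_gt0. Qed.
Let lower i j e := @cellmass_lower R I x y a m d N X f d0 dK m0 xb yb ab hX fX i j e.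
Let box_const i j A K1 K2 K3 x0 y0 a0 :=
  @restr_box_const R I x y a m d N X f d0 dK m0 fX i j A K1 K2 K3 x0 y0 a0.
Let heavy i j := @heavy_cell R I x y a m d N X f d0 dK m0 m1 xb yb ab hX fX i j.
Let step_l := dens_step_le d0 dK m0 m1 xb yb ab hX fX.

Let dN : N.+1%:R * d <= 1.
Proof.
apply: ltW; apply: le_lt_trans d83; rewrite ler_wpM2r ?(ltW d0) //.
by rewrite -natrX ler_nat ltnW // ltn_expl.
Qed.

Let shrink k l : (l <= k)%N -> d ^+ k <= d ^+ l.
Proof. by move=> lk; apply: ler_wiXn2l => //; apply: ltW. Qed.

(** The grid goes one level below the tube width [d^N] so that constants such as 8 do no harm at its
    end. *)
Lemma same_point e e' : `|y e - y e' - a e' * (x e - x e')| <= 8 * d ^+ N.+1 ->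
  (x e, y e) = (x e', y e').
Proof.
move=> le; apply/eqP; apply: contraTT le => /noinc le'; rewrite -ltNge.
apply: lt_le_trans le'; rewrite exprS; have := dpos N; set D := d ^+ N => D0.
by rewrite mulrA -[ltRHS]mul1r ltr_pM2r //; move: dK d0; lra.
Qed.

Lemma dens_end (t s eta : R) i j : 0 <= s <= 1 ->
  (forall e w, d ^+ N <= w <= 1 ->
    \sum_(e' | [&& x e' == x e, y e' == y e & `|a e' - a e| <= w]) m e'
      <= d `^ (N%:R * (t - eta) - 1) * w `^ s) ->
  (i + j = N.+1)%N -> t * N%:R + s * j%:R - eta * N%:R - 3 <= F i j.
Proof.
move=> /andP[s0 s1] frost ij; have ij' : (i + j <= N.+1)%N by rewrite ij.
have [q [Xq _ _]] := heavy ij'.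
(* The hypothesis on pencils holds for radii at least [d^N] only, so [j = N.+1] is replaced by [N];
   as [s <= 1] this loses at most 1 in the exponent. *)
pose k := minn j N.
have kw : d ^+ N <= d ^+ k <= 1.
  by rewrite shrink ?geq_minr // exprn_ile1 // ltW.
have := le_trans (lower ij' Xq) (le_trans _ (frost q _ kw)).
have -> : (d ^+ k) `^ s = d `^ (k%:R * s) by rewrite powRrM pX.
rewrite -pD ple => le.
have jk : j%:R <= k%:R + 1 :> R by rewrite natr1 ler_nat /k; clear -ij; lia.
have sj : s * j%:R <= s * (k%:R + 1) by apply: ler_wpM2l.
suff /le : mass m i j q <= \sum_(e' | [&& x e' == x q, y e' == y q & `|a e' - a q| <= d ^+ k]) m e'.
  by move: sj s1; lra.
rewrite /cellmass big_mkcond [leRHS]big_mkcond; apply: ler_sum => e _.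
case: ifPn => [/eqP /esym /(key_inbox d0) /and3P[_ ha hy]|_]; last by case: ifP.
have [-> ->] : (x e, y e) = (x q, y q).
  apply: same_point; apply: le_trans hy _; rewrite ij.
  by have := dpos N.+1; lra.
by rewrite !eqxx /= (le_trans ha) // shrink // geq_minl.
Qed.

Section FixedCell.
Variables (i j : nat) (q : I).
Hypotheses (ij : (i + j <= N.+1)%N) (Xq : X q).
Let mQ := cellmass x y a d u i j q.
Hypothesis qlow : d `^ (F i j + 6) <= mQ.
Hypothesis qhull : \sum_(e | hull x y a d i j q e) m e <= d `^ (-5) * mQ.

Let inQ e := cell i j e == cell i j q.
Definition cellweight e : R := if inQ e then u e / mQ else 0.
(** The three coordinates are rescaled around [q], with a shear in [ynorm] along the line of [q];
    this divides the incidence form by [d^(i+j)], see [norm_shear]. Flags off the cell have weight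
    0, and the value 0 there makes the bounds hold for all flags. *)
Definition xnorm e : R := if inQ e then (x e - x q) / d ^+ i else 0.
Definition anorm e : R := if inQ e then (a e - a q) / d ^+ j else 0.
Definition ynorm e : R :=
  if inQ e then (y e - y q - a q * (x e - x q)) / d ^+ (i + j) else 0.
Local Notation nu := cellweight.

Let mQ_gt0 : 0 < mQ. Proof. exact: lt_le_trans qlow. Qed.
Let mQ_le : mQ <= d `^ F i j. Proof. exact: (cellmass_restr d0 m0 fX). Qed.

Let QP e : inQ e -> [/\ `|x e - x q| <= d ^+ i, `|a e - a q| <= d ^+ j
  & `|y e - y q - a q * (x e - x q)| <= 2 * d ^+ (i + j)].
Proof. by move=> /eqP /esym /(key_inbox d0) /and3P[]. Qed.

Let scaled (s t c : R) : 0 < s -> (`|t / s| <= c) = (`|t| <= c * s).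
Proof. by move=> s0; rewrite normrM normfV (gtr0_norm s0) ler_pdivrMr. Qed.

Lemma cellweight_ge0 e : 0 <= nu e.
Proof.
rewrite /cellweight; case: ifP => // _.
by rewrite divr_ge0 ?(ltW mQ_gt0) // restr_ge0.
Qed.

Lemma cellweight_sum (A : pred I) :
  \sum_(e | A e) nu e = (\sum_(e | A e && inQ e) u e) / mQ.
Proof.
rewrite mulr_suml big_mkcond [RHS]big_mkcond; apply: eq_bigr => e _.
by rewrite /cellweight; case: (A e).
Qed.

Lemma cellweight_total : \sum_e nu e = 1.
Proof. by rewrite cellweight_sum divff // gt_eqF. Qed.

Lemma cellweight_neq0 e : nu e != 0 -> inQ e /\ X e.
Proof.
rewrite /cellweight; case: (inQ e); rewrite ?eqxx //.
by rewrite /restr; case: (X e); rewrite ?mul0r ?eqxx.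
Qed.

Lemma xnorm_le1 e : `|xnorm e| <= 1.
Proof.
rewrite /xnorm; case: ifP => [/QP[h _ _]|_]; last by rewrite normr0.
by rewrite scaled // mul1r.
Qed.

Lemma anorm_le1 e : `|anorm e| <= 1.
Proof.
rewrite /anorm; case: ifP => [/QP[_ h _]|_]; last by rewrite normr0.
by rewrite scaled // mul1r.
Qed.

Lemma ynorm_le2 e : `|ynorm e| <= 2.
Proof.
rewrite /ynorm; case: ifP => [/QP[_ _ h]|_]; last by rewrite normr0.
by rewrite scaled.
Qed.

Lemma cellweight_box (i' j' : nat) (A : pred I) (K1 K2 K3 x0 y0 a0 : R) :
  (i' + j' <= N.+1)%N -> 0 <= K1 <= 300 -> 0 <= K2 <= 300 -> 0 <= K3 <= 300 ->
  (forall e, A e -> inQ e -> X e ->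
     inbox x y a x0 y0 a0 (K1 * d ^+ i') (K2 * d ^+ j') (K3 * d ^+ (i' + j')) e) ->
  \sum_(e | A e) nu e <= d `^ (F i' j' - F i j - 9).
Proof.
move=> ij' k1 k2 k3 hA; rewrite cellweight_sum ler_pdivrMr //.
have hA' e : A e && inQ e -> X e ->
    inbox x y a x0 y0 a0 (K1 * d ^+ i') (K2 * d ^+ j') (K3 * d ^+ (i' + j')) e.
  by move=> /andP[Ae Qe]; exact: hA.
apply: le_trans (box_const ij' k1 k2 k3 hA') _.
have -> : F i' j' - 3 = (F i' j' - F i j - 9) + (F i j + 6) by ring.
by rewrite pD ler_wpM2l // ltW.
Qed.

Lemma norm_shear e e' : inQ e -> inQ e' ->
  rvdist xnorm ynorm anorm e e' = (y e - y e' - a e' * (x e - x e')) / d ^+ (i + j).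
Proof.
move=> Qe Qe'; rewrite /rvdist /xnorm /ynorm /anorm Qe Qe' exprD.
by field; rewrite !gt_eqF.
Qed.

Lemma norm_intercept e : inQ e ->
  rintercept xnorm ynorm anorm e = (y e - y q - a e * (x e - x q)) / d ^+ (i + j).
Proof.
move=> Qe; rewrite /rintercept /xnorm /ynorm /anorm Qe exprD.
by field; rewrite !gt_eqF.
Qed.

Lemma point_density k x0 y0 : (i + k + j <= N.+1)%N ->
  \sum_(e | (`|xnorm e - x0| <= 3 * d ^+ k.+1) && (`|ynorm e - y0| <= 3 * d ^+ k.+1)) nu e
    <= d `^ (F (i + k) j - F i j - 9).
Proof.
move=> ijk; have dk : d ^+ k.+1 <= d ^+ k by exact: shrink.
apply: (@cellweight_box _ _ _ 3 1 3 (x q + d ^+ i * x0)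
  (y q + a q * (d ^+ i * x0) + d ^+ (i + j) * y0) (a q)) => //; try lra.
move=> e /andP[hx hy] Qe _; move: hx hy; rewrite /xnorm /ynorm Qe => hx hy.
have [_ ha _] := QP Qe; apply/and3P; split; last 2 first.
- by rewrite mul1r.
- have -> : y e - (y q + a q * (d ^+ i * x0) + d ^+ (i + j) * y0) -
     a q * (x e - (x q + d ^+ i * x0)) =
     ((y e - y q - a q * (x e - x q)) / d ^+ (i + j) - y0) * d ^+ (i + j).
    by field; rewrite gt_eqF.
  rewrite normrM (gtr0_norm (dpos _)) (_ : (i + k + j = k + (i + j))%N); last by clear; lia.
  by rewrite [d ^+ (k + _)]exprD mulrA ler_pM2r //; move: hy dk; lra.
have -> : x e - (x q + d ^+ i * x0) = ((x e - x q) / d ^+ i - x0) * d ^+ i.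
  by field; rewrite gt_eqF.
rewrite normrM (gtr0_norm (dpos _)) addnC exprD mulrA ler_pM2r //; lra.
Qed.

(** The intercept is the height of the line at the abscissa of [q]. Moving to the point of the flag,
    at distance at most [d^i], adds a slope error of the same size, so the third side is
    [100 + 100]. *)
Lemma line_density k a0 b0 : (i + (j + k) <= N.+1)%N ->
  \sum_(e | (`|anorm e - a0| <= 100 * d ^+ k) &&
     (`|rintercept xnorm ynorm anorm e - b0| <= 100 * d ^+ k)) nu e
    <= d `^ (F i (j + k) - F i j - 9).
Proof.
move=> ijk; apply: (@cellweight_box _ _ _ 1 100 200 (x q)
  (y q + d ^+ (i + j) * b0) (a q + d ^+ j * a0)) => //; try lra.
move=> e /andP[ha hb] Qe _; move: ha hb; rewrite norm_intercept // /anorm Qe => ha hb.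
have [hx _ _] := QP Qe.
have ha' : `|a e - (a q + d ^+ j * a0)| <= 100 * d ^+ (j + k).
  have -> : a e - (a q + d ^+ j * a0) = ((a e - a q) / d ^+ j - a0) * d ^+ j.
    by field; rewrite gt_eqF.
  by rewrite normrM (gtr0_norm (dpos _)) addnC exprD mulrA ler_pM2r.
apply/and3P; split => //; first by rewrite mul1r.
have -> : y e - (y q + d ^+ (i + j) * b0) - (a q + d ^+ j * a0) * (x e - x q) =
   ((y e - y q - a e * (x e - x q)) / d ^+ (i + j) - b0) * d ^+ (i + j) +
   (a e - (a q + d ^+ j * a0)) * (x e - x q).
  by field; rewrite gt_eqF.
apply: le_trans (ler_normD _ _) _; rewrite !normrM (gtr0_norm (dpos _)).
have h1 := ler_wpM2r (ltW (dpos (i + j))) hb.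
have h2 : `|a e - (a q + d ^+ j * a0)| * `|x e - x q| <= 100 * d ^+ (j + k) * d ^+ i.
  by apply: ler_pM.
have e1 : 100 * d ^+ k * d ^+ (i + j) = 100 * d ^+ (i + (j + k)).
  by rewrite -mulrA -exprD; congr (_ * d ^+ _); clear; lia.
have e2 : 100 * d ^+ (j + k) * d ^+ i = 100 * d ^+ (i + (j + k)).
  by rewrite -mulrA -exprD; congr (_ * d ^+ _); clear; lia.
by move: h1 h2; rewrite e1 e2; lra.
Qed.

Lemma hull_near (i' j' : nat) e0 e : (i <= i')%N -> (j <= j')%N -> inQ e0 ->
  cell i' j' e = cell i' j' e0 -> hull x y a d i j q e.
Proof.
move=> ii jj /QP[hx ha hy] /esym /(key_inbox d0) /and3P[hx' ha' hy'].
have sx := shrink ii; have sa := shrink jj; have sy := shrink (leq_add ii jj).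
have px := dpos i; have pa := dpos j; have py := dpos (i + j).
apply/and3P; split.
- have -> : x e - x q = (x e - x e0) + (x e0 - x q) by ring.
  by apply: le_trans (ler_normD _ _) _; lra.
- have -> : a e - a q = (a e - a e0) + (a e0 - a q) by ring.
  by apply: le_trans (ler_normD _ _) _; lra.
have -> : y e - y q - a q * (x e - x q) = (y e - y e0 - a e0 * (x e - x e0)) +
  (y e0 - y q - a q * (x e0 - x q)) + (a e0 - a q) * (x e - x e0) by ring.
have h1 : `|(a e0 - a q) * (x e - x e0)| <= d ^+ (i + j).
  by rewrite normrM addnC exprD ler_pM // (le_trans hx').
apply: le_trans (ler_normD _ _) _.
by apply: le_trans (lerD (ler_normD _ _) (lexx _)) _; lra.
Qed.

(** Recovers lower bounds on fine cells inside the chosen one. Those that meet it lie in its hull,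
    of mass at most [d^(-5) * mQ], so by [poor_mass] the flags where the restricted mass is too
    small weigh at most [d^6 * d^(-5)]. *)
Lemma poor_share (i' j' : nat) : (i <= i')%N -> (j <= j')%N ->
  \sum_(e | mass nu i' j' e < d `^ 6 * (mass m i' j' e / mQ)) nu e <= d.
Proof.
move=> ii jj; pose rel e0 e := cell i' j' e == cell i' j' e0.
have uU e : 0 <= nu e <= mass nu i' j' e.
  by rewrite cellweight_ge0 cellmass_ge //; exact: cellweight_ge0.
have v0 e : 0 <= m e / mQ by rewrite divr_ge0 // ltW.
have hc e : \sum_(e0 | rel e0 e) nu e0 / mass nu i' j' e0 <= (hull x y a d i j q e)%:R.
  have [[e0 /andP[/eqP E ne0]]|none] := pselect (exists e0, rel e0 e && (nu e0 != 0)).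
    have [Q0 _] := cellweight_neq0 ne0.
    rewrite (hull_near ii jj Q0 E) (eq_bigr (fun e1 => nu e1 / mass nu i' j' e)); last first.
      by move=> e1 /eqP E1; rewrite /cellmass E1.
    rewrite -mulr_suml (eq_bigl (fun e1 => cell i' j' e1 == cell i' j' e)); last first.
      by move=> e1; rewrite /rel eq_sym.
    rewrite -/(mass nu i' j' e).
    by have [->|nz] := eqVneq (mass nu i' j' e) 0; rewrite ?mul0r // divff.
  rewrite big1 // => e0 r; have [->|ne0] := eqVneq (nu e0) 0; first by rewrite mul0r.
  by case: none; exists e0; rewrite r.
have := poor_mass (ltW (pw0 6)) uU v0 hc.
rewrite (eq_bigl (fun e => mass nu i' j' e < d `^ 6 * (mass m i' j' e / mQ))); last first.
  by move=> e; rewrite /cellmass mulr_suml.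
move=> le; apply: le_trans le _.
have -> : \sum_e m e / mQ * (hull x y a d i j q e)%:R =
    (\sum_(e | hull x y a d i j q e) m e) / mQ.
  rewrite mulr_suml [RHS]big_mkcond; apply: eq_bigr => e _.
  by case: (hull _ _ _ _ _ _ _ _); rewrite ?mulr1 ?mulr0.
apply: (@le_trans _ _ (d `^ 6 * d `^ (-5))).
  by apply: ler_wpM2l; [exact: ltW | rewrite ler_pdivrMr].
by rewrite -pD -[leRHS](powRr1 (ltW d0)) ple; lra.
Qed.

Lemma rich_lower (i' j' : nat) e : (i' + j' <= N.+1)%N -> nu e != 0 ->
  d `^ 6 * (mass m i' j' e / mQ) <= mass nu i' j' e ->
  d `^ (F i' j' - F i j + 7) <= mass nu i' j' e.
Proof.
move=> ij' /cellweight_neq0[_ Xe]; apply: le_trans.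
have -> : F i' j' - F i j + 7 = 6 + ((F i' j' + 1) + (- F i j)) by ring.
rewrite pD; apply: ler_wpM2l; first exact: ltW.
rewrite pD; apply: ler_pM; [exact: ltW | exact: ltW | exact: lower |].
by rewrite powRN lef_pV2 ?posrE.
Qed.

Variable h : nat.
Hypotheses (h0 : (0 < h)%N) (ijh : (i + j + 2 * h <= N.+1)%N).
Local Notation inc := (incidence nu xnorm ynorm anorm).

Let ijP : (i + h + j <= N.+1)%N. Proof. by clear -ijh; lia. Qed.
Let ijL : (i + (j + h) <= N.+1)%N. Proof. by clear -ijh; lia. Qed.
Let ijT : (i + h + (j + h) <= N.+1)%N. Proof. by clear -ijh; lia. Qed.

(** The common refinement of the levels [(i + h, j)] and [(i, j + h)] fixes [x] and [a] as a cell of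
    level [(i + h, j + h)] does, but its third side is longer by [d^(-h)]. The resulting loss [h] is
    exactly what division by the width [d^h] compensates. *)
Lemma cross_cell_upper e :
  \sum_(e' | (cell (i + h) j e' == cell (i + h) j e) && (cell i (j + h) e' == cell i (j + h) e))
     nu e' <= d `^ (F (i + h) (j + h) - F i j - h%:R - 9).
Proof.
rewrite cellweight_sum ler_pdivrMr //.
have dh : d `^ (- h%:R) * d ^+ h = 1 by rewrite pX -pD addrC subrr powRr0.
have k3 : 0 <= 2 * d `^ (- h%:R) by rewrite mulr_ge0 // ltW.
have b1 : 2 * 1 + 3 <= d `^ (-1) by apply: small_le_pw => //; lra.
have b3 : 4 * (2 * d `^ (- h%:R)) + 2 * 1 + 5 <= d `^ (- h%:R - 1).
  rewrite mulrA -addrA; apply: affine_le_pw => //; lra.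
have hA e' : ((cell (i + h) j e' == cell (i + h) j e) &&
     (cell i (j + h) e' == cell i (j + h) e)) && inQ e' -> X e' ->
   inbox x y a (x e) (y e) (a e) (1 * d ^+ (i + h)) (1 * d ^+ (j + h))
     (2 * d `^ (- h%:R) * d ^+ (i + h + (j + h))) e'.
  move=> /andP[/andP[/eqP /esym /(key_inbox d0) /and3P[hx _ hy]
    /eqP /esym /(key_inbox d0) /and3P[_ ha _]] _] _.
  apply/and3P; split; rewrite ?mul1r //.
  by rewrite addnA exprD -mulrA [_ * d ^+ h]mulrC (mulrA (d `^ _)) dh mul1r.
apply: le_trans (restr_box d0 m0 fX ijT ler01 ler01 k3 b1 b1 b3 hA) _.
apply: (@le_trans _ _ (d `^ (F (i + h) (j + h) - F i j - h%:R - 9) * d `^ (F i j + 6))).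
  by rewrite -pD ple; lra.
by rewrite ler_wpM2l // ltW.
Qed.

Lemma incidence_start :
  d `^ (mixdiff F i j h + h%:R + 24) <= inc (8 * d ^+ h).
Proof.
have hinc e e1 e2 : nu e != 0 -> nu e1 != 0 -> nu e2 != 0 ->
    cell (i + h) j e1 = cell (i + h) j e -> cell i (j + h) e2 = cell i (j + h) e ->
    `|rvdist xnorm ynorm anorm e1 e2| <= 8 * d ^+ h.
  move=> /cellweight_neq0[Q0 _] /cellweight_neq0[Q1 _] /cellweight_neq0[Q2 _].
  move=> /esym /(key_inbox d0) /and3P[_ _ h1] /esym /(key_inbox d0) /and3P[_ ha2 h2].
  rewrite norm_shear // scaled // -mulrA -exprD.
  have -> : y e1 - y e2 - a e2 * (x e1 - x e2) =
     (y e1 - y e - a e * (x e1 - x e)) - (y e2 - y e - a e * (x e2 - x e)) -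
     (a e2 - a e) * (x e1 - x e2) by ring.
  have hx : `|x e1 - x e2| <= d ^+ i.
    by apply: floor_eq_scale (dpos i) _; move: Q1 => /eqP[-> _ _]; move: Q2 => /eqP[-> _ _].
  have h3 : `|(a e2 - a e) * (x e1 - x e2)| <= d ^+ (h + (i + j)).
    rewrite normrM (_ : (h + (i + j) = j + h + i)%N) ?exprD -?exprD; last by clear; lia.
    by rewrite exprD ler_pM.
  rewrite (_ : (i + h + j = h + (i + j))%N) in h1; last by clear; lia.
  rewrite (_ : (i + (j + h) = h + (i + j))%N) in h2; last by clear; lia.
  have dp := dpos (h + (i + j)).
  apply: le_trans (ler_normB _ _) _ => //.
  by apply: le_trans (lerD (ler_normB _ _) (lexx _)) _; lra.
apply: le_trans (rectangles_le cellweight_ge0 hinc).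
pose poorP e := mass nu (i + h) j e < d `^ 6 * (mass m (i + h) j e / mQ).
pose poorL e := mass nu i (j + h) e < d `^ 6 * (mass m i (j + h) e / mQ).
pose good e := ~~ poorP e && ~~ poorL e.
have hP := poor_share (leq_addr h i) (leqnn j).
have hL := poor_share (leqnn i) (leq_addr h j).
have hgood : d <= \sum_(e | good e) nu e.
  suff : 1 <= \sum_(e | good e) nu e + (\sum_(e | poorP e) nu e + \sum_(e | poorL e) nu e).
    by move: hP hL; rewrite -/poorP -/poorL; move: dK d0; lra.
  rewrite -cellweight_total (bigID good) /= lerD2l.
  rewrite big_mkcond [X in _ <= X + _]big_mkcond [X in _ <= _ + X]big_mkcond -big_split.
  apply: ler_sum => e _; have := cellweight_ge0 e; rewrite /good.
  by case: (poorP e); case: (poorL e) => /=; lra.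
set Z := F (i + h) (j + h) - F i j - h%:R - 9.
(* The constant 24 is 1 for the weight of the good flags, 7 for each of the two classes and 9 for
   their intersection. *)
have -> : mixdiff F i j h + h%:R + 24 =
   1 + ((F (i + h)%N j - F i j + 7) + (F i (j + h)%N - F i j + 7) - Z).
  by rewrite /mixdiff /Z; ring.
rewrite pD powRr1 ?(ltW d0) //.
apply: le_trans (ler_wpM2r (ltW (pw0 _)) hgood) _.
have UC0 e : 0 <= \sum_(e' | (cell (i + h) j e' == cell (i + h) j e) &&
     (cell i (j + h) e' == cell i (j + h) e)) nu e'.
  by apply: sumr_ge0 => e' _; exact: cellweight_ge0.
have M0 w (w0 : forall e, 0 <= w e) i' j' e : 0 <= mass w i' j' e by exact: sumr_ge0.
rewrite mulr_suml big_mkcond; apply: ler_sum => e _; case: ifPn => [/andP[nP nL]|_]; last first.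
  apply: mulr_ge0; first exact: cellweight_ge0.
  by apply: divr_ge0 => //; apply: mulr_ge0; apply: M0; exact: cellweight_ge0.
have [->|ne] := eqVneq (nu e) 0; first by rewrite !mul0r.
apply: ler_wpM2l; first exact: cellweight_ge0.
rewrite pD; apply: ler_pM; [exact: ltW | exact: ltW | |].
  rewrite pD; apply: ler_pM; [exact: ltW | exact: ltW | |].
    by apply: rich_lower => //; rewrite leNgt.
  by apply: rich_lower => //; rewrite leNgt.
rewrite powRN lef_pV2 ?posrE //; first exact: cross_cell_upper.
apply: (@lt_le_trans _ _ (nu e)); first by rewrite lt_def ne cellweight_ge0.
by rewrite (bigD1 e) ?eqxx //= lerDl sumr_ge0 // => e' _; exact: cellweight_ge0.
Qed.

Lemma incidence_end (H := (N.+1 - (i + j))%N) :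
  inc (8 * d ^+ H) <= d `^ (F (i + H) j - F i j - 9).
Proof.
have HE : (i + H + j = N.+1)%N by rewrite /H; clear -ij; lia.
have HE' : (H + (i + j) = N.+1)%N by rewrite /H; clear -ij; lia.
rewrite /incidence.
apply: (@le_trans _ _ (\sum_e nu e * d `^ (F (i + H) j - F i j - 9))); last first.
  by rewrite -mulr_suml cellweight_total mul1r.
apply: ler_sum => e _.
have [->|ne] := eqVneq (nu e) 0.
  by rewrite mul0r big1 // => e' _; rewrite !mul0r.
have [Qe _] := cellweight_neq0 ne.
under eq_bigr do rewrite -mulrA.
rewrite -mulr_sumr; apply: ler_wpM2l; first exact: cellweight_ge0.
(* At the last width a pair shares its point, so the box has two sides equal to 0 and its slope side
   is that of the whole cell. *)
have hA e' : ((x e', y e') == (x e, y e)) -> inQ e' -> X e' ->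
    inbox x y a (x e) (y e) (a q) (0 * d ^+ (i + H)) (1 * d ^+ j) (0 * d ^+ (i + H + j)) e'.
  move=> /eqP[ex ey] /QP[_ ha _] _.
  by rewrite /inbox ex ey !subrr mulr0 subrr normr0 !mul0r mul1r !lexx ha.
have ijH : (i + H + j <= N.+1)%N by rewrite HE.
apply: le_trans (cellweight_box ijH _ _ _ hA); try lra.
rewrite [leRHS]big_mkcond; apply: ler_sum => e' _.
have [->|ne'] := eqVneq (nu e') 0; first by rewrite mul0r; case: ifP.
have [Qe' _] := cellweight_neq0 ne'.
case: (lerP `|rvdist _ _ _ _ _|) => [|_]; last first.
  by rewrite mulr0; case: ifP => // _; exact: cellweight_ge0.
rewrite norm_shear // scaled // -mulrA -exprD HE' => /same_point ->.
by rewrite eqxx mulr1.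
Qed.

(** By [step_l] the mass of a ball of lines shrinks by at most [d^2] per scale up to constants,
    which balances the decay [1 / angle^2] of the correlations. All angular scales thus have the
    same bound [c], and their sum costs [N + 1 <= 1 / d]. *)
Lemma high_low_step k : (i + j + k < N.+1)%N -> exists Err : R, [/\ 0 <= Err,
  Err ^+ 2 <= d `^ (axgrow F i j k - 35)
 & inc (8 * d ^+ k) / d ^+ k <= 82 * (inc (8 * d ^+ k.+1) / d ^+ k.+1) + Err].
Proof.
move=> ijk.
have d1000 : d <= 1 / 1000 by move: dK; lra.
have ijkP : (i + k + j <= N.+1)%N by clear -ijk; lia.
pose g := F i (j + k) - F i j - 18.
pose lam l := d `^ (g - 2 * (k%:R - l%:R)).
have hL l a0 b0 : (l <= k)%N -> \sum_(e | (`|anorm e - a0| <= 100 * d ^+ l) &&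
     (`|rintercept xnorm ynorm anorm e - b0| <= 100 * d ^+ l)) nu e <= lam l.
  move=> lk; have ijl : (i + (j + l) <= N.+1)%N by clear -ijk lk; lia.
  apply: le_trans (line_density a0 b0 ijl) _; rewrite ple /g.
  have := @step_l i (j + l)%N 0%N (k - l)%N.
  rewrite addn0 add0n -addnA subnKC // natrB // => /(_ _) le.
  have : F i (j + k) <= F i (j + l) + 2 * (k%:R - l%:R) + 9 by apply: le; clear -ijk; lia.
  by lra.
have nu1 : \sum_e nu e <= 1 by rewrite cellweight_total.
have [Err [E0 Esq Estep]] := high_low d0 d1000 cellweight_ge0 nu1 xnorm_le1 anorm_le1
  ynorm_le2 (fun x0 y0 => point_density x0 y0 ijkP) hL.
exists Err; split => //; apply: le_trans Esq _.
pose c := d `^ (g - k%:R - 2).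
have term l : d ^+ k / (d ^+ l.+1) ^+ 2 * lam l = c.
  rewrite /lam !pX pw_sqr // -powRN -!pD /c -natr1; congr (_ `^ _); ring.
have last_term : lam k / d ^+ k.+1 <= c.
  by rewrite /lam pX -powRN -pD /c ple -natr1; lra.
have br : lam k / d ^+ k.+1 + \sum_(l < k) d ^+ k / (d ^+ l.+1) ^+ 2 * lam l <=
    d `^ (-1) * c.
  rewrite (eq_bigr _ (fun (l : 'I_k) _ => term l)) sumr_const card_ord -[c *+ k]mulr_natl.
  apply: (@le_trans _ _ (k.+1%:R * c)); first by rewrite -natr1; lra.
  apply: ler_wpM2r; first exact: (ltW (pw0 _)).
  rewrite powRN powRr1 ?(ltW d0) // -[leRHS]mul1r ler_pdivlMr //.
  apply: le_trans dN; apply: ler_wpM2r; first exact: ltW.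
  by rewrite ler_nat; clear -ijk; lia.
have c0 : 82 ^+ 2 * 2000 <= d `^ (-3).
  have -> : -3 = (-1) + (-1) + (-1) :> R by ring.
  have s82 : 82 <= d `^ (-1) by apply: small_le_pw => //; rewrite ler_nat.
  have s2000 : 2000 <= d `^ (-1) by apply: small_le_pw.
  rewrite !pD; apply: ler_pM; [by rewrite -natrX ler0n | exact: ler0n | | exact: s2000].
  by rewrite expr2; apply: ler_pM; [exact: ler0n | exact: ler0n | |].
have br0 : 0 <= lam k / d ^+ k.+1 + \sum_(l < k) d ^+ k / (d ^+ l.+1) ^+ 2 * lam l.
  apply: addr_ge0; first by apply: divr_ge0; [exact: (ltW (pw0 _)) | exact: ltW].
  by apply: sumr_ge0 => l _; rewrite term; exact: (ltW (pw0 _)).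
set M := d `^ _ / _; have M0 : 0 <= M by apply: divr_ge0; apply: ltW => //; exact: exprn_gt0.
apply: (@le_trans _ _ (d `^ (-3) * M * (d `^ (-1) * c))).
  have cc0 : 0 <= 82 ^+ 2 * 2000 :> R by rewrite -natrX; exact: (mulr_ge0 (ler0n _ _) (ler0n _ _)).
  exact: (ler_pM (mulr_ge0 cc0 M0) br0 (ler_wpM2r M0 c0) br).
rewrite /M /c pX pw_sqr // -powRN -!pD ple /axgrow /g -natr1; lra.
Qed.

End FixedCell.

(** If no error exceeds [d * b h], the chain of high-low steps loses at most [83^(N+1) < 1 / d],
    which forces [b H > d * b h]. Otherwise one error exceeds [d * b h], and squaring yields the
    constant [85 = 2 * (1 + 24) + 35]. *)
Lemma losing_main i j h : (0 < h)%N -> (i + j + 2 * h <= N.+1)%N ->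
  losing F 85 N.+1 i j h.
Proof.
move=> h0 ijh; have ij : (i + j <= N.+1)%N by clear -ijh; lia.
have [q [Xq qlow qhull]] := heavy ij.
set H := (N.+1 - (i + j))%N.
have hH : (h + (H - h) = H)%N by rewrite /H; clear -ijh; lia.
pose b k := incidence (cellweight i j q) (xnorm i j q) (ynorm i j q) (anorm i j q) (8 * d ^+ k)
  / d ^+ k.
have bstart : d `^ (mixdiff F i j h + 24) <= b h.
  rewrite /b ler_pdivlMr // [X in _ * X]pX -pD [X in d `^ X]addrAC.
  exact: (incidence_start ij Xq qlow qhull ijh).
have b0 : 0 < b h by apply: lt_le_trans bstart.
have [small|big] := boolP `[< forall k, (h <= k < H)%N -> exists Err : R,
    [/\ Err <= d * b h & b k <= 82 * b k.+1 + Err] >].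
  right; move/asboolP: small => small.
  have bend : d * b h < b H.
    rewrite ltNge; apply/negP => le.
    have E0 : 0 <= d * b h by apply: mulr_ge0; exact: ltW.
    have st k : (h <= k < h + (H - h))%N -> b k <= 82 * b k.+1 + d * b h.
      rewrite hH => /small[Err [h1 h2]]; apply: le_trans h2 _; by rewrite lerD2l.
    have := @backward_chain _ b (d * b h) h (H - h) E0 _ st.
    rewrite hH => /(_ le) /(le_trans _) bb.
    have : 83 ^+ (H - h) * d < 1.
      apply: le_lt_trans d83; rewrite ler_wpM2r ?(ltW d0) //.
      by apply: ler_weXn2l; [rewrite ler1n | rewrite /H; clear -h0; lia].
    move=> lt; have : 83 ^+ (H - h) * (d * b h) < b h by rewrite mulrA gtr_pMl.
    by rewrite ltNge bb.
  have bH : b H <= d `^ (endgrow F N.+1 i j - 9).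
    rewrite /b ler_pdivrMr // [leRHS](_ : _ = d `^ (endgrow F N.+1 i j - 9 + H%:R)); last first.
      by rewrite pX -pD.
    rewrite /endgrow -/H.
    apply: le_trans (incidence_end ij qlow) _; rewrite ple -/H; lra.
  have : d `^ (1 + (mixdiff F i j h + 24)) <= d `^ (endgrow F N.+1 i j - 9).
    apply: le_trans bH; apply: le_trans (ltW bend).
    by rewrite pD powRr1 ?(ltW d0) // ler_wpM2l // ltW.
  by rewrite ple; lra.
left; move: big => /asboolPn /existsNP[k /not_implyP[/andP[hk kH] nex]].
have ijk : (i + j + k < N.+1)%N by move: kH; rewrite /H; clear -ij; lia.
exists k; split => //; first exact: ltnW.
have [Err [E0 Esq Est]] := high_low_step qlow ijk.
have lt : d * b h < Err.
  by rewrite ltNge; apply/negP => le; apply: nex; exists Err.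
have : (d `^ (1 + (mixdiff F i j h + 24))) ^+ 2 <= d `^ (axgrow F i j k - 35).
  apply: le_trans Esq; rewrite ler_pXn2r ?nnegrE //; last exact: ltW.
  by apply: le_trans (ltW lt); rewrite pD powRr1 ?(ltW d0) // ler_wpM2l // ltW.
by rewrite pw_sqr // ple; lra.
Qed.

End MainProposition.

Lemma add3_mul_lt1 (R : realFieldType) (A B C d : R) : 0 <= A -> 0 <= B -> 0 <= C -> 0 < d ->
  (A + B + C) * d < 1 -> [/\ A * d <= 1, B * d < 1 & C * d < 1].
Proof.
move=> A0 B0 C0 d0; have := mulr_ge0 A0 (ltW d0); have := mulr_ge0 B0 (ltW d0).
have := mulr_ge0 C0 (ltW d0); rewrite !mulrDl => h1 h2 h3 h.
by split; lra.
Qed.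

Theorem weighted_incidence (R : realType) (t s : R) : 1 < t -> 0 <= s <= 1 -> 3 < 2 * t + s ->
  exists (eta : R) (N : nat) (dmax : R), [/\ 0 < eta, (0 < N)%N, 0 < dmax <= 1 / 2000 &
  forall d : R, 0 < d < dmax ->
  forall (I : finType) (x y a m : I -> R),
    (forall e, 0 <= m e) -> 1 / 2 <= \sum_e m e -> \sum_e m e <= 1 ->
    (forall e, 0 <= x e <= 1) -> (forall e, 0 <= y e <= 1) -> (forall e, `|a e| <= 1) ->
    (forall e w, d ^+ N <= w <= 1 ->
      \sum_(e' | [&& x e' == x e, y e' == y e & `|a e' - a e| <= w]) m e'
        <= d `^ (N%:R * (t - eta) - 1) * w `^ s) ->
    exists e e', (x e, y e) != (x e', y e') /\ `|y e - y e' - a e' * (x e - x e')| < d ^+ N].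
Proof.
move=> t1 /andP[s0 s1] ts; have [eta eta0 [N0 hN0]] := exponents_not_losing 85 t1 s0 ts.
exists eta, N0.+1; set N := N0.+1.
pose T : finType := ('I_N.+2 * 'I_N.+2)%type.
pose K := (2 * (2 * N + 10).+1 ^ #|T|)%N.
(* One threshold for the three uses of a small [d]: absorbing absolute constants, the chain over all
   scales, and the pigeonhole over exponent vectors. *)
pose S := (2000 + 83 ^+ N.+1 + K%:R : R).
have p83 : 0 <= 83 ^+ N.+1 :> R by apply: exprn_ge0; exact: ler0n.
have K0 : 0 <= K%:R :> R by exact: ler0n.
have S2000 : 2000 <= S by rewrite /S -addrA lerDl addr_ge0.
have S0 : 0 < S by apply: lt_le_trans S2000; rewrite ltr0n.
have c0 : 0 < 2000 :> R by rewrite ltr0n.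
exists (S^-1); split; [by []|by []| |].
  by rewrite invr_gt0 S0 div1r lef_pV2 ?posrE.
move=> d /andP[d0 dS] I x y a m m0 mlow m1 xb yb ab frost; apply: contrapT => none.
have dS1 : S * d < 1 by rewrite -ltr_pdivlMl // mulr1.
have [dK d83 dcap] := add3_mul_lt1 (ltW c0) p83 K0 d0 dS1.
pose mass (p : T) := cellmass x y a d m p.1 p.2.
have mass1 p e : mass p e <= 1.
  by apply: le_trans m1; rewrite [leRHS](bigID (fun e' => key x y a d p.1 p.2 e' == key x y a d p.1 p.2 e)) /= lerDl sumr_ge0.
have small : ((2 * N + 10).+1 ^ #|T|)%:R * d < 1 / 2.
  by rewrite ltr_pdivlMr ?ltr0n // mulrC mulrA -natrM.
have [X [g [hX hg]]] := uniformise d0 m0 mlow mass1 small.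
pose f i j := g (inord i, inord j).
have fX i j : (i + j <= N.+1)%N -> (f i j <= 2 * N + 10)%N /\
    forall e, X e -> cellmass x y a d m i j e <= d ^+ f i j /\
     ((f i j < 2 * N + 10)%N -> d ^+ (f i j).+1 <= cellmass x y a d m i j e).
  move=> ij; have := hg (inord i, inord j); rewrite /mass /= !inordK //.
    by rewrite ltnS (leq_trans (leq_addl _ _) ij).
  by rewrite ltnS (leq_trans (leq_addr _ _) ij).
have noinc e e' : (x e, y e) != (x e', y e') -> d ^+ N <= `|y e - y e' - a e' * (x e - x e')|.
  by move=> ne; rewrite leNgt; apply/negP => lt; apply: none; exists e, e'.
have weak (c c' : R) g' : c <= c' -> step_le g' c N.+1 -> step_le g' c' N.+1.
  by move=> cc h u v p q le; apply: le_trans (h u v p q le) _; rewrite lerD2l.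
have weak' (c c' : R) g' : c <= c' -> step_ge g' c N.+1 -> step_ge g' c' N.+1.
  by move=> cc h u v p q le; apply: le_trans (h u v p q le); rewrite lerD2l lerN2.
apply: (hN0 N (dens R f) (leqnSn _)).
- apply: le_trans (dens00 d0 dK m0 xb yb ab hX fX) _; by rewrite ler_nat.
- by apply: weak (dens_step_le d0 dK m0 m1 xb yb ab hX fX); rewrite ler_nat.
- by apply: weak' (dens_step_ge d0 dK m0 m1 xb yb ab hX fX); rewrite ler_nat.
- move=> i j ij.
  have s01 : 0 <= s <= 1 by rewrite s0.
  have := dens_end d0 dK m0 m1 xb yb ab hX fX noinc s01 frost ij.
  by apply: le_trans; rewrite lerD2l lerN2 ler_nat.
- by move=> i j h h0 ijh; apply: (losing_main d0 dK m0 m1 xb yb ab hX fX noinc d83).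
Qed.

(** * Lines, slopes and the reduction to weighted flags *)

Local Open Scope classical_set_scope.
Local Open Scope ring_scope.

Section Lines.
Variable R : realType.
Implicit Types (p q z : plane R) (l : set (plane R)).

(** The signed distance of [z] to the line of direction [th] through the origin; the lines of
    direction [th] are its level sets. *)
Definition offset (th : R) z : R := z.1 * sin th - z.2 * cos th.

Lemma line_atP p th z : line_at p th z <-> offset th z = offset th p.
Proof.
have sc := cos2Dsin2 th; split.
  by move=> [r _ <-]; rewrite /offset /=; ring.
rewrite /offset => E; exists ((z.1 - p.1) * cos th + (z.2 - p.2) * sin th) => //.
have h : (z.2 - p.2) * cos th = (z.1 - p.1) * sin th by lra.
rewrite [RHS]surjective_pairing; congr (_, _).
  have -> : p.1 + ((z.1 - p.1) * cos th + (z.2 - p.2) * sin th) * cos th =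
    p.1 + ((z.1 - p.1) * cos th ^+ 2 + (z.2 - p.2) * cos th * sin th) by ring.
  rewrite h; transitivity (p.1 + (z.1 - p.1) * (cos th ^+ 2 + sin th ^+ 2)); first by ring.
  by rewrite sc; ring.
have -> : p.2 + ((z.1 - p.1) * cos th + (z.2 - p.2) * sin th) * sin th =
  p.2 + ((z.1 - p.1) * sin th * cos th + (z.2 - p.2) * sin th ^+ 2) by ring.
rewrite -h; transitivity (p.2 + (z.2 - p.2) * (cos th ^+ 2 + sin th ^+ 2)); first by ring.
by rewrite sc; ring.
Qed.

Lemma line_at_recenter p q th : line_at p th q -> line_at p th = line_at q th.
Proof. by move=> /line_atP E; apply/seteqP; split=> z /line_atP h; apply/line_atP; rewrite h. Qed.

Lemma line_through l p : is_line l -> l p -> exists th, l = line_at p th.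
Proof. by move=> [a [th ->]] lp; exists th; exact: line_at_recenter. Qed.

Lemma line_at_parallel p th ph : sin th * cos ph = cos th * sin ph ->
  line_at p th = line_at p ph.
Proof.
move=> par; have half t1 t2 : sin t1 * cos t2 = cos t1 * sin t2 ->
    line_at p t1 `<=` line_at p t2.
  move=> h z /line_atP E; apply/line_atP.
  have D : (z.1 - p.1) * sin t1 = (z.2 - p.2) * cos t1 by move: E; rewrite /offset; lra.
  apply/eqP; rewrite -subr_eq0; apply/eqP.
  have -> : offset t2 z - offset t2 p =
     ((z.1 - p.1) * sin t2 - (z.2 - p.2) * cos t2) * (cos t1 ^+ 2 + sin t1 ^+ 2).
    by rewrite cos2Dsin2 /offset; ring.
  transitivity (cos t1 * cos t2 * ((z.1 - p.1) * sin t1 - (z.2 - p.2) * cos t1) +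
    cos t1 * (z.1 - p.1) * (cos t1 * sin t2 - sin t1 * cos t2) +
    sin t1 * sin t2 * ((z.1 - p.1) * sin t1 - (z.2 - p.2) * cos t1) +
    sin t1 * (z.2 - p.2) * (cos t1 * sin t2 - sin t1 * cos t2)); first by ring.
  by rewrite D h !subrr !mulr0 !addr0.
apply/seteqP; split; first exact: half.
by apply: half; move: par; lra.
Qed.

Lemma edist_offset th z w : `|offset th z - offset th w| <= Defs.edist z w.
Proof.
rewrite -(@ler_pXn2r _ 2) ?nnegrE ?sqrtr_ge0 // sqr_sqrtr ?addr_ge0 ?sqr_ge0 //.
rewrite real_normK ?num_real //.
have := sqr_ge0 ((z.1 - w.1) * cos th + (z.2 - w.2) * sin th).
have -> : (z.1 - w.1) ^+ 2 + (z.2 - w.2) ^+ 2 =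
  ((z.1 - w.1) ^+ 2 + (z.2 - w.2) ^+ 2) * (cos th ^+ 2 + sin th ^+ 2).
  by rewrite cos2Dsin2 mulr1.
have -> : ((z.1 - w.1) ^+ 2 + (z.2 - w.2) ^+ 2) * (cos th ^+ 2 + sin th ^+ 2) =
  (offset th z - offset th w) ^+ 2 + ((z.1 - w.1) * cos th + (z.2 - w.2) * sin th) ^+ 2.
  by rewrite /offset; ring.
by lra.
Qed.

Definition foot p th z : plane R :=
  (z.1 - (offset th z - offset th p) * sin th, z.2 + (offset th z - offset th p) * cos th).

Lemma foot_on_line p th z : line_at p th (foot p th z).
Proof.
apply/line_atP; rewrite /foot {1}/offset /=; set c := offset th z - offset th p.
have -> : (z.1 - c * sin th) * sin th - (z.2 + c * cos th) * cos th =
   z.1 * sin th - z.2 * cos th - c * (cos th ^+ 2 + sin th ^+ 2) by ring.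
by rewrite cos2Dsin2 /c /offset; ring.
Qed.

Lemma edist_foot p th z : Defs.edist z (foot p th z) = `|offset th z - offset th p|.
Proof.
rewrite /Defs.edist /foot /=; set c := offset th z - offset th p.
have -> : (z.1 - (z.1 - c * sin th)) ^+ 2 + (z.2 - (z.2 + c * cos th)) ^+ 2 =
  c ^+ 2 * (cos th ^+ 2 + sin th ^+ 2) by ring.
by rewrite cos2Dsin2 mulr1 sqrtr_sqr.
Qed.

Lemma nbhd_lineP (delta : R) p th z :
  nbhd delta (line_at p th) z <-> `|offset th z - offset th p| < delta.
Proof.
split=> [[w /line_atP <- lt]|lt]; last first.
  by exists (foot p th z); [exact: foot_on_line | rewrite edist_foot].
by apply: le_lt_trans lt; exact: edist_offset.
Qed.

Lemma dist0_line p th : dist0 (line_at p th) = `|offset th p|.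
Proof.
have o0 : offset th (0, 0) = 0 by rewrite /offset /= !mul0r subrr.
have lb : lbound [set Defs.edist (0, 0) x | x in line_at p th] `|offset th p|.
  move=> _ [w /line_atP <- <-]; rewrite -normrN -[- _]add0r -{1}o0.
  exact: edist_offset.
have mem : [set Defs.edist (0, 0) x | x in line_at p th] `|offset th p|.
  exists (foot p th (0, 0)); first exact: foot_on_line.
  by rewrite edist_foot o0 add0r normrN.
apply/eqP; rewrite eq_le; apply/andP; split.
  by apply: ge_inf => //; exists `|offset th p|.
by apply: lb_le_inf => //; exists `|offset th p|.
Qed.

Lemma lipschitz1 (f df : R -> R) : (forall x : R, is_derive x 1 f (df x)) ->
  (forall x, `|df x| <= 1) -> forall u v, `|f u - f v| <= `|u - v|.
Proof.
move=> fd df1; have main u v : u < v -> `|f u - f v| <= `|u - v|.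
  move=> uv; have [|c _ E] := MVT uv (fun x _ => fd x).
    by apply: derivable_within_continuous => x _; have [] := fd x.
  by rewrite distrC E normrM [leRHS]distrC ler_piMl.
move=> u v; have [uv|vu|->] := ltgtP u v; first exact: main.
  by rewrite distrC [leRHS]distrC; exact: main.
by rewrite subrr normr0.
Qed.

Lemma sin_lipschitz (u v : R) : `|sin u - sin v| <= `|u - v|.
Proof. by apply: (lipschitz1 (df := cos)) => x; exact: cos_max. Qed.

Lemma cos_lipschitz (u v : R) : `|cos u - cos v| <= `|u - v|.
Proof.
apply: (lipschitz1 (df := fun x => - sin x)) => x.
by rewrite normrN; exact: sin_max.
Qed.

Lemma atan_lipschitz (u v : R) : `|atan u - atan v| <= `|u - v|.
Proof.
apply: (lipschitz1 (df := fun x => (1 + x ^+ 2)^-1)) => x.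
have h : 1 <= 1 + x ^+ 2 by rewrite lerDl sqr_ge0.
by rewrite ger0_norm ?invr_ge0 ?(le_trans _ h) // invf_le1 // (lt_le_trans _ h).
Qed.

(** Nearby directions in a pencil give nearby lines, so a set of such lines lies in a ball of the
    line metric, where the hypothesis counts it. The 3 is 2 for the distances to the origin and 1
    for the angles. *)
Lemma line_dist_pencil p th ph : `|p.1| <= 1 -> `|p.2| <= 1 ->
  line_dist (line_at p th) (line_at p ph) <= 3 * `|th - ph|.
Proof.
move=> p1 p2; rewrite /line_dist !dist0_line.
have hd : `| `|offset th p| - `|offset ph p| | <= 2 * `|th - ph|.
  apply: le_trans (ler_dist_dist _ _) _.
  have -> : offset th p - offset ph p =
    p.1 * (sin th - sin ph) - p.2 * (cos th - cos ph) by rewrite /offset; ring.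
  apply: le_trans (ler_normB _ _) _; rewrite !normrM.
  have h1 : `|p.1| * `|sin th - sin ph| <= 1 * `|th - ph|.
    by apply: ler_pM => //; exact: sin_lipschitz.
  have h2 : `|p.2| * `|cos th - cos ph| <= 1 * `|th - ph|.
    by apply: ler_pM => //; exact: cos_lipschitz.
  by lra.
have ha : angle_dist (angle (line_at p th)) (angle (line_at p ph)) <= `|th - ph|.
  apply: ge_inf; first by exists 0 => _ [x _ [y _ <-]].
  by exists th; [exists p | exists ph => //; exists p].
by lra.
Qed.

(* Moving along one line by a large amount leaves the neighbourhood of the
   other unless they are parallel. *)
Lemma nbhd_line_inj (delta : R) l l' : 0 < delta -> is_line l -> is_line l' ->
  nbhd delta l = nbhd delta l' -> l = l'.
Proof.
move=> del0 [p [th ->]] [q [ph ->]] E.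
have inN z : `|offset th z - offset th p| < delta <-> `|offset ph z - offset ph q| < delta.
  by rewrite -!nbhd_lineP E.
have par : sin th * cos ph = cos th * sin ph.
  apply/eqP; rewrite -subr_eq0; apply: contrapT => /negP k0.
  set k := _ - _ in k0.
  pose r := (3 * delta) / k.
  pose z : plane R := (p.1 + r * cos th, p.2 + r * sin th).
  have hp : `|offset ph p - offset ph q| < delta by apply/inN; rewrite subrr normr0.
  have hz : `|offset ph z - offset ph q| < delta.
    by apply/inN; have /line_atP -> : line_at p th z by [exists r]; rewrite subrr normr0.
  have ez : offset ph z - offset ph p = - (r * k) by rewrite /offset /z /k /=; ring.
  have rk : r * k = 3 * delta by rewrite /r divfK.
  by move: hp hz ez; rewrite rk !ltr_norml; lra.
have lineq : line_at q th = line_at q ph by exact: line_at_parallel.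
have E' z : `|offset th z - offset th p| < delta <-> `|offset th z - offset th q| < delta.
  by rewrite -!nbhd_lineP lineq E.
rewrite -lineq; apply: line_at_recenter; apply/line_atP.
apply/eqP; rewrite eq_sym -subr_eq0; apply: contrapT => /negP k0.
set k := _ - _ in k0.
have shift (c : R) : exists z, offset th z = c.
  exists (c * sin th, - (c * cos th)).
  by rewrite /offset /= -[RHS]mulr1 -(cos2Dsin2 th); ring.
have [kpos|kneg] := ltP 0 k.
  have [z ez] := shift (offset th p + Num.max 0 (delta - k / 2)).
  have : `|offset th z - offset th p| < delta.
    by rewrite ez addrAC subrr add0r ltr_norml; case: (lerP 0 (delta - k / 2)) => h; lra.
  move=> /E'; rewrite ez ltr_norml; case: (lerP 0 (delta - k / 2)) => h; rewrite /k in kpos h *; lra.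
have {kneg} kneg : k < 0 by rewrite lt_def eq_sym k0 in kneg *.
have [z ez] := shift (offset th p - Num.max 0 (delta + k / 2)).
have : `|offset th z - offset th p| < delta.
  by rewrite ez addrAC subrr add0r ltr_norml; case: (lerP 0 (delta + k / 2)) => h; lra.
by move=> /E'; rewrite ez ltr_norml; case: (lerP 0 (delta + k / 2)) => h; rewrite /k in kneg h *; lra.
Qed.

End Lines.

Section Slopes.
Variable R : realType.
Implicit Types (p q z : plane R) (l : set (plane R)) (th al : R) (b : bool).

(** Exchanging the coordinates for steep lines makes every slope at most 1. One of the two classes
    carries at least half of the weight of all flags, and only that class is kept. *)
Definition steep th : bool := `|cos th| < `|sin th|.
Definition slope b th : R := if b then cos th / sin th else sin th / cos th.
Definition axis1 b p : R := if b then p.2 else p.1.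
Definition axis2 b p : R := if b then p.1 else p.2.
Definition slope_angle b al : R := if b then - (atan al - pi / 2) else atan al.

Lemma steep_neq0 th : if steep th then sin th != 0 else cos th != 0.
Proof.
rewrite /steep; case: ifPn => [lt|].
  by rewrite -normr_gt0 (le_lt_trans _ lt).
rewrite -leNgt => le; apply: contraPneq (cos2Dsin2 th) => c0.
move: le; rewrite c0 normr0 normr_le0 => /eqP ->.
by rewrite expr0n addr0 => /esym /eqP; rewrite oner_eq0.
Qed.

Lemma slope_le1 th : `|slope (steep th) th| <= 1.
Proof.
have := steep_neq0 th; rewrite /slope /steep; case: ifPn => [lt|]; rewrite ?(negbTE _).
  by move=> s0; rewrite normf_div ler_pdivrMr ?normr_gt0 // mul1r ltW.
by rewrite -leNgt => le c0; rewrite normf_div ler_pdivrMr ?normr_gt0 // mul1r.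
Qed.

Lemma slope_direction th : let al := slope (steep th) th in
  if steep th then cos th = al * sin th else sin th = al * cos th.
Proof. by have := steep_neq0 th; rewrite /slope /=; case: ifP => _ h; rewrite divfK. Qed.

Lemma sin_atan_tan al : sin (atan al) = al * cos (atan al).
Proof.
have c0 : cos (atan al) != 0.
  by rewrite cos_atan invr_neq0 // gt_eqF // sqrtr_gt0 ltr_wpDr ?sqr_ge0.
by rewrite -{2}(atanK al) /tan divfK.
Qed.

(** The angle of a line is defined modulo [pi] only, so close slopes need not come from close
    angles; this representative depends on the slope through [atan], which is 1-Lipschitz. *)
Lemma line_at_slope p th :
  line_at p th = line_at p (slope_angle (steep th) (slope (steep th) th)).
Proof.
apply: line_at_parallel; have := slope_direction th => /=.
rewrite /slope_angle; set al := slope _ _; case: ifP => _ E.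
  by rewrite sinN cosN sinBpihalf cosBpihalf opprK sin_atan_tan E; ring.
by rewrite sin_atan_tan E; ring.
Qed.

Lemma line_dist_slope p th ph : `|p.1| <= 1 -> `|p.2| <= 1 -> steep th = steep ph ->
  line_dist (line_at p th) (line_at p ph) <=
    3 * `|slope (steep th) th - slope (steep ph) ph|.
Proof.
move=> p1 p2 E; rewrite (line_at_slope p th) (line_at_slope p ph).
apply: le_trans (line_dist_pencil _ _ p1 p2) _; rewrite ler_pM2l //.
rewrite -E; move: (slope _ th) (slope _ ph) => u v; rewrite /slope_angle.
case: (steep th); last exact: atan_lipschitz.
have -> : - (atan u - pi / 2) - - (atan v - pi / 2) = - (atan u - atan v) by ring.
by rewrite normrN; exact: atan_lipschitz.
Qed.

Lemma offset_slope_le th z p :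
  `|offset th z - offset th p| <=
  `|axis2 (steep th) z - axis2 (steep th) p -
     slope (steep th) th * (axis1 (steep th) z - axis1 (steep th) p)|.
Proof.
have := slope_direction th; rewrite /= /axis1 /axis2 /offset.
move: (slope _ th) => al; case: (steep th) => E.
  rewrite {}E (_ : _ - _ = sin th * (z.1 - p.1 - al * (z.2 - p.2))); last by ring.
  by rewrite normrM ler_piMl // sin_max.
rewrite {}E (_ : _ - _ = - (cos th * (z.2 - p.2 - al * (z.1 - p.1)))); last by ring.
by rewrite normrN normrM ler_piMl // cos_max.
Qed.

End Slopes.

Lemma card_le_fset_set (J : finType) (T : choiceType) (C : pred J) (g : J -> T) (B : set T) :
  finite_set B -> {in C &, injective g} -> (forall e, C e -> B (g e)) ->
  (#|C| <= #|` fset_set B|)%N.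
Proof.
move=> fB inj hB; rewrite cardE -(size_map g); apply: uniq_leq_size.
  by rewrite map_inj_in_uniq ?enum_uniq // => u v; rewrite !mem_enum; exact: inj.
move=> l /mapP[e]; rewrite mem_enum => Ce ->.
by rewrite -[_ \in _]/(g e \in fset_set B) in_fset_set // mem_set //; exact: hB.
Qed.

Lemma card_fset_set_sub (T : choiceType) (F : {fset T}) (B : set T) :
  finite_set B -> (forall l, B l -> l \in F) ->
  #|[pred l : F | `[< B (val l) >]]| = #|` fset_set B|.
Proof.
move=> fB sub; apply/eqP; rewrite eqn_leq; apply/andP; split.
  apply: (card_le_fset_set (g := val)) => //; first by move=> u v _ _; exact: val_inj.
  by move=> e /asboolP.
rewrite cardE -(size_map val); apply: uniq_leq_size; first exact: fset_uniq.
move=> l; rewrite -[_ \in _]/(l \in fset_set B) in_fset_set // inE => Bl.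
by apply/mapP; exists [` sub l Bl]%fset => //; rewrite mem_enum inE; exact: Bl.
Qed.

(** * The weighted flags of a configuration *)

Section Reduction.
Variables (R : realType) (delta s C : R) (P : set (plane R)).
Variable TT : plane R -> set (set (plane R)).
Hypotheses (delta0 : 0 < delta) (Punit : P `<=` @unit_square R) (Pfin : finite_set P).
Hypothesis tubes : forall p, P p -> [/\ TT p !=set0, TT p `<=` tube_through delta p
  & tube_set delta s C (TT p)].

Local Notation L p := (central_lines delta (TT p)).

Lemma unit_squareP p : P p -> 0 <= p.1 <= 1 /\ 0 <= p.2 <= 1.
Proof.
move=> /Punit [] /=; rewrite !in_itv /= => h1 h2; by split.
Qed.

Lemma central_line_through p l : P p -> L p l ->
  [/\ is_line l, l p & TT p (nbhd delta l)].
Proof.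
move=> Pp [T TpT [il ET]]; have [_ thr _] := tubes Pp.
have [l' [il' ET'] l'p] := thr T TpT.
have -> : l = l' by apply: (nbhd_line_inj delta0) => //; rewrite -ET -ET'.
by rewrite -ET'.
Qed.

Lemma central_lines_finite p : P p -> finite_set (L p).
Proof. by move=> /tubes[_ _ []]. Qed.

Lemma central_lines_neq0 p : P p -> L p !=set0.
Proof.
move=> /tubes[[T TpT] thr _]; have [l cl _] := thr T TpT.
by exists l, T.
Qed.

Definition direction p l : R := xget 0 [set th | l = line_at p th].

Lemma direction_line p l : P p -> L p l -> l = line_at p (direction p l).
Proof.
move=> Pp Lp; have [il lp _] := central_line_through Pp Lp.
by rewrite /direction; case: xgetP => [th _ ->//|] none; have [th E] := line_through il lp;
  case: (none th).
Qed.

Definition points := fset_set P.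
Definition lines := fset_set (\bigcup_(p in P) L p).
(** A line that belongs to the pencils of two points gives two flags, in accordance with the
    disjoint union of the pencils; [incident] selects the pairs that come from a pencil. *)
Definition flag := (points * lines)%type.
Definition incident (e : flag) : bool := `[< L (val e.1) (val e.2) >].
Definition dir (e : flag) : R := direction (val e.1) (val e.2).
Definition flagclass (b : bool) : pred flag := fun e => incident e && (steep (dir e) == b).
Definition nlines (p : plane R) : nat := #|` fset_set (L p)|%fset.
Definition weight (e : flag) : R := (#|` points|%fset%:R * (nlines (val e.1))%:R)^-1.

Lemma pointP (p : points) : P (val p).
Proof. by have := valP p; rewrite /points in_fset_set // inE. Qed.

Lemma nlines_gt0 p : P p -> (0 < nlines p)%N.
Proof.
move=> Pp; rewrite /nlines cardfs_gt0; apply/fset0Pn.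
have [l Ll] := central_lines_neq0 Pp; exists l.
by rewrite in_fset_set ?inE //; exact: central_lines_finite.
Qed.

Lemma weight_ge0 e : 0 <= weight e.
Proof. by rewrite invr_ge0 mulr_ge0. Qed.

Lemma weight_total : P !=set0 -> \sum_(e | flagclass true e) weight e +
  \sum_(e | flagclass false e) weight e = 1.
Proof.
move=> [p0 Pp0].
have n0 : (0 < #|` points|%fset)%N.
  by rewrite cardfs_gt0; apply/fset0Pn; exists p0; rewrite in_fset_set ?inE.
transitivity (\sum_(e : flag | incident e) weight e).
  rewrite [RHS](bigID (fun e => steep (dir e) == true)) /=; congr (_ + _).
  by apply: eq_bigl => e; rewrite /flagclass; case: (steep _).
transitivity (\sum_(p : points) \sum_(l : lines | incident (p, l)) weight (p, l)).
  by rewrite pair_big_dep; apply: eq_big => -[p l].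
transitivity (\sum_(p : points) (#|` points|%fset%:R : R)^-1); last first.
  by rewrite sumr_const -cardfE -[LHS]mulr_natl divff // pnatr_eq0 -lt0n.
apply: eq_bigr => p _; have Pp := pointP p.
rewrite (eq_bigr (fun=> (#|` points|%fset%:R * (nlines (val p))%:R)^-1)) //.
rewrite sumr_const.
have -> : #|[pred l : lines | incident (p, l)]| = nlines (val p).
  apply: card_fset_set_sub; first exact: central_lines_finite.
  move=> l Ll; rewrite /lines in_fset_set ?inE; first by exists (val p).
  by apply: bigcup_finite => //; exact: central_lines_finite.
rewrite -[LHS]mulr_natl invfM mulrCA divff ?mulr1 // pnatr_eq0 -lt0n.
exact: nlines_gt0.
Qed.

Lemma class_frost b (e : flag) (w : R) : flagclass b e -> 0 <= s <= 1 -> 1 <= C ->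
  delta <= w <= 1 ->
  \sum_(e' | flagclass b e' && [&& axis1 b (val e'.1) == axis1 b (val e.1),
      axis2 b (val e'.1) == axis2 b (val e.1)
    & `|slope b (dir e') - slope b (dir e)| <= w]) weight e'
  <= 4 * C * w `^ s / #|` points|%fset%:R.
Proof.
move=> /andP[/asboolP Ie /eqP be] /andP[s0 s1] C1 /andP[dw w1].
pose Q (e' : flag) := flagclass b e' && [&& axis1 b (val e'.1) == axis1 b (val e.1),
      axis2 b (val e'.1) == axis2 b (val e.1)
    & `|slope b (dir e') - slope b (dir e)| <= w].
rewrite (eq_bigl Q) //.
have w0 : 0 < w by apply: lt_le_trans dw.
set p := val e.1; have Pp : P p by exact: pointP.
have samep e' : Q e' -> val e'.1 = p.
  move=> /and4P[_ /eqP + /eqP + _]; rewrite /axis1 /axis2 /p.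
  by case: b {be Q} => h1 h2; rewrite [LHS]surjective_pairing h1 h2 -surjective_pairing.
rewrite (eq_bigr (fun=> (#|` points|%fset%:R * (nlines p)%:R)^-1)); last first.
  by move=> e' /samep h; rewrite /weight h.
have ws0 : 0 <= w `^ s by exact: powR_ge0.
suff cardQ : #|Q|%:R <= 4 * C * w `^ s * (nlines p)%:R.
  rewrite sumr_const -[leLHS]mulr_natr invfM -[leLHS]mulrA [leRHS]mulrC.
  apply: ler_wpM2l; first by rewrite invr_ge0.
  by rewrite mulrC ler_pdivrMr // ltr0n nlines_gt0.
have inj : {in Q &, injective (fun e' : flag => val e'.2)}.
  move=> [p1 l1] [p2 l2] /samep /= h1 /samep /= h2 /val_inj ->.
  by congr (_, _); apply: val_inj; exact: etrans h1 (esym h2).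
(* Slopes within [w] give lines at distance at most [3 w], inside the open ball of radius [4 w], and
   [(4 w)^s <= 4 w^s]. If [4 w > 1] the ball condition does not apply, but then [4 w^s >= 4 w > 1]
   and counting all lines suffices. *)
have [w4|w4] := lerP (4 * w) 1.
  have adm : adm_line (val e.2).
    by have [_ _ [sub _ _ _]] := tubes Pp; exact: sub.
  have [_ _ [_ fin _ ball]] := tubes Pp.
  have wP : delta <= 4 * w <= 1 by rewrite w4 andbT; lra.
  have Bfin : finite_set (L p `&` line_ball (val e.2) (4 * w)) by exact: finite_setIl.
  have hB e' : Q e' -> (L p `&` line_ball (val e.2) (4 * w)) (val e'.2).
    move=> Qe'; have pe' := samep _ Qe'.
    move: Qe' => /andP[/andP[/asboolP Le' /eqP be'] /and3P[_ _ hsl]].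
    rewrite pe' in Le'; split => //; split.
      by have [_ _ [sub _ _ _]] := tubes Pp; exact: sub.
    have [[x0 x1] [y0 y1]] : (0 <= p.1 /\ p.1 <= 1) /\ (0 <= p.2 /\ p.2 <= 1).
      by have [/andP[? ?] /andP[? ?]] := unit_squareP Pp.
    have px : `|p.1| <= 1 by rewrite ger0_norm.
    have py : `|p.2| <= 1 by rewrite ger0_norm.
    rewrite (direction_line Pp Ie) (direction_line Pp Le').
    have dirE : dir e' = direction p (val e'.2) by rewrite /dir pe'.
    have := line_dist_slope px py (etrans be (esym be')).
    rewrite be be' dirE => /le_lt_trans; apply.
    rewrite -dirE distrC; apply: (@le_lt_trans _ _ (3 * w)); last by lra.
    by rewrite ler_pM2l.
  have le1 := card_le_fset_set Bfin inj hB.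
  apply: (@le_trans _ _ (C * (4 * w) `^ s * (nlines p)%:R)).
    apply: le_trans (ball _ _ adm wP); by rewrite ler_nat.
  rewrite ler_wpM2r // [4 * C]mulrC -mulrA ler_wpM2l //; first by lra.
  rewrite powRM // ?(ltW w0) // ler_wpM2r //.
  by rewrite -[leRHS]powRr1 //; apply: ler_powR => //; lra.
have hB e' : Q e' -> L p (val e'.2).
  by move=> Qe'; move: (Qe') => /andP[/andP[/asboolP + _] _]; rewrite (samep _ Qe').
have le1 := card_le_fset_set (central_lines_finite Pp) inj hB.
apply: (@le_trans _ _ (nlines p)%:R); first by rewrite ler_nat.
rewrite ler_peMl //.
have : w `^ 1 <= w `^ s by apply: ger_powR => //; rewrite w0.
rewrite powRr1 ?(ltW w0) // => h.
have : 1 * w <= C * w `^ s by apply: ler_pM => //; exact: ltW.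
by move: w4; lra.
Qed.

End Reduction.

Theorem theorem1p4 (R : realType) (t s : R)
    (ht : 1 <= t <= 2) (hs : 0 <= s <= 1) (hts : 3 < 2 * t + s) :
  exists eta delta0 : R, [/\ 0 < eta, 0 < delta0 &
    forall delta : R, 0 < delta < delta0 ->
    forall P : set (plane R),
      P `<=` @unit_square R ->
      finite_set P ->
      (* P has delta^(-t) points, rounded down or up when not an integer *)
      `|#|` fset_set P|%fset%:R - delta `^ (- t)| < 1 ->
    forall TT : plane R -> set (set (plane R)),
      (forall p, P p ->
        [/\ TT p !=set0,
            TT p `<=` tube_through delta p
          & tube_set delta s (delta `^ (- eta)) (TT p)]) ->
    exists p p' : plane R, exists T : set (plane R),
      [/\ P p, P p', p' <> p, TT p' T & T p]].
Proof.
have t1 : 1 < t by move: hs => /andP[_ s1]; lra.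
have [eta [N [dmax [eta0 N0 /andP[dmax0 dmax1] main]]]] := weighted_incidence t1 hs hts.
exists eta, (dmax ^+ N); split => //; first exact: exprn_gt0.
move=> delta /andP[del0 delN] P Punit Pfin Pcard TT tubes.
pose d := delta `^ N%:R^-1.
have Nn0 : N%:R != 0 :> R by rewrite pnatr_eq0 -lt0n.
have d0 : 0 < d by exact: powR_gt0.
have dN : d ^+ N = delta by rewrite -powR_mulrn ?(ltW d0) // -powRrM mulVf // powRr1 // ltW.
have dd : d < dmax.
  by rewrite -(@ltr_pXn2r _ N) ?nnegrE ?(ltW d0) ?(ltW dmax0) // dN.
have d2000 : 2000 * d <= 1.
  by rewrite mulrC -ler_pdivlMr ?ltr0n //; exact: le_trans (ltW dd) dmax1.
have d1 : d < 1 by move: d2000 d0; lra.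
have del_d : delta <= d.
  rewrite -dN -[leRHS]expr1; apply: ler_wiXn2l => //; exact: ltW.
have powE r : delta `^ r = d `^ (N%:R * r) by rewrite powRrM powR_mulrn ?(ltW d0) // dN.
set n := #|` fset_set P|%fset in Pcard.
have nlow : delta `^ (- t) / 2 <= n%:R.
  have : 2 <= delta `^ (- t).
    have h : d `^ (-1) <= delta `^ (- t).
      rewrite powE le_pw //; have : 1 <= N%:R :> R by rewrite ler1n.
      by move=> N1; have := ler_pM ler01 ler01 N1 (ltW t1); lra.
    apply: le_trans h; rewrite powRN powRr1 ?(ltW d0) // -[leRHS]mul1r ler_pdivlMr //.
    by move: d2000 d0; lra.
  by move: Pcard; rewrite ltr_norml => /andP[h1 _] h2; lra.
have npos : 0 < n%:R :> R by apply: lt_le_trans nlow; rewrite divr_gt0 // powR_gt0.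
have Pn0 : P !=set0.
  have : fset_set P != fset0 by rewrite -cardfs_gt0 -(ltr0n R).
  by move=> /fset0Pn[p]; rewrite in_fset_set // inE => Pp; exists p.
pose fl := @flagclass R delta P TT.
pose wt := @weight R delta P TT.
have wt0 : forall e, 0 <= wt e by exact: weight_ge0.
have tot := weight_total Pfin tubes Pn0.
have part b : \sum_(e | fl b e) wt e <= 1.
  rewrite /fl /wt -tot; case: b; first by rewrite lerDl sumr_ge0.
  by rewrite lerDr sumr_ge0.
have [b hb] : exists b, 1 / 2 <= \sum_(e | fl b e) wt e.
  have [h|h] := lerP (1 / 2) (\sum_(e | fl true e) wt e); first by exists true.
  by exists false; move: tot h; rewrite -/fl -/wt; lra.
pose I : finType := {e | e \in fl b}.
pose m (e : I) := wt (val e).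
pose pt (e : I) : plane R := val (val e).1.
pose x e := axis1 b (pt e); pose y e := axis2 b (pt e).
pose a (e : I) : R := slope b (dir (val e)).
have msum : \sum_e m e = \sum_(e | fl b e) wt e.
  exact: (esym (big_sub (fl b) wt)).
have Ppt e : P (pt e) by exact: pointP.
have hxy e : 0 <= x e <= 1 /\ 0 <= y e <= 1.
  by have [] := unit_squareP Punit (Ppt e); rewrite /x /y; case: (b).
have hd : 0 < d < dmax by rewrite d0.
have flI (e : I) : fl b (val e) by exact: (valP e).
have steepI (e : I) : steep (dir (val e)) = b by have /andP[_ /eqP] := flI e.
have frost (e : I) w : d ^+ N <= w <= 1 ->
  \sum_(e' | [&& x e' == x e, y e' == y e & `|a e' - a e| <= w]) m e'
    <= d `^ (N%:R * (t - eta) - 1) * w `^ s.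
  rewrite dN => wP.
  have C1 : 1 <= delta `^ (- eta).
    by rewrite powE mulrN pw_ge1 // mulr_ge0 // ltW.
  have := class_frost del0 Punit Pfin tubes (flI e) hs C1 wP.
  have -> : \sum_(e' | [&& x e' == x e, y e' == y e & `|a e' - a e| <= w]) m e' =
     \sum_(e' : flag delta P TT | fl b e' && [&& axis1 b (val e'.1) == x e, axis2 b (val e'.1) == y e
        & `|slope b (dir e') - a e| <= w]) wt e'.
    rewrite big_mkcond [RHS]big_mkcondr.
    exact: (esym (big_sub (fl b) (fun e' : flag delta P TT =>
      if [&& axis1 b (val e'.1) == x e, axis2 b (val e'.1) == y e
        & `|slope b (dir e') - a e| <= w] then wt e' else 0))).
  move=> /le_trans; apply; rewrite -/n.
  have ws0 : 0 <= w `^ s by exact: powR_ge0.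
  rewrite mulrAC ler_wpM2r // ler_pdivrMr //.
  have -> : N%:R * (t - eta) - 1 = -1 + (N%:R * (- eta) + N%:R * t) by ring.
  rewrite !pwD // -!powE.
  (* The [-1] in the exponent pays for the factor 4 of [class_frost] and the factor 2 lost in
     rounding the number of points. *)
  have c8 : 8 <= d `^ (-1).
    rewrite powRN powRr1 ?(ltW d0) // -[leRHS]mul1r ler_pdivlMr //.
    by move: d2000 d0; lra.
  have nt : 1 <= 2 * (delta `^ t * n%:R).
    have : delta `^ t * (delta `^ (- t) / 2) <= delta `^ t * n%:R.
      by rewrite ler_wpM2l // powR_ge0.
    by rewrite mulrA -pwD // subrr powRr0; lra.
  have e0 : 0 <= delta `^ (- eta) by exact: powR_ge0.
  have h1 : 4 * delta `^ (- eta) * 1 <= 4 * delta `^ (- eta) * (2 * (delta `^ t * n%:R)).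
    by rewrite ler_wpM2l // mulr_ge0.
  have z0 : 0 <= delta `^ (- eta) * (delta `^ t * n%:R).
    by rewrite !mulr_ge0 // powR_ge0.
  have h2 := ler_wpM2r z0 c8.
  by move: h1 h2; lra.
have m0 (e : I) : 0 <= m e by exact: wt0.
have mlow : 1 / 2 <= \sum_e m e by rewrite msum.
have mup : \sum_e m e <= 1 by rewrite msum.
have a1 (e : I) : `|a e| <= 1 by have := slope_le1 (dir (val e)); rewrite steepI.
have [e [e' [ne lt]]] := main d hd I x y a m m0 mlow mup (fun e => (hxy e).1)
  (fun e => (hxy e).2) a1 frost.
exists (pt e), (pt e'), (nbhd delta (val (val e').2)).
have /andP[/asboolP Le' _] := flI e'.
have [_ _ TTe'] := central_line_through del0 tubes (Ppt e') Le'.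
split => //; first by move=> E; case/eqP: ne; rewrite /x /y E.
rewrite (direction_line del0 tubes (Ppt e') Le') -/(pt e').
apply/nbhd_lineP; apply: le_lt_trans (offset_slope_le _ _ _) _.
by move: lt; rewrite dN /y /x /a -/(dir (val e')) steepI.
Qed.
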